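(* Consider the lost-sales inventory model with sales logs, caps $\lambda_t\in[0,\bar D]$, carry-safe caps $a_t=\min_{s=t,\ldots,T}\lambda_s$ and $q_t=p_t/(h_t+p_t)$. Suppose the conditional noninformative-censoring assumption (see context) holds, $x_1\in[0,a_1]$ is fixed, and $F_t^-(a_t)>q_t$ for every $t\in[T]$. Let $\mathcal J_t=\{j\in[N_t]:b_t^j\ge a_t\}$, $m_t=|\mathcal J_t|$, and, for $j\in\mathcal J_t$, $W_t^j=\min\{Z_t^j,a_t\}$ (which equals $\min\{D_t^j,a_t\}$). Condition on the complete recorded boundary array. For a positive integer $n$, if $m_t\ge n$ in every period, choose any $n$ indices from each $\mathcal J_t$ using only the boundaries and form the empirical marginals of the selected $W_t^j$. Let $\widehat\pi^\times$ be Product ERM (see context) from $x_1$ under these marginals with the constraint $S_1\ge x_1$, equivalently empirical DP under these marginals. There is a universal constant $C>0$ such that, for any $0<\delta<1$ and $\epsilon>0$, $$n\ge C\frac{C_c^2\bar D^2T^2}{\epsilon^2}\left(1+\log\frac1\delta\right)$$ implies $$V_1^{\widehat\pi^\times}(x_1)-V_1^*(x_1)\le\epsilon$$ with conditional probability at least $1-\delta$. In particular, if $N$ raw observations are available in every period and $m_t\ge rN$ for every $t$, where $r\in(0,1]$, the sufficient raw total is $$TN=O\!\left(\frac Tr+\frac{C_c^2\bar D^2T^3}{r\epsilon^2}\left(1+\log\frac1\delta\right)\right).$$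
   Context: Lost-sales inventory model. Horizon $T$; $[n]=\{1,\ldots,n\}$, $u^+=\max\{u,0\}$. Demands $D_1,\ldots,D_T$ are independent with laws $P_t$ supported on $[0,\bar D]$, $\bar D>0$; $F_t^-(u)=\mathbb P(D_t<u)$. Holding and shortage coefficients $h_t,p_t>0$ are known, $C_c=\max_{t\in[T]}\max\{h_t,p_t\}$; fixed and per-unit ordering costs, lead time, and terminal salvage value are zero. Starting period $t$ with inventory $x_t\ge0$, the retailer chooses a post-order level $y_t\ge x_t$ before demand and incurs $c_t(y_t,D_t)$ with $c_t(y,d)=h_t(y-d)^++p_t(d-y)^+$. The next state is $(y_t-D_t)^+$; only sales $\min\{D_t,y_t\}$ are observed. Feasible policies use the information then available and may randomize; $V_t^\pi(x)$ is the expected total cost (under the original demands $D_t$, on a fresh trajectory independent of the offline data) from period $t$ and state $x$, and $V_t^*(x)=\inf_\pi V_t^\pi(x)$. Sales logs and caps. Offline data are logs $((Z_t^j,b_t^j):t\in[T],j\in[N_t])$ with known boundary $b_t^j\ge0$ and $Z_t^j=\min\{D_t^j,b_t^j\}$, where $D_t^j$ is a latent fitting demand. Conditional noninformative censoring: conditional on the complete boundary array $\mathcal B=(b_t^j)$, all latent $D_t^j$ are mutually independent and $D_t^j$ has law $P_t$; each boundary is fixed or determined before its own demand. The numbers $\lambda_t$ are chosen before observing fitting demands, or using only $\mathcal B$; an independent pilot is also allowed if, conditional on the pilot, design information, and complete boundaries, fitting demands remain independent with laws $P_t$. The raw total counts all logs, including those not in $\mathcal J_t$. Product ERM. Given empirical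 marginals $\widehat P_t$ (here, the uniform distribution on the $n$ selected values $W_t^j$), let $\widehat P^\times=\bigotimes_{t=1}^T\widehat P_t$. For $S\in[0,\bar D]^T$ let $\pi^S$ be the base-stock policy $\pi_t^S(x)=\max\{x,S_t\}$, and let $\ell_{x_1}(\pi;d_{1:T})$ be the realized total holding and shortage cost of $\pi$ along demands $d_{1:T}$ from initial stock $x_1$. Product ERM selects a minimizer of $\mathbb E_{\widehat P^\times}[\ell_{x_1}(\pi^S;D_{1:T})]$ over $S\in[0,\bar D]^T$ (here with $S_1\ge x_1$). Empirical DP implements this by replacing each demand law in the Bellman recursion $V_{T+1}=0$, $V_t(x)=\min_{y\ge\max\{x,0\}}\{\mathbb E[c_t(y,D_t)]+\mathbb E[V_{t+1}((y-D_t)^+)]\}$ by $\widehat P_t$. *)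

(* Defs.v *)
From HB Require Import structures.
From mathcomp Require Import all_boot all_order all_algebra.
From mathcomp Require Import all_classical all_reals all_analysis measurable_realfun.

Set Implicit Arguments.
Unset Strict Implicit.
Unset Printing Implicit Defensive.
Import Order.TTheory GRing.Theory Num.Theory.
Import numFieldNormedType.Exports.
Local Open Scope classical_set_scope.
Local Open Scope ring_scope.

(* Periods are 0, ..., T - 1.  Families indexed by periods are functions on nat
   whose values at t >= T never matter. *)

Record inventory (R : realType) := Inventory {
  horizon : nat ;
  hold : nat -> R ;
  short : nat -> R ;
  dmax : R ;
  horizon_gt0 : (0 < horizon)%N ;
  hold_gt0 : forall t, (t < horizon)%N -> 0 < hold t ;
  short_gt0 : forall t, (t < horizon)%N -> 0 < short t ;
  dmax_gt0 : 0 < dmax }.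

Section product_law.
Context {R : realType}.
Local Notation MR := (measurableTypeR R).

Definition prepend n (u : MR * n.-tuple MR) : n.+1.-tuple MR :=
  [the n.+1.-tuple MR of u.1 :: u.2].

Lemma measurable_prepend n : measurable_fun [set: MR * n.-tuple MR] (@prepend n).
Proof. by apply: measurable_cons. Qed.

HB.instance Definition _ n :=
  isMeasurableFun.Build _ _ _ _ (@prepend n) (@measurable_prepend n).

Fixpoint product_law (Q : nat -> probability MR R) (n : nat) :
    probability (n.-tuple MR) R :=
  match n with
  | 0 => \d_([tuple] : 0.-tuple MR)
  | n'.+1 => distribution (Q 0%N \x product_law (fun t => Q t.+1) n')%E
                          (@prepend n')
  end.

End product_law.

Section model.
Context {R : realType}.
Local Notation MR := (measurableTypeR R).
Variable M : inventory R.
Local Notation T := (horizon M).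

Definition cost t (y d : R) : R :=
  hold M t * Num.max (y - d) 0 + short M t * Num.max (d - y) 0.

Definition cost_bound : R := \big[Num.max/0]_(t < T) Num.max (hold M t) (short M t).

Definition critical_ratio t : R := short M t / (hold M t + short M t).

Definition supported (P : nat -> probability MR R) : Prop :=
  forall t, (t < T)%N -> P t [set` `[0, dmax M]] = 1%E.

(* Randomization is through a private seed, drawn independently of the demands.
   The history available in period t lists (x_s, y_s, min(D_s, y_s)) for s < t;
   the last argument of [order] is the current stock x_t. *)
Record policy := Policy {
  seed_display : measure_display ;
  seed : measurableType seed_display ;
  seed_law : probability seed R ;
  order : forall t, seed * t.-tuple (MR * MR * MR) * MR -> MR ;
  measurable_order : forall t, measurable_fun setT (order (t := t)) ;
  order_ge : forall t s (hst : t.-tuple (MR * MR * MR)) (x : MR),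
    0 <= x :> R -> x <= order (s, hst, x) :> R }.

Fixpoint run (pi : policy) (s : seed pi) (x1 : R) (d : nat -> R) (t : nat) :
    MR * t.-tuple (MR * MR * MR) :=
  match t with
  | 0 => (x1, [tuple])
  | t'.+1 =>
    let: (x, hst) := run s x1 d t' in
    let y : R := order (s, hst, x) in
    (Num.max (y - d t') 0, [tuple of rcons hst (x, y, Num.min (d t') y)])
  end.

Definition loss (pi : policy) (s : seed pi) (x1 : R) (d : T.-tuple MR) : R :=
  \sum_(t < T)
    let: (x, hst) := run s x1 (nth 0 d) t in cost t (order (s, hst, x)) (nth 0 d t).

Definition policy_value (P : nat -> probability MR R) (pi : policy) (x1 : R) :
    \bar R :=
  (\int[seed_law pi \x product_law P T]_w (loss w.1 x1 w.2)%:E)%E.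

Definition opt_value (P : nat -> probability MR R) (x1 : R) : \bar R :=
  ereal_inf [set v | exists pi : policy, v = policy_value P pi x1].

Section base_stock.
Variable S : nat -> R.

Definition base_stock_order t (w : unit * t.-tuple (MR * MR * MR) * MR) : MR :=
  Num.max (w.2 : R) (S t).

Lemma measurable_base_stock_order t : measurable_fun setT (@base_stock_order t).
Proof. by apply: measurable_maxr => //; exact: measurable_snd. Qed.

Lemma base_stock_order_ge t s (hst : t.-tuple (MR * MR * MR)) (x : MR) :
  0 <= x :> R -> x <= base_stock_order (s, hst, x) :> R.
Proof. by move=> _; rewrite /base_stock_order /= le_max lexx. Qed.

Definition base_stock : policy :=
  Policy (\d_tt : probability unit R) measurable_base_stock_order base_stock_order_ge.

End base_stock.

Definition feasible_levels (x1 : R) (S : nat -> R) : Prop :=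
  (forall t, (t < T)%N -> 0 <= S t <= dmax M) /\ x1 <= S 0%N.

Definition product_risk (Q : nat -> probability MR R) (x1 : R) (S : nat -> R) :
    \bar R :=
  (\int[product_law Q T]_d (@loss (base_stock S) tt x1 d)%:E)%E.

Definition product_erm (Q : nat -> probability MR R) (x1 : R) (S : nat -> R) : Prop :=
  feasible_levels x1 S /\
  forall S', feasible_levels x1 S' -> (product_risk Q x1 S <= product_risk Q x1 S')%E.

(* [bellman Q k t] is the value function of period t when k periods remain. *)
Definition cost_to_go (Q : nat -> probability MR R) (V : R -> \bar R) t (y : R) :
    \bar R :=
  (\int[Q t]_d (cost t y d)%:E + \int[Q t]_d V (Num.max (y - d) 0)%R)%E.

Fixpoint bellman (Q : nat -> probability MR R) (k t : nat) (x : R) : \bar R :=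
  match k with
  | 0 => 0%E
  | k'.+1 =>
    ereal_inf [set cost_to_go Q (bellman Q k' t.+1) t y | y in [set y | Num.max x 0 <= y]]
  end.

Definition dp_minimizer (Q : nat -> probability MR R) t (x y : R) : Prop :=
  let G := cost_to_go Q (bellman Q (T - t.+1) t.+1) t in
  Num.max x 0 <= y /\ forall y', Num.max x 0 <= y' -> (G y <= G y')%E.

(* Levels selected by dynamic programming under Q from x1: the order-up-to
   decision attains the Bellman minimum at every state the policy visits (almost
   surely under the product law); unvisited states are left unconstrained. *)
Definition product_dp (Q : nat -> probability MR R) (x1 : R) (S : nat -> R) : Prop :=
  feasible_levels x1 S /\
  {ae product_law Q T, forall d : T.-tuple MR, forall t, (t < T)%N ->
     let x : R := (@run (base_stock S) tt x1 (nth 0 d) t).1 in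
     dp_minimizer Q t x (Num.max x (S t))}.

End model.

(* g is a version of the conditional probability of E given the sub-sigma-algebra G. *)
Definition cond_probability (R : realType) (d : measure_display)
    (Omega : measurableType d) (Pr : probability Omega R)
    (G : set (set Omega)) (E : set Omega) (g : Omega -> R) : Prop :=
  [/\ measurable E,
      forall A : set (measurableTypeR R), measurable A -> G (g @^-1` A) &
      forall B, G B -> (\int[Pr]_(w in B) (g w)%:E)%E = Pr (E `&` B)].

(* The j-th log of period t (j < nlogs t) consists of the boundary and of the sales
   min(demand, boundary); the demand is latent.  [pilot] collects pilot data and
   design information and may be trivial (e.g. unit-valued). *)
Record sales_logs (R : realType) (d : measure_display) (Omega : measurableType d) :=
  SalesLogs {
  nlogs : nat -> nat ;
  latent : nat -> nat -> Omega -> measurableTypeR R ;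
  boundary : nat -> nat -> Omega -> measurableTypeR R ;
  pilot_display : measure_display ;
  pilot_space : measurableType pilot_display ;
  pilot : Omega -> pilot_space ;
  measurable_latent : forall t j, measurable_fun setT (latent t j) ;
  measurable_boundary : forall t j, measurable_fun setT (boundary t j) ;
  measurable_pilot : measurable_fun setT pilot ;
  boundary_ge0 : forall t j w, 0 <= boundary t j w :> R }.

Section offline.
Context {R : realType} {d : measure_display} {Omega : measurableType d}.
Local Notation MR := (measurableTypeR R).
Variables (M : inventory R) (P : nat -> probability MR R).
Variables (Pr : probability Omega R) (L : sales_logs R Omega).
Local Notation T := (horizon M).

(* Conditioning sigma-algebra, generated by the complete boundary array and the pilot. *)
Definition design : set (set Omega) :=
  <<s [set E | (exists t j (A : set MR),
                 [/\ (t < T)%N, (j < nlogs L t)%N, measurable A &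
                     E = boundary L t j @^-1` A]) \/
               (exists A : set (pilot_space L),
                 measurable A /\ E = pilot L @^-1` A)] >>.

Definition noninformative_censoring : Prop :=
  forall A : nat -> nat -> set MR, (forall t j, measurable (A t j)) ->
    cond_probability Pr design
      [set w | forall t j, (t < T)%N -> (j < nlogs L t)%N -> A t j (latent L t j w)]
      (fun=> \prod_(t < T) \prod_(j < nlogs L t) fine (P t (A t j))).

Definition admissible_caps (lam : nat -> Omega -> R) : Prop :=
  forall t, (t < T)%N ->
    (forall A : set MR, measurable A -> design (lam t @^-1` A)) /\
    (forall w, 0 <= lam t w <= dmax M).

Variables (lam : nat -> Omega -> R) (x1 : R).

Definition carry_safe_cap t w : R := \big[Num.min/lam t w]_(t <= s < T) lam s w.

Definition caps_valid w : Prop :=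
  x1 <= carry_safe_cap 0 w /\
  forall t, (t < T)%N -> ((critical_ratio M t)%:E < P t [set` `]-oo, carry_safe_cap t w[])%E.

Definition sales t j w : R := Num.min (latent L t j w : R) (boundary L t j w : R).

Definition eligible t w : {set 'I_(nlogs L t)} :=
  [set j : 'I_(nlogs L t) | carry_safe_cap t w <= (boundary L t j w : R)]%SET.

Definition capped_sales t j w : R := Num.min (sales t j w) (carry_safe_cap t w).

(* n indices are picked in each period, on the basis of the design alone. *)
Definition selection (n : nat) (sel : forall t, Omega -> {set 'I_(nlogs L t)}) : Prop :=
  (forall t, (t < T)%N -> forall A : {set 'I_(nlogs L t)}, design (sel t @^-1` [set A])) /\
  (forall w, (forall t, (t < T)%N -> (n <= #|eligible t w|)%N) ->
     forall t, (t < T)%N -> (sel t w \subset eligible t w) /\ #|sel t w| = n).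

(* The uniform distribution on the entries of s, with multiplicity; the second
   argument of mnormalize is only the default value for the empty sequence. *)
Definition empirical (s : seq R) : probability MR R :=
  mnormalize (msum (fun i => \d_(nth 0 s i : MR)) (size s)) \d_(0 : MR).

Definition empirical_marginals (sel : forall t, Omega -> {set 'I_(nlogs L t)}) w :
    nat -> probability MR R :=
  fun t => empirical [seq capped_sales t j w | j : 'I_(nlogs L t) <- enum (sel t w)].

(* On the event Ev, Product ERM and empirical dynamic programming coincide. *)
Definition erm_is_dp (n : nat) (Ev : Omega -> Prop) : Prop :=
  forall sel, selection n sel ->
    {ae Pr, forall w, Ev w -> forall S,
       product_erm M (empirical_marginals sel w) x1 S <->
       product_dp M (empirical_marginals sel w) x1 S}.

(* On the event Ev, for every selection of n logs per period and every (measurable)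
   choice of Product ERM levels, the regret is at most eps with conditional
   probability at least 1 - delta given the design. *)
Definition erm_guarantee (n : nat) (eps delta : R) (Ev : Omega -> Prop) : Prop :=
  forall sel, selection n sel ->
  forall Shat : nat -> Omega -> MR,
    (forall t, (t < T)%N -> measurable_fun setT (Shat t)) ->
    {ae Pr, forall w, Ev w -> product_erm M (empirical_marginals sel w) x1 (Shat ^~ w)} ->
  exists g : Omega -> R,
    cond_probability Pr design
      [set w | (policy_value M P (base_stock (Shat ^~ w)) x1 - opt_value M P x1 <= eps%:E)%E]
      g /\
    {ae Pr, forall w, Ev w -> 1 - delta <= g w}.

End offline.

(* Main.v *)
Require Import Defs.
From HB Require Import structures.
From mathcomp Require Import all_boot all_order all_algebra.
From mathcomp Require Import all_classical all_reals all_analysis measurable_realfun.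
From mathcomp Require Import ring lra zify.
Set Implicit Arguments.
Unset Strict Implicit.
Unset Printing Implicit Defensive.
Import Order.TTheory GRing.Theory Num.Theory.
Import numFieldNormedType.Exports.
Local Open Scope classical_set_scope.
Local Open Scope ring_scope.

(* The regret of the selected levels is at most the supremum over S of the difference
   between the true and the empirical centred product risks, the caps being harmless
   because some optimal levels and all the empirical ones lie below a_t, where capping the
   demands shifts every loss by the same amount.  The empirical product risk is a
   T-sample V-statistic: averaging over cyclic shifts of the n samples of each period
   rewrites it as a mean of averages over n independent trajectories, so Jensen's
   inequality and symmetrization reduce its exponential moments to a Rademacher process.
   The post-order level in period t is max_j (S_j - (d_j + ... + d_(t-1))), that is,
   max_j (s_j - e_j) for nonincreasing curves s (depending on S) and e (depending on the
   demands).  At scale 2^-k such levels are described by O(k 2^k) bits in mean square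
   over any sample, hence chaining bounds the process by O(T C D / sqrt n) without
   logarithms.  Demands and levels are rounded to a grid, so that noninformative
   censoring is only used on rectangles.  Product ERM and empirical DP coincide because
   the cost of a policy is the value function plus its Bellman gaps. *)

(** * Rademacher chaining *)

(** What removes the logarithms is one product. Along the time axis the level curve and the n demand
    curves are all monotone with range D. If time is cut into about 4^k cells by the joint variation
    of the demand curves, the error inside a cell is, up to rounding, at most the minimum of two
    oscillations, and min(a, b)^2 <= a b. One factor is summed over the samples within a cell, the
    other over the cells; this gives n D^2 / 4^k although only about 2^k crossing positions per
    curve are stored. Entropy k 2^k against variance 4^-k makes the chain converge geometrically.
    The cells depend on the sample, which is why the signs come first: under the Rademacher mean the
    sample is frozen. The factor T^2 comes from separating the periods by Jensen's inequality. Only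
    differences with one fixed optimal vector of levels enter, so one-sided deviations suffice. The
    concentration argument consists of finite weighted sums over grid points, so that no law on the
    space of samples has to be constructed. *)

Lemma eq_ler {R : numDomainType} (x y : R) : x = y -> x <= y.
Proof. by move->. Qed.

Section exponential_inequalities.
Context {R : realType}.
Implicit Types x y : R.

(** The tangent of the exponential at the mean [m] lies below its graph, and the linear terms
    average to zero. *)
Lemma expR_jensen (I : finType) (w x : I -> R) :
  (forall i, 0 <= w i) -> \sum_i w i = 1 ->
  expR (\sum_i w i * x i) <= \sum_i w i * expR (x i).
Proof.
move=> w0 w1; set m := \sum_i w i * x i.
have -> : expR m = \sum_i w i * (expR m * (1 + (x i - m))).
  rewrite (eq_bigr (fun i => expR m * (w i * x i + w i * (1 - m)))); last first.
    by move=> i _; ring.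
  rewrite -mulr_sumr big_split /= -mulr_suml w1 -/m; ring.
apply: ler_sum => i _; apply: ler_wpM2l => //.
have -> : expR (x i) = expR m * expR (x i - m) by rewrite -expRD; congr expR; ring.
by apply: ler_wpM2l; rewrite ?expR_ge0 ?expR_ge1Dx.
Qed.

Lemma expR_le_geometric x : x < 1 -> expR x <= (1 - x)^-1.
Proof.
move=> x1; have h := expR_ge1Dx (- x).
rewrite -[leLHS]invrK -expRN lef_pV2 ?posrE ?expR_gt0 //; lra.
Qed.

(** The constant 2, instead of the sharp 1/2, allows an elementary proof: the geometric bound for
    x^2 <= 1/2, and x, - x <= 2 x^2 otherwise. *)
Lemma cosh_le x : (expR x + expR (- x)) / 2 <= expR (2 * x ^+ 2).
Proof.
have sq1 := sqr_ge0 (x - 2^-1); have sq2 := sqr_ge0 (x + 2^-1).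
have E1 : (x - 2^-1) ^+ 2 = x ^+ 2 - x + 4^-1 by field.
have E2 : (x + 2^-1) ^+ 2 = x ^+ 2 + x + 4^-1 by field.
have [x2|x2] := lerP (x ^+ 2) (1 / 2).
  have x1 : x < 1 by lra.
  have x3 : - x < 1 by lra.
  have h1 := expR_le_geometric x1; have h2 := expR_le_geometric x3.
  have h3 := expR_ge1Dx (2 * x ^+ 2).
  have h4 : (1 - x)^-1 + (1 - - x)^-1 = 2 * (1 - x ^+ 2)^-1.
    by field; apply/and3P; split; apply/eqP; lra.
  have h5 : (1 - x ^+ 2)^-1 <= 1 + 2 * x ^+ 2.
    rewrite -[leLHS]mul1r ler_pdivrMr; last lra.
    have -> : (1 + 2 * x ^+ 2) * (1 - x ^+ 2) = 1 + x ^+ 2 * (1 - 2 * x ^+ 2) by ring.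
    by rewrite lerDl mulr_ge0 ?sqr_ge0 //; lra.
  lra.
have le_exp y : y <= 2 * x ^+ 2 -> expR y <= expR (2 * x ^+ 2) by rewrite ler_expR.
have := le_exp x ltac:(lra); have := le_exp (- x) ltac:(lra); lra.
Qed.

End exponential_inequalities.

Section rademacher.
Context {R : realType} {n : nat}.

Definition rsum (s : {ffun 'I_n -> bool}) (a : 'I_n -> R) : R :=
  \sum_i (-1) ^+ s i * a i.

Definition rmean (F : {ffun 'I_n -> bool} -> R) : R := 2^-1 ^+ n * \sum_s F s.

Lemma rmean_le F G : (forall s, F s <= G s) -> rmean F <= rmean G.
Proof.
by move=> FG; apply: ler_wpM2l; [rewrite exprn_ge0 ?invr_ge0|apply: ler_sum].
Qed.

Lemma rmean_cst c : rmean (fun=> c) = c.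
Proof.
rewrite /rmean sumr_const card_ffun card_bool card_ord -(mulr_natr c) natrX.
by rewrite mulrCA -exprMn mulVf ?expr1n ?mulr1 ?pnatr_eq0.
Qed.

Lemma rmeanD F G : rmean (fun s => F s + G s) = rmean F + rmean G.
Proof. by rewrite /rmean big_split mulrDr. Qed.

Lemma rmeanZ c F : rmean (fun s => c * F s) = c * rmean F.
Proof. by rewrite /rmean -mulr_sumr mulrCA. Qed.

Lemma rmean_sum (I : Type) (r : seq I) (Q : pred I) (F : I -> {ffun 'I_n -> bool} -> R) :
  rmean (fun s => \sum_(i <- r | Q i) F i s) = \sum_(i <- r | Q i) rmean (F i).
Proof. by rewrite /rmean exchange_big /= mulr_sumr. Qed.

Lemma rmean_expR (a : 'I_n -> R) :
  rmean (fun s => expR (rsum s a)) <= expR (2 * \sum_i a i ^+ 2).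
Proof.
rewrite /rmean.
have -> : \sum_s expR (rsum s a) = \prod_i (\sum_(b : bool) expR ((-1) ^+ b * a i)).
  by rewrite bigA_distr_bigA /=; apply: eq_bigr => s _; rewrite expR_sum.
have -> : 2^-1 ^+ n = \prod_(i < n) 2^-1 :> R by rewrite prodr_const card_ord.
rewrite -big_split /= mulr_sumr expR_sum; apply: ler_prod => i _.
rewrite big_bool /= expr0 expr1 mul1r mulN1r; apply/andP; split.
  by rewrite mulr_ge0 ?invr_ge0 // addr_ge0 ?expR_ge0.
by have := cosh_le (a i); rewrite [expR (- _) + _]addrC mulrC.
Qed.

End rademacher.

(** The missing mass is put on an extra point of value 0, whose exponential contributes at most 1.
    This spares normalising the chaining weights, which sum to less than 1 over finitely many
    scales. *)
Lemma expR_subjensen {R : realType} (I : finType) (w x : I -> R) :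
  (forall i, 0 <= w i) -> \sum_i w i <= 1 ->
  expR (\sum_i w i * x i) <= \sum_i w i * expR (x i) + 1.
Proof.
move=> w0 w1; pose w' o := if o is Some i then w i else 1 - \sum_i w i.
pose x' o := if o is Some i then x i else 0.
have sumo (f : option I -> R) : \sum_o f o = f None + \sum_i f (Some i).
  rewrite (bigD1 None) //=; congr (_ + _).
  rewrite (reindex_omap Some id) /=; last by case.
  by apply: eq_bigl => i; rewrite eqxx.
have := @expR_jensen R _ w' x'; rewrite !sumo /= mulr0 add0r expR0 mulr1.
move=> /(_ _ _)/le_trans; apply.
- by case=> [i|] //=; rewrite subr_ge0.
- by rewrite subrK.
- rewrite addrC lerD2l lerBlDr lerDl; exact: sumr_ge0.
Qed.

Section rademacher_maximum.
Context {R : realType} {n : nat} (F : finType).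
Implicit Types a : F -> 'I_n -> R.

Lemma rsumZ s c (a : 'I_n -> R) : rsum s (fun i => c * a i) = c * rsum s a.
Proof. by rewrite /rsum mulr_sumr; apply: eq_bigr => i _; ring. Qed.

Lemma rsum_le s (a : 'I_n -> R) : rsum s a <= \sum_i `|a i|.
Proof.
apply: ler_sum => i _; rewrite (le_trans (ler_norm _)) //.
by rewrite normrM normrX normrN1 expr1n mul1r.
Qed.

Definition maxexp (s : {ffun 'I_n -> bool}) a : R :=
  \big[Num.max/0]_S expR (rsum s (a S)).

(* The moment of order H ~ log #|G| controls the expected maximum. *)
Lemma rmean_maxexp (G : finType) (code : F -> G) a (H : nat) v :
  (#|G| <= 2 ^ H.+1)%N ->
  (forall S S', code S = code S' -> a S =1 a S') ->
  (forall S, \sum_i a S i ^+ 2 <= v) ->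
  rmean (fun s => maxexp s a) <= 4 * expR (2 * H.+1%:R * v).
Proof.
(* [U] balances the truncation z <= U + U^-H z^(H+1): summed over at most 2^(H+1) codes, the moments
   of order H + 1 have mean at most U^(H+1). *)
move=> cardG acode av; set U := 2 * expR (2 * H.+1%:R * v).
have U0 : 0 < U by rewrite mulr_gt0 ?expR_gt0.
(* Each code is represented by one of its preimages; [K] discards the codes without preimage. *)
pose b g i := if [pick S | code S == g] is Some u then H.+1%:R * a u i else 0.
pose K g : R := if [pick S | code S == g] is Some _ then 1 else 0.
have K0 g : 0 <= K g by rewrite /K; case: pickP.
have le1 s : maxexp s a <= U + (U ^+ H)^-1 * \sum_g K g * expR (rsum s (b g)).
  have T0 g : 0 <= K g * expR (rsum s (b g)) by rewrite mulr_ge0 ?expR_ge0.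
  apply: bigmax_le => [|S _].
    rewrite addr_ge0 ?(ltW U0) // mulr_ge0 ?sumr_ge0 //.
    by rewrite invr_ge0 exprn_ge0 // ltW.
  set z := expR _; have z0 : 0 < z by exact: expR_gt0.
  apply: (@le_trans _ _ (U + (U ^+ H)^-1 * z ^+ H.+1)).
    have [zU|Uz] := lerP z U.
      rewrite -[leLHS]addr0 lerD // mulr_ge0 ?exprn_ge0 ?invr_ge0 ?(ltW z0) //.
      by rewrite exprn_ge0 // ltW.
    rewrite -[leLHS]add0r lerD ?(ltW U0) // exprS mulrCA ler_peMr ?(ltW z0) //.
    rewrite mulrC ler_pdivlMr ?exprn_gt0 // mul1r.
    by apply: lerXn2r; rewrite ?nnegrE ?ltW.
  rewrite lerD2l ler_wpM2l ?invr_ge0 ?exprn_ge0 ?(ltW U0) //.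
  rewrite (bigD1 (code S)) //= -[leLHS]addr0 lerD ?sumr_ge0 //.
  rewrite /K /b; case: pickP => [S' /eqP SS'|/(_ S)]; last by rewrite eqxx.
  rewrite mul1r rsumZ expRM_natl /z (_ : rsum s (a S) = rsum s (a S')) //.
  by apply: eq_bigr => i _; rewrite (acode S S').
apply: (le_trans (rmean_le le1)).
rewrite rmeanD rmean_cst rmeanZ rmean_sum.
have le2 : \sum_g rmean (fun s => K g * expR (rsum s (b g))) <= U ^+ H.+1.
  apply: (@le_trans _ _ (\sum_(g : G) expR (2 * (H.+1%:R ^+ 2 * v)))).
    apply: ler_sum => g _; rewrite rmeanZ /K /b; case: pickP => [S _|_].
      rewrite mul1r (le_trans (rmean_expR _)) // ler_expR ler_pM2l //.
      under eq_bigr do rewrite exprMn.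
      by rewrite -mulr_sumr ler_pM2l ?exprn_gt0.
    by rewrite mul0r expR_ge0.
  rewrite sumr_const -[_ *+ _]mulr_natl /U exprMn -expRM_natl;
  apply: ler_pM; rewrite ?expR_ge0 ?ler0n //.
    by rewrite -natrX ler_nat.
  by rewrite ler_expR; apply: eq_ler; ring.
have := ler_wpM2l (_ : 0 <= (U ^+ H)^-1) le2; rewrite invr_ge0 exprn_ge0 ?(ltW U0) //.
move=> /(_ isT); rewrite exprS [U * _]mulrC mulKf ?expf_neq0 ?gt_eqF // => le3.
apply: (le_trans (lerD (lexx U) le3)); rewrite /U; apply: eq_ler; ring.
Qed.

End rademacher_maximum.

(** Bits (k + 1) 2^k, times variance 4^-k, times the inverse square of the weight (4/5)^k with which
    scale k enters the chain: the net ratio is 25/32 < 1. *)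
Lemma chaining_rate {R : realType} k :
  k.+1%:R * 2 ^+ k * (4 ^+ k)^-1 * ((4 / 5) ^- k) ^+ 2 <= 4 :> R.
Proof.
have -> : k.+1%:R * 2 ^+ k * (4 ^+ k)^-1 * ((4 / 5) ^- k) ^+ 2
    = k.+1%:R * (25 / 32) ^+ k :> R.
  rewrite -!mulrA; congr (_ * _); rewrite -!exprVn -exprM mulnC exprM -!exprMn.
  by congr (_ ^+ _); field.
elim: k => [|k IH]; first by rewrite expr0 mulr1; lra.
rewrite exprS mulrCA; have [k0|k3] := leqP k 2.
  by move: k k0 {IH} => [|[|[|]]] //= _; rewrite ?expr0 ?expr1 ?expr2; lra.
have h : k.+2%:R * (25 / 32) <= k.+1%:R :> R.
  have : 4%:R <= k.+1%:R :> R by rewrite ler_nat.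
  by rewrite -(natr1 k.+1); lra.
have h0 : 0 <= (25 / 32) ^+ k :> R by rewrite exprn_ge0.
by have := ler_wpM2r h0 h; lra.
Qed.

Section chaining.
Context {R : realType} {n : nat} (F : finType).
Variables (y : F -> 'I_n -> R) (D : R) (G : nat -> finType) (code : forall k, F -> G k).
Variables (psi : 'I_n -> R -> R) (C : R) (z : 'I_n -> R).
Hypothesis n_gt0 : (0 < n)%N.
Hypothesis D_ge0 : 0 <= D.
Hypothesis C_ge0 : 0 <= C.
Hypothesis card_code : forall k, (#|G k| <= 2 ^ (4 * k.+1 * 2 ^ k))%N.
Hypothesis code_fine : forall k S S', code k S = code k S' ->
  \sum_i (y S i - y S' i) ^+ 2 <= n%:R * (6 * D ^+ 2 / 4 ^+ k).
Hypothesis psi_lip : forall i u v, `|psi i u - psi i v| <= C * `|u - v|.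
Hypothesis y_near : forall S i, `|y S i - z i| <= D.

(** Elements with equal codes get the same representative ([rep_code]), so [level k] is a function
    of the code. The default branch never occurs, [S] itself being a candidate. *)
Let rep k (S : F) : F := if [pick u | code k u == code k S] is Some u then u else S.

Let code_rep k S : code k (rep k S) = code k S.
Proof. by rewrite /rep; case: pickP => [u /eqP|/(_ S)] //; rewrite eqxx. Qed.

Let rep_code k S S' : code k S = code k S' -> rep k S = rep k S'.
Proof.
by rewrite /rep => ->; case: pickP => // /(_ S'); rewrite eqxx.
Qed.

Let level k S i := psi i (y (rep k S) i).
Let link k S i := level k S i - (if k is k'.+1 then level k' S i else psi i (z i)).

Let psi_sq i u v : (psi i u - psi i v) ^+ 2 <= C ^+ 2 * (u - v) ^+ 2.
Proof.
rewrite -exprMn -[leLHS]real_normK ?num_real // -[leRHS]real_normK ?num_real //.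
by rewrite lerXn2r ?nnegrE // [leRHS]normrM (ger0_norm C_ge0).
Qed.

Let link_sq k S : \sum_i link k S i ^+ 2 <= 60 * (n%:R * C ^+ 2 * D ^+ 2) / 4 ^+ k.
Proof.
case: k => [|k]; rewrite /link /level.
  apply: (@le_trans _ _ (\sum_(i < n) C ^+ 2 * D ^+ 2)).
    apply: ler_sum => i _; apply: (le_trans (psi_sq _ _ _)).
    apply: ler_wpM2l; first exact: sqr_ge0.
    rewrite -[leLHS]real_normK ?num_real //.
    by rewrite lerXn2r ?nnegrE.
  rewrite sumr_const card_ord -[_ *+ _]mulr_natl expr0 divr1 -mulrA.
  by apply: ler_peMl; [rewrite !mulr_ge0 ?sqr_ge0|lra].
(* Both representatives are compared with [S] itself; relative to 4^(k+1) this costs 2 * (6 + 4 * 6)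
   = 60. *)
apply: (@le_trans _ _ (\sum_i C ^+ 2 *
   (2 * ((y (rep k.+1 S) i - y S i) ^+ 2 + (y (rep k S) i - y S i) ^+ 2)))).
  apply: ler_sum => i _; apply: (le_trans (psi_sq _ _ _)).
  apply: ler_wpM2l; first exact: sqr_ge0.
  move: (y (rep k.+1 S) i) (y (rep k S) i) (y S i) => a b c.
  have := sqr_ge0 (a - c + (b - c)).
  have -> : (a - b) ^+ 2 = 2 * ((a - c) ^+ 2 + (b - c) ^+ 2) - (a - c + (b - c)) ^+ 2.
    by ring.
  lra.
rewrite -mulr_sumr -mulr_sumr big_split /= mulrA.
have h1 := code_fine (code_rep k.+1 S); have h2 := code_fine (code_rep k S).
have C2 : 0 <= C ^+ 2 * 2 by rewrite mulr_ge0 ?sqr_ge0.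
apply: (le_trans (ler_wpM2l C2 (lerD h1 h2))).
apply: eq_ler; rewrite [4 ^+ k.+1]exprS; field.
by rewrite expf_neq0.
Qed.

Let fine_level : exists K, forall S i, `|y (rep K S) i - y S i| <= D / n%:R.
Proof.
(* One squared coordinate is at most the sum of squares; 4^K >= 6 n^3 brings n * 6 D^2 / 4^K below
   (D / n)^2. *)
have [K KE] : exists K, K = (6 * n ^ 3)%N by exists (6 * n ^ 3)%N.
exists K => S i.
have n0 : 0 < n%:R :> R by rewrite ltr0n.
have h1 := code_fine (code_rep K S).
rewrite -(@ler_pXn2r _ 2) ?nnegrE ?mulr_ge0 ?invr_ge0 ?ler0n //.
rewrite real_normK ?num_real //.
apply: le_trans (le_trans h1 _).
  by rewrite (bigD1 i) //= lerDl sumr_ge0 // => j _; exact: sqr_ge0.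
have K4 : 6 * n%:R ^+ 3 <= 4 ^+ K :> R.
  by rewrite -!natrX -natrM ler_nat -KE ltnW // ltn_expl.
have K0 : 0 < 4 ^+ K :> R by rewrite exprn_gt0.
move: (4 ^+ K : R) (n%:R : R) K4 K0 n0 => q m K4 K0 n0 {h1 KE}.
have -> : m * (6 * D ^+ 2 / q) = (6 * m ^+ 3 / q) * (D / m) ^+ 2.
  field.
  by rewrite !gt_eqF.
by rewrite ler_piMl ?sqr_ge0 // ler_pdivrMr // mul1r.
Qed.

(** The centre [z] is linked to [y S] through the representatives of scales 0 to K. Jensen's
    inequality with geometric weights [w k] separates the scales at the price of inflating link k by
    1 / w k, which the decay of its variance absorbs. What remains beyond scale K is deterministic,
    at most mu C D <= 1 + X. The factor 20 is 4 >= e times 5, from 4 e^B + 1 <= 5 e^B. *)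
Lemma rmean_chaining mu : 0 <= mu ->
  rmean (fun s => maxexp s (fun S i => mu * (psi i (y S i) - psi i (z i))))
  <= 20 * expR (400 ^+ 2 * (mu ^+ 2 * (n%:R * C ^+ 2 * D ^+ 2))).
Proof.
move=> mu0; set X := mu ^+ 2 * _.
have n0 : 0 < n%:R :> R by rewrite ltr0n.
have X0 : 0 <= X by rewrite !mulr_ge0 ?sqr_ge0 // ltW.
(* 240 * 400 = 2 * 8 * 60 * 5^2 * 4: the factors come from [rmean_maxexp], the bits of a pair of
   codes, [link_sq], the weight 1/5 and [chaining_rate]. *)
have [B BE] : exists B, B = 240 * 400 * X by eexists.
have B0 : 0 <= B by rewrite BE !mulr_ge0 ?ler0n.
have BX : X + B <= 400 ^+ 2 * X.
  rewrite (_ : X + B = (1 + 240 * 400) * X); last by rewrite BE; ring.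
  by apply: ler_wpM2r => //; lra.
have [K KP] := fine_level.
pose w (k : 'I_K.+1) : R := 5^-1 * (4 / 5) ^+ k.
have w0 k : 0 < w k by rewrite mulr_gt0 ?exprn_gt0 ?invr_gt0 //; lra.
have w1 : \sum_k w k <= 1.
  rewrite -mulr_sumr; have := subrX1 (4 / 5 : R) K.+1.
  rewrite [RHS]mulrC => /eqP; rewrite eq_sym; move=> /eqP h.
  have h0 : 0 <= (4 / 5) ^+ K.+1 :> R by rewrite exprn_ge0.
  by lra.
have le1 s : maxexp s (fun S i => mu * (psi i (y S i) - psi i (z i))) <=
    expR (1 + X) * (\sum_k w k * maxexp s (fun S i => mu / w k * link k S i) + 1).
  have M0 k : 0 <= maxexp s (fun S i => mu / w k * link k S i).
    by rewrite /maxexp; elim/big_ind: _ => // a b a0 b0; rewrite le_max a0.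
  have r0 : 0 <= \sum_k w k * maxexp s (fun S i => mu / w k * link k S i) + 1.
    by rewrite addr_ge0 // sumr_ge0 // => k _; rewrite mulr_ge0 // ltW.
  apply: bigmax_le => [|S _]; first by rewrite mulr_ge0 ?expR_ge0.
  have -> : rsum s (fun i => mu * (psi i (y S i) - psi i (z i))) =
      rsum s (fun i => mu * (psi i (y S i) - level K S i)) +
      \sum_k w k * rsum s (fun i => mu / w k * link k S i).
    under eq_bigr do rewrite -rsumZ.
    rewrite /rsum exchange_big /= -big_split /=; apply: eq_bigr => i _.
    rewrite -mulr_sumr -mulrDr; congr (_ * _).
    rewrite (eq_bigr (fun k : 'I_K.+1 => mu * link k S i)); last first.
      by move=> k _; rewrite mulrA mulrCA mulfV ?mulr1 // gt_eqF.
    rewrite -mulr_sumr -mulrDr; congr (_ * _).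
    rewrite big_ord_recl /= {1}/link /=.
    have -> : \sum_(i0 < K) link (bump 0 i0) S i = level K S i - level 0 S i.
      rewrite -(telescope_sumr (fun k => level k S i)) // big_mkord.
      by apply: eq_bigr.
    by ring.
  rewrite expRD; apply: ler_pM; rewrite ?expR_ge0 //.
    rewrite ler_expR; apply: (le_trans (rsum_le _ _)).
    apply: (@le_trans _ _ (\sum_(i < n) mu * (C * (D / n%:R)))).
      apply: ler_sum => i _; rewrite normrM (ger0_norm mu0) ler_wpM2l //.
      by rewrite (le_trans (psi_lip _ _ _)) // ler_wpM2l // distrC.
    rewrite sumr_const card_ord -[_ *+ _]mulr_natl.
    have -> : n%:R * (mu * (C * (D / n%:R))) = mu * C * D.
      by field; rewrite gt_eqF.
    have h1 : (mu * C * D) ^+ 2 <= X.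
      rewrite /X; have -> : mu ^+ 2 * (n%:R * C ^+ 2 * D ^+ 2) = n%:R * (mu * C * D) ^+ 2.
        by ring.
      by rewrite ler_peMl ?sqr_ge0 // ler1n.
    have h2 := sqr_ge0 (mu * C * D - 2^-1).
    have E : (mu * C * D - 2^-1) ^+ 2 = (mu * C * D) ^+ 2 - mu * C * D + 4^-1.
      by field.
    by lra.
  apply: (le_trans (expR_subjensen _ _ w1)) => [k|]; first exact: ltW.
  rewrite lerD2r; apply: ler_sum => k _; rewrite ler_wpM2l ?(ltW (w0 k)) //.
  exact: (@le_bigmax _ _ _ _ (fun S => expR (rsum s (fun i => mu / w k * link k S i)))).
apply: (le_trans (rmean_le le1)); rewrite rmeanZ rmeanD rmean_cst rmean_sum.
have le2 (k : 'I_K.+1) : rmean (fun s => w k * maxexp s (fun S i => mu / w k * link k S i))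
    <= w k * (4 * expR B).
  rewrite rmeanZ ler_wpM2l ?(ltW (w0 k)) //.
  have [H HE] : exists H, (8 * k.+1 * 2 ^ k = H.+1)%N.
    exists (8 * k.+1 * 2 ^ k).-1%N; rewrite prednK // !muln_gt0 expn_gt0 //.
  (* A link joins two consecutive scales, hence the pair of codes. At scale 0 the predecessor is 0
     again, the other end of the link being the centre. *)
  apply: (le_trans (@rmean_maxexp _ _ F (G k.-1 * G k)%type
    (fun S => (code k.-1 S, code k S)) (fun S i => mu / w k * link k S i) H
    ((mu / w k) ^+ 2 * (60 * (n%:R * C ^+ 2 * D ^+ 2) / 4 ^+ k)) _ _ _)).
  - rewrite card_prod -HE; apply: (leq_trans (leq_mul (card_code _) (card_code _))).
    rewrite -expnD leq_exp2l //.
    have : (4 * k.-1.+1 * 2 ^ k.-1 <= 4 * k.+1 * 2 ^ k)%N.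
      by rewrite leq_mul ?leq_exp2l ?leq_pred // leq_mul // ltnS leq_pred.
    by rewrite -(leq_add2r (4 * k.+1 * 2 ^ k)) -[X in (_ <= X)%N]mulnDl -mulnDl.
  - move=> S S' [c1 c2] i; congr (_ * _); rewrite /link /level (rep_code c2).
    by move: c1; case: (k : nat) => //= k' c1; rewrite (rep_code c1).
  - move=> S; under eq_bigr do rewrite exprMn.
    by rewrite -mulr_sumr ler_wpM2l ?sqr_ge0.
  rewrite ler_wpM2l // ler_expR -HE BE /w.
  have -> : 2 * (8 * k.+1 * 2 ^ k)%:R * ((mu / (5^-1 * (4 / 5) ^+ k)) ^+ 2 *
      (60 * (n%:R * C ^+ 2 * D ^+ 2) / 4 ^+ k)) =
      240 * 100 * (k.+1%:R * 2 ^+ k * (4 ^+ k)^-1 * ((4 / 5) ^- k) ^+ 2) * X :> R.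
    rewrite /X !natrM natrX; field.
    by rewrite !expf_neq0.
  apply: ler_wpM2r => //; have := @chaining_rate R k; lra.
have le3 := ler_sum (index_enum _) (fun k (_ : true) => le2 k).
have e1 : 1 <= expR B by rewrite -expR0 ler_expR.
have le4 : \sum_k w k * (4 * expR B) <= 4 * expR B.
  by rewrite -mulr_suml ler_piMl // mulr_ge0 ?expR_ge0.
have e2 : expR 1 <= 4 :> R.
  have -> : (1 : R) = 2^-1 + 2^-1 by field.
  have : expR 2^-1 <= 2 :> R.
    have := @expR_le_geometric R 2^-1; rewrite (_ : 1 - 2^-1 = 2^-1); last by field.
    by rewrite invrK; apply; lra.
  by rewrite expRD; have := expR_ge0 (2^-1 : R); nra.
apply: (@le_trans _ _ (20 * expR (X + B))); last by rewrite ler_wpM2l // ler_expR.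
rewrite !expRD -mulrA.
have -> : 20 * (expR X * expR B) = 4 * (expR X * (5 * expR B)) by ring.
apply: (@le_trans _ _ (expR 1 * (expR X * (5 * expR B)))).
  apply: ler_wpM2l; first exact: expR_ge0.
  apply: ler_wpM2l; first exact: expR_ge0.
  by have := le_trans le3 le4; lra.
by rewrite ler_wpM2r // !mulr_ge0 ?expR_ge0 ?ler0n.
Qed.

End chaining.

(** * Entropy of differences of monotone curves *)

Definition first (p : pred nat) N := find p (iota 0 N).

Lemma first_le p N : (first p N <= N)%N.
Proof. by rewrite /first (leq_trans (find_size _ _)) ?size_iota. Qed.

Lemma firstP (p : pred nat) N j : (j < N)%N ->
  (forall i j, (i <= j)%N -> p i -> p j) -> (first p N <= j)%N = p j.
Proof.
move=> jN up; apply/idP/idP => [fj|pj]; last first.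
  rewrite leqNgt; apply/negP => /(before_find 0).
  by rewrite nth_iota // add0n pj.
have hp : has p (iota 0 N) by rewrite has_find size_iota (leq_ltn_trans fj).
have := nth_find 0 hp; rewrite nth_iota ?add0n; last by rewrite -{2}(size_iota 0 N) -has_find.
exact: up.
Qed.

(** The largest multiple of [eps] below [u], if positive, is also below [v], and [u] exceeds it by
    less than [eps]. *)
Lemma close_levels {R : realType} (eps u v : R) (N : nat) : 0 < eps ->
  0 <= v -> u <= N%:R * eps ->
  (forall l, (l < N)%N -> (l.+1%:R * eps <= u) = (l.+1%:R * eps <= v)) -> u <= v + eps.
Proof.
move=> e0 v0 uN H; rewrite leNgt; apply/negP => vu.
have u0 : 0 <= u / eps by rewrite divr_ge0 ?(ltW e0) //; lra.
have /andP[] := truncn_itv u0; set l := Num.truncn _.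
rewrite ler_pdivlMr // ltr_pdivrMr // => l1 l2.
have l0 : (0 < l)%N.
  by rewrite lt0n; apply/eqP => l0; move: l2; rewrite l0 mul1r; lra.
have lN : (l <= N)%N.
  by rewrite -(ler_nat R) -(ler_pM2r e0); apply: le_trans l1 uN.
have := H l.-1; rewrite !prednK // l1 => /(_ lN)/esym.
by move: l2; rewrite -natr1 mulrDl mul1r; lra.
Qed.

(** A nonincreasing sequence rounded to 2^k levels is determined by the positions where it crosses
    each level. Storing 2^k pairs of positions among about 4^k cells costs O(k 2^k) bits, whereas
    listing the values would cost order 4^k. *)
Lemma card_curve_code k :
  (#|{ffun 'I_(2 ^ k) -> 'I_(4 ^ k).+2 * 'I_(4 ^ k).+2}| <= 2 ^ (4 * k.+1 * 2 ^ k))%N.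
Proof.
rewrite card_ffun card_ord expnM leq_exp2r ?expn_gt0 // card_prod card_ord.
have -> : (4 * k.+1 = 2 * k.+1 + 2 * k.+1)%N by lia.
have k0 : (0 < 4 ^ k)%N by rewrite expn_gt0.
rewrite expnD expnM expnS; apply: leq_mul; rewrite (_ : 2 ^ 2 = 4)%N //; lia.
Qed.

Section monotone_entropy.
Context {R : realType} {n : nat} (F : finType).
Variables (t : nat) (D : R) (k : nat) (s_ : F -> nat -> R) (e : 'I_n -> nat -> R).
Variable (y : F -> 'I_n -> R).
Hypothesis n_gt0 : (0 < n)%N.
Hypothesis D_gt0 : 0 < D.
Hypothesis s_mono : forall S i j, (i <= j)%N -> s_ S j <= s_ S i.
Hypothesis s_range : forall S j, 0 <= s_ S j <= D.
Hypothesis e_mono : forall i j l, (j <= l)%N -> e i l <= e i j.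
Hypothesis e_range : forall i j, 0 <= e i j <= D.
Hypothesis y_ge : forall S i j, (j <= t)%N -> s_ S j - e i j <= y S i.
Hypothesis y_att : forall S i, exists2 j, (j <= t)%N & y S i = s_ S j - e i j.

Let g j := \sum_i (e i 0%N - e i j).
Let wd : R := n%:R * D / 4 ^+ k.
Let m := (4 ^ k).+1.
Let lft j := first (fun s => j%:R * wd <= g s) t.+1.
Let rgt j := (lft j.+1).-1.
Let eps : R := D / 2 ^+ k.

(* Positions are grouped into cells on which the total oscillation of the e i is at
   most wd; a level curve is encoded by its values, rounded to multiples of eps, at
   the two ends lft j and rgt j of each cell. *)
Definition curve_code S : {ffun 'I_(2 ^ k) -> 'I_m.+1 * 'I_m.+1} :=
  [ffun l : 'I_(2 ^ k) => (inord (first (fun j => s_ S (lft j) < l.+1%:R * eps) m),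
              inord (first (fun j => s_ S (rgt j) < l.+1%:R * eps) m))].

Let wd_gt0 : 0 < wd.
Proof. by rewrite /wd !mulr_gt0 ?ltr0n ?invr_gt0 ?exprn_gt0. Qed.

Let eps_gt0 : 0 < eps.
Proof. by rewrite divr_gt0 ?exprn_gt0. Qed.

Let g_mono j l : (j <= l)%N -> g j <= g l.
Proof. by move=> jl; apply: ler_sum => i _; have := e_mono i jl; lra. Qed.

Let lftP j s : (s <= t)%N -> (lft j <= s)%N = (j%:R * wd <= g s).
Proof. by move=> st; apply: firstP => // i l il /le_trans; apply; exact: g_mono. Qed.

Let lft_mono i j : (i <= j)%N -> (lft i <= lft j)%N.
Proof.
move=> ij; have [tj|jt] := leqP t.+1 (lft j).
  by rewrite (leq_trans _ tj) ?first_le.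
rewrite lftP //; have := leqnn (lft j); rewrite {1}lftP //.
by apply: le_trans; rewrite ler_wpM2r ?(ltW wd_gt0) ?ler_nat.
Qed.

Let lft0 : lft 0 = 0%N.
Proof.
apply/eqP; rewrite -leqn0 lftP // mul0r /g sumr_ge0 // => i _.
by rewrite subrr.
Qed.

(** [m] is 4^k + 1 so that the threshold m * wd strictly exceeds the total oscillation n * D; the
    cells then exhaust the positions up to [t]. *)
Let lftm s : (s <= t)%N -> (s < lft m)%N.
Proof.
move=> st; rewrite ltnNge lftP // -ltNge.
apply: (@le_lt_trans _ _ (n%:R * D)).
  have -> : n%:R * D = \sum_(i < n) D by rewrite sumr_const card_ord mulr_natl.
  by apply: ler_sum => i _; have := e_range i 0; have := e_range i s; lra.
rewrite /m /wd -natr1 natrX mulrDl mul1r mulrCA mulfV ?expf_neq0 // mulr1.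
by rewrite ltrDl divr_gt0 ?exprn_gt0 // mulr_gt0 // ltr0n.
Qed.

Let cell s : (s <= t)%N -> exists j : 'I_m, (lft j <= s < lft j.+1)%N.
Proof.
move=> st; have : exists j, (s < lft j.+1)%N.
  exists (4 ^ k)%N; exact: lftm.
move=> /ex_minnP[j sj jmin].
have jm : (j < m)%N by rewrite ltnS jmin // lftm.
suff lj : (lft j <= s)%N by exists (Ordinal jm); rewrite lj.
case: j jmin {sj jm} => [|i] jmin; first by rewrite lft0.
by rewrite leqNgt; apply/negP => /jmin; rewrite ltnn.
Qed.

Let code_close (f : nat -> nat) S S' :
  (forall i j, (i <= j)%N -> (f i <= f j)%N) ->
  (forall l, (l < 2 ^ k)%N -> first (fun j => s_ S (f j) < l.+1%:R * eps) m =
                              first (fun j => s_ S' (f j) < l.+1%:R * eps) m) ->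
  forall j, (j < m)%N -> s_ S (f j) <= s_ S' (f j) + eps.
Proof.
move=> fm E j jm; apply: (@close_levels _ _ _ _ (2 ^ k)%N) => //.
- by case/andP: (s_range S' (f j)).
- rewrite natrX mulrC divfK ?expf_neq0 //; by case/andP: (s_range S (f j)).
- move=> l lk; apply/negb_inj; rewrite -!ltNge.
  have up U : forall i j, (i <= j)%N -> s_ U (f i) < l.+1%:R * eps -> s_ U (f j) < l.+1%:R * eps.
    by move=> i i' ii' /(le_lt_trans _); apply; apply/s_mono/fm.
  by rewrite -(firstP jm (up S)) -(firstP jm (up S')) E.
Qed.

Let osc S j : R := s_ S (lft j) - s_ S (rgt j).
Let vr i j : R := e i (lft j) - e i (rgt j).
(** A cell is empty when [g] jumps past several thresholds at once or never reaches them; [rgt j]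
    then falls to the left of [lft j], and the cell must be left out of every sum. *)
Let ne j := (lft j < lft j.+1)%N.

Let rgtE j : ne j -> (rgt j < lft j.+1)%N /\ (lft j <= rgt j)%N.
Proof. by rewrite /ne /rgt; case: (lft j.+1). Qed.

Let osc_ge0 S j : ne j -> 0 <= osc S j.
Proof. by move=> /rgtE[_ h]; rewrite subr_ge0 s_mono. Qed.

Let vr_ge0 i j : ne j -> 0 <= vr i j.
Proof. by move=> /rgtE[_ h]; rewrite subr_ge0 e_mono. Qed.

Let sum_osc S : \sum_(j < m | ne j) osc S j <= D.
Proof.
apply: (@le_trans _ _ (\sum_(j < m) (s_ S (lft j) - s_ S (lft j.+1)))).
  rewrite [leRHS](bigID (fun j : 'I_m => ne j)) /= -[leLHS]addr0 lerD //.
    apply: ler_sum => j /rgtE[h _]; rewrite lerD2l lerN2; apply: s_mono; exact: ltnW.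
  by rewrite sumr_ge0 // => j _; rewrite subr_ge0 s_mono // lft_mono.
have -> : \sum_(j < m) (s_ S (lft j) - s_ S (lft j.+1)) = s_ S (lft 0) - s_ S (lft m).
  rewrite -(big_mkord xpredT (fun j => s_ S (lft j) - s_ S (lft j.+1))).
  rewrite -[RHS]opprB -(telescope_sumr (fun j => s_ S (lft j))) // -sumrN.
  by apply: eq_bigr => j _; rewrite opprB.
by have := s_range S (lft 0); have := s_range S (lft m); lra.
Qed.

(** Since [rgt j] is still strictly below the next threshold, a jump of [g] across that threshold
    happens between two cells and is charged to neither. *)
Let sum_vr j : ne j -> \sum_i vr i j <= wd.
Proof.
move=> nj; have [r1 r2] := rgtE nj.
have -> : \sum_i vr i j = g (rgt j) - g (lft j).
  rewrite /g -sumrB; apply: eq_bigr => i _; rewrite /vr; ring.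
have rt : (rgt j <= t)%N by rewrite -ltnS (leq_trans r1) // first_le.
have : ~~ (lft j.+1 <= rgt j)%N by rewrite -ltnNge.
rewrite lftP // -ltNge -natr1 mulrDl mul1r => h1.
have : (lft j <= lft j)%N by [].
rewrite lftP ?(leq_trans r2) // => h2; lra.
Qed.

(** Let [s] attain the maximum for [S], in cell j. Testing [S'] at the left end of the cell loses at
    most eps + [vr i j], since the level there is no lower and only the demand curve varies. Testing
    it at the right end loses at most eps + [osc S j]. The smaller of the two bounds has a square at
    most 2 eps^2 + 2 * vr * osc. *)
Let one_sided S S' i : curve_code S = curve_code S' -> y S' i <= y S i ->
  (y S i - y S' i) ^+ 2 <= 2 * eps ^+ 2 + 2 * \sum_(j < m | ne j) vr i j * osc S j.
Proof.
move=> /ffunP E; have [s st ->] := y_att S i.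
have [j /andP[j1 j2]] := cell st.
have nj : ne j by exact: leq_ltn_trans j1 j2.
have [r1 r2] := rgtE nj.
have rt : (rgt j <= t)%N by rewrite -ltnS (leq_trans r1) // first_le.
have sr : (s <= rgt j)%N by rewrite /rgt -ltnS prednK // (leq_ltn_trans _ j2).
have lt_ : (lft j <= t)%N by exact: leq_trans j1 st.
have inord_inj a b : (a <= m)%N -> (b <= m)%N -> inord a = inord b :> 'I_m.+1 -> a = b.
  by move=> am bm /(congr1 val) /=; rewrite !inordK.
have cl : s_ S (lft j) <= s_ S' (lft j) + eps.
  apply: (code_close (f := lft)) => // l lk.
  by have := E (Ordinal lk); rewrite !ffunE => -[/inord_inj + _]; apply; exact: first_le.
have cr : s_ S (rgt j) <= s_ S' (rgt j) + eps.
  apply: (code_close (f := rgt)) => // [i1 i2 i12|l lk].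
    by rewrite /rgt -!subn1 leq_sub2r // lft_mono.
  by have := E (Ordinal lk); rewrite !ffunE => -[_ /inord_inj]; apply; exact: first_le.
have y1 := @y_ge S' i _ lt_; have y2 := @y_ge S' i _ rt.
have s1 := s_mono S j1; have e1 := e_mono i sr.
have o0 := osc_ge0 S nj; have v0 := vr_ge0 i nj.
rewrite -subr_ge0 => z0; set z := _ - y S' i in z0 *.
apply: (@le_trans _ _ (2 * eps ^+ 2 + 2 * (vr i j * osc S j))); last first.
  rewrite lerD2l ler_wpM2l // (bigD1 j) //= lerDl sumr_ge0 // => l /andP[nl _].
  by rewrite mulr_ge0 ?osc_ge0 ?vr_ge0.
have z1 : z <= eps + vr i j.
  rewrite /z /vr. lra.
have z2 : z <= eps + osc S j.
  rewrite /z /osc. lra.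
have sq a b : 0 <= a -> a <= b -> z <= eps + a -> z ^+ 2 <= 2 * eps ^+ 2 + 2 * (a * b).
  move=> a0 ab za; apply: (@le_trans _ _ ((eps + a) ^+ 2)).
    by rewrite lerXn2r ?nnegrE // (le_trans z0).
  have h1 := ler_wpM2l a0 ab; have h2 := sqr_ge0 (eps - a).
  have E1 : (eps + a) ^+ 2 = 2 * eps ^+ 2 + 2 * (a * a) - (eps - a) ^+ 2 by ring.
  lra.
have [vo|ov] := lerP (vr i j) (osc S j); first exact: sq.
by rewrite [vr i j * _]mulrC; apply: sq => //; exact: ltW.
Qed.

Lemma curve_code_fine S S' : curve_code S = curve_code S' ->
  \sum_i (y S i - y S' i) ^+ 2 <= n%:R * (6 * D ^+ 2 / 4 ^+ k).
Proof.
move=> E.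
(* The oscillations of both curves are kept because the sign of the difference depends on i. The
   final 6 is 2 from the rounding plus 2 * 2 from the two total oscillations, each at most D. *)
apply: (@le_trans _ _ (\sum_(i < n) (2 * eps ^+ 2 +
    2 * \sum_(j < m | ne j) vr i j * (osc S j + osc S' j)))).
  apply: ler_sum => i _.
  have le_osc (f f' : nat -> R) : (forall j, ne j -> 0 <= f j) -> (forall j, ne j -> f j <= f' j) ->
      2 * eps ^+ 2 + 2 * (\sum_(j < m | ne j) vr i j * f j) <=
      2 * eps ^+ 2 + 2 * (\sum_(j < m | ne j) vr i j * f' j).
    move=> f0 ff'; rewrite lerD2l ler_wpM2l //; apply: ler_sum => j nj.
    by rewrite ler_wpM2l ?vr_ge0 ?ff'.
  have [yy|/ltW yy] := lerP (y S' i) (y S i).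
    apply: (le_trans (one_sided E yy)).
    apply: (le_osc (osc S) (fun j => osc S j + osc S' j)) => j nj; first exact: osc_ge0.
    by rewrite lerDl osc_ge0.
  rewrite -sqrrN opprB; apply: (le_trans (one_sided (esym E) yy)).
  apply: (le_osc (osc S') (fun j => osc S j + osc S' j)) => j nj; first exact: osc_ge0.
  by rewrite lerDr osc_ge0.
rewrite big_split /= sumr_const card_ord -[_ *+ n]mulr_natl -mulr_sumr exchange_big /=.
have h : \sum_(j < m | ne j) \sum_(i < n) vr i j * (osc S j + osc S' j) <= wd * (D + D).
  apply: (@le_trans _ _ (wd * (\sum_(j < m | ne j) (osc S j + osc S' j)))).
    rewrite mulr_sumr; apply: ler_sum => j nj; rewrite -mulr_suml.
    by rewrite ler_wpM2r ?sum_vr // addr_ge0 ?osc_ge0.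
  rewrite ler_wpM2l ?(ltW wd_gt0) // big_split /=; apply: lerD; exact: sum_osc.
have h2 := ler_wpM2l (ler0n R 2) h.
apply: (le_trans (lerD (lexx _) h2)); apply: eq_ler.
rewrite /eps /wd expr_div_n -exprM mulnC exprM (_ : 2 ^+ 2 = 4); last by ring.
by field; rewrite expf_neq0.
Qed.

End monotone_entropy.

(** * Base-stock paths *)

Section base_stock_path.
Context {R : realType}.
Implicit Types S d : nat -> R.

Fixpoint stock S d x1 t : R :=
  if t is t'.+1 then Num.max (Num.max (stock S d x1 t') (S t') - d t') 0 else x1.

Definition post S d x1 t : R := Num.max (stock S d x1 t) (S t).

Definition raised S x1 j : R := if j is 0 then Num.max x1 (S 0%N) else S j.

Lemma postS S d x1 t : 0 <= S t.+1 ->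
  post S d x1 t.+1 = Num.max (post S d x1 t - d t) (S t.+1).
Proof. by move=> S0; rewrite /post /= -maxA (max_r S0). Qed.

Lemma post_ge0 S d x1 t : 0 <= S t -> 0 <= post S d x1 t.
Proof. by move=> S0; rewrite le_max S0 orbT. Qed.

(** Unrolling the recursion of [postS]: the truncation of stock at 0 is absorbed by the nonnegative
    levels, so the post-order level is a maximum of levels less the demand accumulated since. *)
Lemma post_ge S d x1 t : (forall s, (s <= t)%N -> 0 <= S s) ->
  forall j, (j <= t)%N -> raised S x1 j - \sum_(j <= r < t) d r <= post S d x1 t.
Proof.
elim: t => [|t IH] S0 j; first by rewrite leqn0 => /eqP ->; rewrite big_geq // subr0.
rewrite leq_eqVlt => /predU1P[->|jt].
  by rewrite big_geq // subr0 postS ?S0 // le_max lexx orbT.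
rewrite postS ?S0 // big_nat_recr //= opprD addrA le_max lerD2r IH // => s st.
exact/S0/(leq_trans st).
Qed.

Lemma post_att S d x1 t : (forall s, (s <= t)%N -> 0 <= S s) ->
  exists2 j, (j <= t)%N & post S d x1 t = raised S x1 j - \sum_(j <= r < t) d r.
Proof.
elim: t => [|t IH] S0; first by exists 0%N => //; rewrite big_geq // subr0.
have [s st|j jt E] := IH; first exact/S0/(leq_trans st).
rewrite postS ?S0 //; have [h|h] := leP (post S d x1 t - d t) (S t.+1).
  by exists t.+1; rewrite // big_geq // subr0.
by exists j; rewrite ?(leq_trans jt) // big_nat_recr //= opprD addrA -E.
Qed.

Variables (t : nat) (D : R).
Hypothesis D_gt0 : 0 < D.

(** The levels need not be monotone; replacing each by the largest later one leaves the maximum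
    unchanged, because a later position has less demand to subtract. Capping the accumulated demand
    at [D] in [drop] is harmless as well: it only affects terms that are at most 0, and the
    post-order level is nonnegative. *)
Definition curve S x1 j : R := \big[Num.max/0]_(j <= r < t.+1) raised S x1 r.
Definition drop d j : R := Num.min D (\sum_(j <= r < t) d r).

Lemma raised_range S x1 : 0 <= x1 <= D -> (forall s, (s <= t)%N -> 0 <= S s <= D) ->
  forall j, (j <= t)%N -> 0 <= raised S x1 j <= D.
Proof.
move=> x1D SD [_|j jt] /=; last exact: SD.
have /andP[a1 a2] := x1D; have /andP[b1 b2] := SD 0%N isT.
by rewrite le_max a1 ge_max a2 b2.
Qed.

Lemma curve_mono S x1 i j : (i <= j)%N -> curve S x1 j <= curve S x1 i.
Proof.
by move=> ij; apply: le_bigmax_nat.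
Qed.

Lemma curve_range S x1 j : 0 <= x1 <= D -> (forall s, (s <= t)%N -> 0 <= S s <= D) ->
  0 <= curve S x1 j <= D.
Proof.
move=> x1D SD; rewrite /curve big_seq_cond; elim/big_ind: _ => //.
- by rewrite lexx ltW.
- by move=> a b /andP[a0 aD] /andP[b0 bD]; rewrite le_max a0 ge_max aD bD.
- move=> i; rewrite mem_index_iota andbT => /andP[_ it].
  exact: raised_range.
Qed.

Lemma tail_sum_mono d i j : (forall r, (r < t)%N -> 0 <= d r) -> (i <= j)%N ->
  \sum_(j <= r < t) d r <= \sum_(i <= r < t) d r.
Proof.
move=> d0 ij; have nn a b : (b <= t)%N -> 0 <= \sum_(a <= r < b) d r.
  move=> bt; rewrite big_nat_cond sumr_ge0 // => r; rewrite andbT => /andP[_ rb].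
  exact/d0/(leq_trans rb).
have [jt|tj] := leqP j t; last by rewrite [leLHS]big_geq ?nn // ltnW.
by rewrite [leRHS](@big_cat_nat _ _ _ j) //= lerDr nn.
Qed.

Lemma drop_mono d i j : (forall r, (r < t)%N -> 0 <= d r) -> (i <= j)%N ->
  drop d j <= drop d i.
Proof.
move=> d0 ij; rewrite /drop le_min ge_min lexx /= ge_min.
by rewrite (tail_sum_mono d0 ij) orbT.
Qed.

Lemma drop_range d j : (forall r, (r < t)%N -> 0 <= d r) -> 0 <= drop d j <= D.
Proof.
move=> d0; rewrite /drop le_min ltW // ge_min lexx /= andbT.
rewrite big_nat_cond sumr_ge0 // => r; rewrite andbT => /andP[_]; exact: d0.
Qed.

Lemma post_curve_ge S d x1 j : 0 <= x1 <= D -> (forall s, (s <= t)%N -> 0 <= S s <= D) ->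
  (forall r, (r < t)%N -> 0 <= d r) -> (j <= t)%N ->
  curve S x1 j - drop d j <= post S d x1 t.
Proof.
move=> x1D SD d0 jt.
have S0 s : (s <= t)%N -> 0 <= S s by move=> /SD/andP[].
have p0 : 0 <= post S d x1 t by apply: post_ge0; exact: S0.
have [dr0 drD] : 0 <= drop d j /\ drop d j <= D by apply/andP/drop_range.
rewrite lerBlDr /curve big_seq_cond.
elim/big_ind: _ => [|a b aX bX|r]; first exact: addr_ge0.
  by rewrite ge_max aX.
rewrite mem_index_iota andbT ltnS => /andP[jr rt].
have /andP[_ rD] := raised_range x1D SD rt.
have := @post_ge S d x1 t S0 r rt; have := tail_sum_mono d0 jr.
by rewrite /drop; have [_|_] := lerP D (\sum_(j <= r < t) d r); lra.
Qed.

Lemma post_curve_att S d x1 : 0 <= x1 <= D -> (forall s, (s <= t)%N -> 0 <= S s <= D) ->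
  (forall r, (r < t)%N -> 0 <= d r) ->
  exists2 j, (j <= t)%N & post S d x1 t = curve S x1 j - drop d j.
Proof.
move=> x1D SD d0.
have S0 s : (s <= t)%N -> 0 <= S s by move=> /SD/andP[].
have [j jt E] := @post_att S d x1 t S0.
exists j => //; apply/eqP; rewrite eq_le post_curve_ge // andbT E.
apply: lerB; last by rewrite /drop ge_min lexx orbT.
by apply: le_bigmax_seq; rewrite // mem_index_iota leqnn ltnS.
Qed.

Lemma post_range S d x1 : 0 <= x1 <= D -> (forall s, (s <= t)%N -> 0 <= S s <= D) ->
  (forall r, (r < t)%N -> 0 <= d r) -> 0 <= post S d x1 t <= D.
Proof.
move=> x1D SD d0; rewrite post_ge0; last by case/andP: (SD t (leqnn t)).
have [j jt ->] := post_curve_att x1D SD d0.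
by have := curve_range j x1D SD; have := drop_range j d0; lra.
Qed.

(** The path of the reference levels [S1] is the chaining centre; both post-order levels lie in
    [0, D], hence within distance D of each other. *)
Lemma rmean_base_stock (n : nat) (F : finType) (S : F -> nat -> R) (S1 : nat -> R)
    (d : 'I_n -> nat -> R) (x1 C mu : R) (psi : 'I_n -> R -> R) :
  (0 < n)%N -> 0 <= C -> 0 <= mu -> 0 <= x1 <= D ->
  (forall u s, (s <= t)%N -> 0 <= S u s <= D) ->
  (forall s, (s <= t)%N -> 0 <= S1 s <= D) ->
  (forall i r, (r < t)%N -> 0 <= d i r) ->
  (forall i a b, `|psi i a - psi i b| <= C * `|a - b|) ->
  rmean (fun s => maxexp s (fun u i =>
    mu * (psi i (post (S u) (d i) x1 t) - psi i (post S1 (d i) x1 t))))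
  <= 20 * expR (400 ^+ 2 * (mu ^+ 2 * (n%:R * C ^+ 2 * D ^+ 2))).
Proof.
move=> n0 C0 mu0 x1D SD S1D d0 psiC.
pose s_ u j := curve (S u) x1 j; pose e i j := drop (d i) j.
apply: (@rmean_chaining R n F _ D _ (fun k => curve_code t D k s_ e)) => //.
- exact: ltW.
- by move=> k; exact: card_curve_code.
- move=> k u u'; apply: (@curve_code_fine R n F t D k s_ e (fun u i => post (S u) (d i) x1 t)) => //.
  + by move=> v i j; exact: curve_mono.
  + by move=> v j; apply: curve_range => // r; exact: SD.
  + by move=> i j l; apply: drop_mono => r; exact: d0.
  + by move=> i j; apply: drop_range => // r; exact: d0.
  + by move=> v i j; apply: post_curve_ge => // r; [exact: SD|exact: d0].
  + by move=> v i; apply: post_curve_att => // r; [exact: SD|exact: d0].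
- move=> u i; rewrite ler_norml.
  have := @post_range (S u) (d i) _ x1D (SD u) (d0 i).
  by have := @post_range S1 (d i) _ x1D S1D (d0 i); lra.
Qed.

End base_stock_path.

(** * Symmetrization and decoupling *)

Section finite_product.
Context {R : realType} {n : nat} (X : finType).
Variable P : X -> R.
Hypothesis P_ge0 : forall x, 0 <= P x.
Hypothesis P_sum1 : \sum_x P x = 1.
Implicit Types w : {ffun 'I_n -> X}.

Definition pweight w : R := \prod_i P (w i).

Lemma pweight_ge0 w : 0 <= pweight w.
Proof. exact: prodr_ge0. Qed.

Lemma sum_pweight : \sum_w pweight w = 1.
Proof.
by rewrite -(bigA_distr_bigA (fun _ => P)) /= big1 // => i _; exact: P_sum1.
Qed.

Lemma pweight_marginal i (g : X -> R) :
  \sum_w pweight w * g (w i) = \sum_x P x * g x.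
Proof.
transitivity (\sum_(w : {ffun 'I_n -> X}) \prod_j (P (w j) * (if j == i then g (w j) else 1))).
  apply: eq_bigr => w _; rewrite big_split /=; congr (_ * _).
  by rewrite -big_mkcond big_pred1_eq.
rewrite -(bigA_distr_bigA (fun j x => P x * (if j == i then g x else 1))) /=.
rewrite (bigD1 i) //= eqxx [X in _ * X]big1 ?mulr1 // => j /negbTE ji.
by under eq_bigr do rewrite ji mulr1.
Qed.

End finite_product.

Section symmetrization.
Context {R : realType} {n : nat} (X F : finType).
Variables (P : X -> R) (f : F -> X -> R) (lam B : R).
Hypothesis P_ge0 : forall x, 0 <= P x.
Hypothesis P_sum1 : \sum_x P x = 1.
Implicit Types w : {ffun 'I_n -> X}.

Hypothesis rad_le : forall w w',
  rmean (fun s => maxexp s (fun u i => lam * (f u (w i) - f u (w' i)))) <= B.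

Let swap (s : {ffun 'I_n -> bool}) (p : {ffun 'I_n -> X} * {ffun 'I_n -> X}) :=
  ([ffun i => if s i then p.2 i else p.1 i], [ffun i => if s i then p.1 i else p.2 i]).

Let swapK s : involutive (swap s).
Proof.
by move=> [w w']; congr (_, _); apply/ffunP => i; rewrite !ffunE /=; case: (s i).
Qed.

Definition dev u w : R := \sum_i lam * (f u (w i) - \sum_x P x * f u x).

Let gap w w' u i : R := lam * (f u (w i) - f u (w' i)).

(** The mean inside [dev] becomes an average over a ghost sample, which Jensen's inequality moves
    outside the exponential. Exchanging the two samples at the coordinates where [s i] holds
    preserves the joint weight and inserts the signs; averaging over [s] then changes nothing. *)
Lemma symmetrization :
  \sum_w pweight P w * \big[Num.max/0]_u expR (dev u w) <= B.
Proof.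
pose M s w w' := maxexp s (gap w w').
have pw0 w : 0 <= pweight P w by exact: pweight_ge0.
pose s0 := [ffun=> false] : {ffun 'I_n -> bool}.
have ghost w : \big[Num.max/0]_u expR (dev u w) <= \sum_w' pweight P w' * M s0 w w'.
  apply: bigmax_le => [|u _].
    apply: sumr_ge0 => w' _; rewrite mulr_ge0 //; exact: bigmax_ge_id.
  have -> : dev u w = \sum_w' pweight P w' * rsum s0 (gap w w' u).
    rewrite /rsum; under eq_bigr do rewrite mulr_sumr.
    rewrite exchange_big /=; apply: eq_bigr => i _.
    transitivity (\sum_w' (lam * (pweight P w' * f u (w i)) - lam * (pweight P w' * f u (w' i)))).
      rewrite sumrB -!mulr_sumr -mulr_suml sum_pweight // mul1r.
      by rewrite (pweight_marginal P_sum1 i (f u)) mulrBr.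
    by apply: eq_bigr => w' _; rewrite /s0 ffunE expr0 mul1r /gap; ring.
  apply: (le_trans (expR_jensen _ _ _)) => //; first exact: sum_pweight.
  apply: ler_sum => w' _; apply: ler_wpM2l => //.
  exact: (@le_bigmax _ _ _ _ (fun u => expR (rsum s0 (gap w w' u)))).
apply: (@le_trans _ _ (\sum_w \sum_w' pweight P w * pweight P w' * M s0 w w')).
  apply: ler_sum => w _; have := ler_wpM2l (pw0 w) (ghost w).
  by rewrite mulr_sumr; under [leRHS]eq_bigr do rewrite mulrA.
have sym s : \sum_w \sum_w' pweight P w * pweight P w' * M s w w' =
             \sum_w \sum_w' pweight P w * pweight P w' * M s0 w w'.
  rewrite !pair_bigA /= [RHS](reindex_inj (inv_inj (swapK s))) /=.
  apply: eq_bigr => -[w w'] _ /=; congr (_ * _).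
    rewrite /pweight -!big_split /=; apply: eq_bigr => i _.
    by rewrite !ffunE /=; case: (s i) => //; rewrite mulrC.
  apply: eq_bigr => u _; congr expR; apply: eq_bigr => i _.
  rewrite /s0 /gap !ffunE /= expr0 mul1r; case: (s i); rewrite ?expr0 ?mul1r ?expr1 //.
  by ring.
rewrite -[leLHS](rmean_cst (n := n)).
rewrite (_ : (fun=> _) = (fun s => \sum_w \sum_w' pweight P w * pweight P w' * M s w w')); last first.
  by apply/funext => s; rewrite sym.
rewrite rmean_sum.
apply: (@le_trans _ _ (\sum_w \sum_w' pweight P w * pweight P w' * B)).
  apply: ler_sum => w _; rewrite rmean_sum; apply: ler_sum => w' _.
  by rewrite rmeanZ ler_wpM2l ?mulr_ge0 //; exact: rad_le.
under eq_bigr do rewrite -mulr_suml -mulr_sumr sum_pweight // mulr1.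
by rewrite -mulr_suml sum_pweight // mul1r.
Qed.

End symmetrization.

Section decoupling.
Context {R : realType} {n T : nat} (V F : finType).
Variables (p : 'I_T -> V -> R) (f : F -> {ffun 'I_T -> V} -> R) (lam B : R).
Hypothesis p_ge0 : forall t v, 0 <= p t v.
Hypothesis p_sum1 : forall t, \sum_v p t v = 1.
Local Notation X := {ffun 'I_T -> V}.
Local Notation W := {ffun 'I_n.+1 -> X}.

Definition tweight (x : X) : R := \prod_t p t (x t).

Lemma tweight_ge0 x : 0 <= tweight x.
Proof. exact: prodr_ge0. Qed.

Lemma sum_tweight : \sum_x tweight x = 1.
Proof. by rewrite -(bigA_distr_bigA p) /= big1. Qed.

(* The mean of f u under the product of the empirical marginals of the sample w. *)
Definition vstat u (w : W) : R :=
  (n.+1%:R ^+ T)^-1 * \sum_(j : {ffun 'I_T -> 'I_n.+1}) f u [ffun t => w (j t) t].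

Hypothesis rad_le : forall w w' : W,
  rmean (fun s => maxexp s (fun u i => lam * (f u (w i) - f u (w' i)))) <= B.

Let shift (k : {ffun 'I_T -> 'I_n.+1}) (w : W) : W :=
  [ffun i => [ffun t => w (i + k t) t]].

Let shift_inj k : injective (shift k).
Proof.
apply: (can_inj (g := shift [ffun t => - k t])) => w.
by apply/ffunP => i; apply/ffunP => t; rewrite !ffunE subrK.
Qed.

(* For each vector k of cyclic shifts the n + 1 trajectories of shift k w are
   independent, and averaging over k recovers vstat. *)
Lemma decoupling :
  \sum_w pweight tweight w *
    \big[Num.max/0]_u expR (lam * n.+1%:R * (vstat u w - \sum_x tweight x * f u x)) <= B.
Proof.
pose K := {ffun 'I_T -> 'I_n.+1}.
have cK : #|K|%:R = n.+1%:R ^+ T :> R by rewrite card_ffun !card_ord natrX.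
have c0 : n.+1%:R ^+ T != 0 :> R by rewrite expf_neq0 // pnatr_eq0.
pose M (w : W) := \big[Num.max/0]_u expR (dev tweight f lam u w).
have pw0 (w : W) : 0 <= pweight tweight w by apply: pweight_ge0; exact: tweight_ge0.
have le1 w : \big[Num.max/0]_u expR (lam * n.+1%:R * (vstat u w - \sum_x tweight x * f u x))
    <= \sum_(k : K) (n.+1%:R ^+ T)^-1 * M (shift k w).
  apply: bigmax_le => [|u _].
    apply: sumr_ge0 => k _; rewrite mulr_ge0 ?invr_ge0 ?exprn_ge0 //.
    exact: bigmax_ge_id.
  have -> : lam * n.+1%:R * (vstat u w - \sum_x tweight x * f u x) =
      \sum_(k : K) (n.+1%:R ^+ T)^-1 * dev tweight f lam u (shift k w).
    rewrite -mulr_sumr /dev exchange_big /= /vstat; set m := \sum_x tweight x * f u x.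
    rewrite (eq_bigr (fun i : 'I_n.+1 =>
        lam * (\sum_(j : K) f u [ffun t => w (j t) t] - n.+1%:R ^+ T * m))); last first.
      move=> i _; rewrite -mulr_sumr; congr (_ * _).
      rewrite sumrB sumr_const -[_ *+ _]mulr_natl cK; congr (_ - _).
      pose h (k : K) : K := [ffun t => i + k t].
      have hI : injective h.
        apply: (can_inj (g := fun k : K => [ffun t => k t - i] : K)) => k.
        by apply/ffunP => t; rewrite !ffunE addrC addKr.
      rewrite [RHS](reindex_inj hI) /=; apply: eq_bigr => k _; congr (f u _).
      by apply/ffunP => t; rewrite !ffunE.
    rewrite sumr_const card_ord -[_ *+ _]mulr_natl.
    move: (\sum_(j : K) _) => S; move: (n.+1%:R ^+ T) c0 => c c0.
    by field.
  apply: (le_trans (expR_jensen _ _ _)).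
  - by move=> k; rewrite invr_ge0 exprn_ge0.
  - by rewrite sumr_const -[_ *+ _]mulr_natl cK mulfV.
  apply: ler_sum => k _; rewrite ler_wpM2l ?invr_ge0 ?exprn_ge0 //.
  exact: (@le_bigmax _ _ _ _ (fun u => expR (dev tweight f lam u (shift k w)))).
apply: (@le_trans _ _ (\sum_(w : W) \sum_(k : K)
    (n.+1%:R ^+ T)^-1 * (pweight tweight w * M (shift k w)))).
  apply: ler_sum => w _; rewrite [leRHS](_ : _ =
    pweight tweight w * \sum_(k : K) (n.+1%:R ^+ T)^-1 * M (shift k w)); first exact: ler_wpM2l.
  by rewrite mulr_sumr; apply: eq_bigr => k _; rewrite mulrCA.
rewrite exchange_big /=.
have inv (k : K) : \sum_(w : W) (n.+1%:R ^+ T)^-1 * (pweight tweight w * M (shift k w)) =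
    (n.+1%:R ^+ T)^-1 * \sum_(w : W) (pweight tweight w * M w).
  rewrite -mulr_sumr; congr (_ * _).
  rewrite [RHS](reindex_inj (@shift_inj k)) /=; apply: eq_bigr => w _; congr (_ * _).
  rewrite /pweight /tweight exchange_big [RHS]exchange_big /=; apply: eq_bigr => t _.
  rewrite (reindex_inj (addIr (k t))) /=; apply: eq_bigr => i _.
  by rewrite !ffunE.
rewrite (eq_bigr _ (fun k _ => inv k)) sumr_const -[_ *+ _]mulr_natl cK
  mulrA mulfV // mul1r.
apply: symmetrization => //; [exact: tweight_ge0|exact: sum_tweight].
Qed.

End decoupling.

(** * Uniform deviations of base-stock losses *)

Section base_stock_deviation.
Context {R : realType} {n T : nat} (V F : finType).
Variables (c : nat -> R -> R -> R) (C D x1 : R) (p v : 'I_T -> V -> R).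
Variables (S : F -> nat -> R) (S1 : nat -> R).
Hypothesis T_gt0 : (0 < T)%N.
Hypothesis C_gt0 : 0 < C.
Hypothesis D_gt0 : 0 < D.
Hypothesis c_lip : forall t a b d, (t < T)%N -> `|c t a d - c t b d| <= C * `|a - b|.
Hypothesis x1_range : 0 <= x1 <= D.
Hypothesis p_ge0 : forall t a, 0 <= p t a.
Hypothesis p_sum1 : forall t, \sum_a p t a = 1.
Hypothesis v_ge0 : forall t a, 0 <= v t a.
Hypothesis S_range : forall u s, (s < T)%N -> 0 <= S u s <= D.
Hypothesis S1_range : forall s, (s < T)%N -> 0 <= S1 s <= D.

Definition path_loss (U d : nat -> R) : R := \sum_(t < T) c t (post U d x1 t) (d t).

Definition dem (x : {ffun 'I_T -> V}) (t : nat) : R :=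
  if insub t is Some i then v i (x i) else 0.

Definition loss_diff u x : R := path_loss S1 (dem x) - path_loss (S u) (dem x).

Let dem_ge0 x t : 0 <= dem x t.
Proof. by rewrite /dem; case: insubP. Qed.

(** The loss is a sum over T periods and each sign multiplies two samples, which makes 2T processes.
    Jensen's inequality with equal weights treats them separately, each amplified by 2T; hence the
    factors 2^2 and T^2 in the exponent. *)
Lemma rmean_loss_diff lam (w w' : {ffun 'I_n.+1 -> {ffun 'I_T -> V}}) : 0 <= lam ->
  rmean (fun s => maxexp s (fun u i => lam * (loss_diff u (w i) - loss_diff u (w' i))))
  <= 20 * expR ((2 * 400) ^+ 2 * (lam ^+ 2 * (n.+1%:R * T%:R ^+ 2 * C ^+ 2 * D ^+ 2))).
Proof.
move=> lam0.
pose d (b : bool) i := dem (if b then w' i else w i).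
pose sg (b : bool) : R := if b then 1 else -1.
pose psi (k : bool * 'I_T) i y := sg k.1 * c k.2 y (d k.1 i k.2).
pose a (k : bool * 'I_T) u i : R :=
  psi k i (post (S u) (d k.1 i) x1 k.2) - psi k i (post S1 (d k.1 i) x1 k.2).
have T0 : 0 < T%:R :> R by rewrite ltr0n.
pose mu : R := 2 * T%:R * lam.
have mu0 : 0 <= mu by rewrite !mulr_ge0 // ltW.
have q0 : 0 <= (2 * T%:R)^-1 :> R by rewrite invr_ge0 mulr_ge0 // ltW.
have M0 s k : 0 <= maxexp s (fun u i => mu * a k u i) by exact: bigmax_ge_id.
have cardK : #|{: bool * 'I_T}|%:R = 2 * T%:R :> R.
  by rewrite card_prod card_bool card_ord natrM.
have le1 s : maxexp s (fun u i => lam * (loss_diff u (w i) - loss_diff u (w' i))) <=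
    \sum_k (2 * T%:R)^-1 * maxexp s (fun u i => mu * a k u i).
  apply: bigmax_le => [|u _]; first by apply: sumr_ge0 => k _; rewrite mulr_ge0.
  have -> : rsum s (fun i => lam * (loss_diff u (w i) - loss_diff u (w' i))) =
      \sum_k (2 * T%:R)^-1 * rsum s (fun i => mu * a k u i).
    under eq_bigr do rewrite -rsumZ.
    rewrite /rsum exchange_big /=; apply: eq_bigr => i _.
    rewrite -mulr_sumr; congr (_ * _).
    transitivity (\sum_k lam * a k u i); last first.
      apply: eq_bigr => k _; rewrite /mu; field.
      by rewrite gt_eqF.
    rewrite -mulr_sumr; congr (_ * _).
    rewrite -(pair_bigA _ (fun b t => a (b, t) u i)) big_bool /= /a /psi /= /loss_diff.
    rewrite /path_loss -!sumrB -big_split /=; apply: eq_bigr => t _.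
    by rewrite /sg /d; ring.
  apply: (le_trans (expR_jensen _ _ _)) => //.
    by rewrite sumr_const -[_ *+ _]mulr_natl cardK mulfV // mulf_neq0 ?gt_eqF.
  apply: ler_sum => k _; rewrite ler_wpM2l //.
  exact: (@le_bigmax _ _ _ _ (fun u => expR (rsum s (fun i => mu * a k u i)))).
apply: (le_trans (rmean_le le1)); rewrite rmean_sum.
set E := 20 * _.
apply: (@le_trans _ _ (\sum_(k : bool * 'I_T) (2 * T%:R)^-1 * E)); last first.
  by rewrite sumr_const -[_ *+ _]mulr_natl cardK mulrA mulfV ?mul1r // mulf_neq0 ?gt_eqF.
apply: ler_sum => k _; rewrite rmeanZ ler_wpM2l //.
have kT := ltn_ord k.2.
apply: le_trans (rmean_base_stock (t := k.2) (D := D) (C := C) (psi := psi k) (mu := mu)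
  (S := S) (S1 := S1) (d := d k.1) _ _ _ _ _ _ _ _ _) _ => //.
- exact: ltW.
- by move=> u s sk; apply: S_range; exact: leq_ltn_trans sk kT.
- by move=> s sk; apply: S1_range; exact: leq_ltn_trans sk kT.
- by move=> i r _; exact: dem_ge0.
- move=> i y z; rewrite /psi /= -mulrBr normrM.
  have -> : `|sg k.1| = 1 by rewrite /sg; case: k.1; rewrite ?normrN normr1.
  by rewrite mul1r c_lip.
rewrite /E; apply: ler_wpM2l => //; rewrite ler_expR; apply: eq_ler; rewrite /mu.
by ring.
Qed.

Lemma deviation_bound (eta delta : R) : 0 < eta -> 0 < delta < 1 ->
  20 * (2 * 400 * T%:R * C * D) ^+ 2 / eta ^+ 2 * (1 + ln (1 / delta)) <= n.+1%:R ->
  \sum_(w : {ffun 'I_n.+1 -> {ffun 'I_T -> V}} | [exists u,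
      eta < vstat loss_diff u w - \sum_x tweight p x * loss_diff u x])
    pweight (tweight p) w <= delta.
Proof.
move=> eta0 /andP[de0 de1] nbig.
have T0 : 0 < T%:R :> R by rewrite ltr0n.
have h400 : 0 < 2 * 400 :> R by apply: mulr_gt0; rewrite ltr0n.
have kap0 : 0 < (2 * 400 * T%:R * C * D) ^+ 2.
  by apply: exprn_gt0; rewrite (mulr_gt0 (mulr_gt0 (mulr_gt0 h400 _) _) _) ?ltr0n.
set kap := (2 * 400 * T%:R * C * D) ^+ 2 in kap0 nbig.
(* The minimiser of lam^2 kap - lam eta, which leaves the exponent - n eta^2 / (4 kap), with n.+1 in
   place of n. *)
pose lam := eta / (2 * kap).
have lam0 : 0 < lam by rewrite divr_gt0 // mulr_gt0.
have N0 : 0 < n.+1%:R :> R by rewrite ltr0n.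
have := @decoupling R n T V F p loss_diff lam (20 * expR (lam ^+ 2 * n.+1%:R * kap)).
move=> /(_ p_ge0 p_sum1) h.
have {}h := h _.
have pw0 (w : {ffun 'I_n.+1 -> {ffun 'I_T -> V}}) : 0 <= pweight (tweight p) w.
  by apply: pweight_ge0 => x; exact: tweight_ge0.
set P := \sum_(w | _) _.
have le1 : P * expR (lam * n.+1%:R * eta) <= 20 * expR (lam ^+ 2 * n.+1%:R * kap).
  apply: le_trans (h _); last first.
    move=> w w'; apply: (le_trans (rmean_loss_diff w w' (ltW lam0))).
    by apply: ler_wpM2l => //; rewrite ler_expR; apply: eq_ler; rewrite /kap; ring.
  rewrite mulr_suml [leRHS](bigID (fun w => [exists u,
      eta < vstat loss_diff u w - \sum_x tweight p x * loss_diff u x])) /=.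
  rewrite -[leLHS]addr0; apply: lerD; last first.
    by apply: sumr_ge0 => w _; rewrite mulr_ge0 //; exact: bigmax_ge_id.
  apply: ler_sum => w /existsP[u hu]; rewrite ler_wpM2l //.
  apply: le_trans (@le_bigmax _ _ _ 0 (fun u => expR (lam * n.+1%:R *
    (vstat loss_diff u w - \sum_x tweight p x * loss_diff u x))) u).
  by rewrite ler_expR; apply: ler_wpM2l; [rewrite mulr_ge0 // ltW|exact: ltW].
have L0 : 0 < 1 / delta by rewrite divr_gt0.
set L := ln (1 / delta) in nbig.
have dE : delta = expR (- L) by rewrite expRN /L lnK ?posrE // invf_div divr1.
have Lge : 0 <= L by rewrite ln_ge0 // ler_pdivlMr // mul1r ltW.
(* The sample size is chosen for 5 (1 + L): the 5 absorbs the prefactor, as 20 <= 2^5 <= e^5, and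
   the remaining 5 L more than covers delta = e^-L. *)
have big2 : 5 * (1 + L) <= n.+1%:R * eta ^+ 2 / (4 * kap).
  rewrite ler_pdivlMr ?mulr_gt0 //.
  rewrite -ler_pdivrMr ?exprn_gt0 //.
  by apply: le_trans nbig; apply: eq_ler; ring.
have e1 : lam * n.+1%:R * eta = n.+1%:R * eta ^+ 2 / (4 * kap) + lam ^+ 2 * n.+1%:R * kap.
  by rewrite /lam; field; rewrite gt_eqF.
rewrite dE -(ler_pM2r (expR_gt0 (lam * n.+1%:R * eta))); apply: (le_trans le1).
rewrite -expRD {1}e1.
apply: (@le_trans _ _ (expR 5 * expR (lam ^+ 2 * n.+1%:R * kap))).
  rewrite ler_wpM2r ?expR_ge0 //.
  have h1 : 2 <= expR 1 :> R by have := @expR_ge1Dx R 1; lra.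
  rewrite -[5]mulr1 expRM_natl; apply: (@le_trans _ _ (2 ^+ 5)); first lra.
  by rewrite lerXn2r // nnegrE ?expR_ge0.
rewrite -expRD ler_expR; lra.
Qed.

End base_stock_deviation.

(** * Policies, dynamic programming and product ERM *)

Section product_law_integral.
Context {R : realType}.
Local Notation MR := (measurableTypeR R).

Lemma ge0_integral_product_law_cons (Q : nat -> probability MR R) n
    (f : n.+1.-tuple MR -> \bar R) :
  measurable_fun [set: n.+1.-tuple MR] f -> (forall d, 0 <= f d)%E ->
  (\int[product_law Q n.+1]_d f d =
   \int[Q 0%N]_u \int[product_law (fun t => Q t.+1) n]_v f [tuple of u :: v])%E.
Proof.
move=> mf f0; rewrite /product_law -/product_law ge0_integral_distribution //.
rewrite fubini_tonelli1 //; last by move=> ?; exact: f0.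
by apply: measurableT_comp => //; exact: measurable_prepend.
Qed.

Lemma measurable_rcons d (X : measurableType d) d' (Y : measurableType d') n
    (f : X -> n.-tuple Y) (g : X -> Y) :
  measurable_fun setT f -> measurable_fun setT g ->
  measurable_fun setT (fun x => [tuple of rcons (f x) (g x)]).
Proof.
move=> mf mg; apply/measurable_fun_tnthP => i.
have [ni|ni] := ltnP i n.
  rewrite (_ : _ \o _ = fun x => tnth (f x) (Ordinal ni)); last first.
    apply/funext => x /=; rewrite (tnth_nth (g x)) /= nth_rcons size_tuple ni.
    by rewrite (tnth_nth (g x)).
  by apply: measurableT_comp (measurable_tnth _) mf.
rewrite (_ : _ \o _ = g) //; apply/funext => x /=.
rewrite (tnth_nth (g x)) /= nth_rcons size_tuple ltnNge ni /=.
by case: eqP => // /eqP; rewrite eqn_leq ni andbT -ltnS ltn_ord.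
Qed.

End product_law_integral.

Section policy_path.
Context {R : realType}.
Local Notation MR := (measurableTypeR R).
Variables (pi : @policy R) (phi : nat -> R -> R -> R -> R).
Local Notation state t := (MR * t.-tuple (MR * MR * MR))%type.

Definition step (s : seed pi) t (st : state t) (u : R) : state t.+1 :=
  let y : R := Defs.order (s, st.2, st.1) in
  (Num.max (y - u) 0, [tuple of rcons st.2 (st.1, y, Num.min u y)]).

(* Total of phi over the k periods that start in period t from the state st, the
   demands being e 0, e 1, ... *)
Fixpoint accum (s : seed pi) k t (st : state t) (e : nat -> R) : R :=
  if k is k'.+1 then
    phi t st.1 (Defs.order (s, st.2, st.1)) (e 0%N) +
    accum s k' (step s st (e 0%N)) (fun r => e r.+1)
  else 0.

Lemma runS s x1 d t : run (pi := pi) s x1 d t.+1 = step s (run s x1 d t) (d t).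
Proof. by rewrite /=; case: (run s x1 d t). Qed.

Lemma accum_run s x1 d k t :
  \sum_(t <= r < t + k) phi r (run (pi := pi) s x1 d r).1
     (Defs.order (s, (run s x1 d r).2, (run s x1 d r).1)) (d r) =
  accum s k (run s x1 d t) (fun r => d (t + r)%N).
Proof.
elim: k t => [|k IH] t; first by rewrite addn0 big_geq.
rewrite big_ltn ?addnS ?ltnS ?leq_addr // -addSn IH runS /= addn0; congr (_ + accum _ _ _ _).
by apply/funext => r; rewrite addSnnS.
Qed.

Hypothesis mphi : forall t, measurable_fun setT (fun w : MR * MR * MR => (phi t w.1.1 w.1.2 w.2 : MR)).

Lemma measurable_accum k t :
  measurable_fun [set: seed pi * state t * k.-tuple MR] (fun w =>
    (accum w.1.1 k w.1.2 (nth 0 w.2) : MR)).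
Proof.
elim: k t => [|k IH] t; first exact: measurable_cst.
pose X := (seed pi * state t * k.+1.-tuple MR)%type.
have ms : measurable_fun [set: X] (fun w => w.1.1).
  exact: measurableT_comp.
have mst : measurable_fun [set: X] (fun w => w.1.2) by exact: measurableT_comp.
have mx : measurable_fun [set: X] (fun w => w.1.2.1).
  exact: measurableT_comp measurable_fst mst.
have mh : measurable_fun [set: X] (fun w => w.1.2.2).
  exact: measurableT_comp measurable_snd mst.
have my : measurable_fun [set: X] (fun w => Defs.order (w.1.1, w.1.2.2, w.1.2.1) : MR).
  apply: measurableT_comp (@measurable_order _ pi t) _.
  by apply/measurable_fun_pairP; split; [apply/measurable_fun_pairP; split|].
have mu : measurable_fun [set: X] (fun w => nth 0 w.2 0%N : MR).
  rewrite (_ : (fun _ => _) = fun w : X => tnth w.2 ord0).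
    by apply: measurableT_comp (measurable_tnth _) measurable_snd.
  by apply/funext => w; rewrite (tnth_nth 0).
have mstep : measurable_fun [set: X] (fun w => step w.1.1 w.1.2 (nth 0 w.2 0%N)).
  apply/measurable_fun_pairP; split => /=.
    by apply: measurable_maxr => //; exact: measurable_funB.
  apply: measurable_rcons => //.
  apply/measurable_fun_pairP; split; first by apply/measurable_fun_pairP.
  exact: measurable_minr.
apply: measurable_funD => /=.
  have mt : measurable_fun [set: X]
      (fun w => (w.1.2.1, Defs.order (w.1.1, w.1.2.2, w.1.2.1), nth 0 w.2 0%N) : MR * MR * MR).
    by apply/measurable_fun_pairP; split => //; apply/measurable_fun_pairP.
  exact: (measurableT_comp (mphi t) mt).
have mtl : measurable_fun [set: X] (fun w : X => [tuple of behead w.2]).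
  by apply: measurableT_comp (@measurable_behead _ MR k) measurable_snd.
rewrite (_ : (fun _ => _) = (fun w : seed pi * state t.+1 * k.-tuple MR =>
    accum w.1.1 k w.1.2 (nth 0 w.2)) \o
    (fun w : X => (w.1.1, step w.1.1 w.1.2 (nth 0 w.2 0%N), [tuple of behead w.2]))); last first.
  apply/funext => w /=; congr accum; apply/funext => r.
  by rewrite nth_behead.
apply: measurableT_comp (IH t.+1) _.
by apply/measurable_fun_pairP; split => //; apply/measurable_fun_pairP.
Qed.

End policy_path.

Section bounded_mean.
Context {R : realType}.
Local Notation MR := (measurableTypeR R).
Variables (mu : probability MR R) (D : R).
Hypothesis D_gt0 : 0 < D.
Hypothesis mu_supp : mu [set` `[0, D]] = 1%E.
Local Notation I := [set` `[0, D]].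

(** Restricting the integral to [0, D], which carries the whole mass, makes every Lipschitz
    integrand integrable although costs are unbounded on the line. *)
Definition mean (f : R -> R) : R := Rintegral mu (I : set MR) (f : MR -> R).

Definition bounded_measurable (f : R -> R) :=
  measurable_fun [set: MR] (f : MR -> MR) /\
  exists B, forall x, 0 <= x <= D -> `|f x| <= B.

Let mI : measurable (I : set MR). Proof. exact: measurable_itv. Qed.

Lemma bounded_integrable f : bounded_measurable f ->
  mu.-integrable (I : set MR) (EFin \o f).
Proof.
move=> [mf [B fB]]; apply: measurable_bounded_integrable => //.
- by apply: le_lt_trans (probability_le1 _ _) (ltry _).
- exact: measurable_funS mf.
- exists B; split; first exact: num_real.
  move=> x Bx y; rewrite /= in_itv /= => yI.
  exact: le_trans (fB _ yI) (ltW Bx).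
Qed.

Lemma integral_mean f : bounded_measurable f -> (forall x, 0 <= f x) ->
  (\int[mu]_x (f x)%:E = (mean f)%:E)%E.
Proof.
move=> nf f0; have [mf _] := nf.
have mC : measurable (~` (I : set MR)) by exact: measurableC.
have C0 : mu (~` I) = 0%E.
  by have := probability_setC mu mI; rewrite mu_supp subee.
rewrite /mean fineK; last exact: integrable_fin_num (bounded_integrable nf).
rewrite (@ge0_negligible_integral _ _ _ mu setT (~` (I : set MR))) //.
- by rewrite setTD setCK.
- exact/measurable_EFinP.
- by move=> x _; rewrite lee_fin.
Qed.

Lemma mean_le f g : bounded_measurable f -> bounded_measurable g ->
  (forall x, 0 <= x <= D -> f x <= g x) -> mean f <= mean g.
Proof.
move=> nf ng fg; apply: le_Rintegral => //; try exact: bounded_integrable.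
Qed.

Lemma mean_cst c : mean (fun=> c) = c.
Proof. by rewrite /mean Rintegral_cst // -[RHS]mulr1; congr (_ * _); exact: (congr1 fine mu_supp). Qed.

Lemma meanD f g : bounded_measurable f -> bounded_measurable g ->
  mean (fun x => f x + g x) = mean f + mean g.
Proof. by move=> nf ng; apply: RintegralD => //; exact: bounded_integrable. Qed.

Lemma meanZ c f : bounded_measurable f -> mean (fun x => c * f x) = c * mean f.
Proof. by move=> nf; apply: RintegralZl => //; exact: bounded_integrable. Qed.

Lemma lipschitz_measurable f L : (forall x y, `|f x - f y| <= L * `|x - y|) ->
  measurable_fun [set: MR] (f : MR -> MR).
Proof.
move=> fL; apply: continuous_measurable_fun => x; apply/cvgrPdist_lt => e e0.
have L1 : 0 < `|L| + 1 by rewrite ltr_wpDl.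
near=> y; apply: (le_lt_trans (fL x y)).
apply: (@le_lt_trans _ _ ((`|L| + 1) * `|x - y|)).
  by rewrite ler_wpM2r // (le_trans (ler_norm L)) // lerDl.
rewrite mulrC -ltr_pdivlMr //; near: y.
by exists (e / (`|L| + 1)); rewrite /= ?divr_gt0.
Unshelve. all: by end_near. Qed.

Lemma lipschitz_bounded f L : (forall x y, `|f x - f y| <= L * `|x - y|) ->
  bounded_measurable f.
Proof.
move=> fL; split; first exact: lipschitz_measurable fL.
exists (`|f 0| + `|L| * D) => x /andP[x0 xD].
have := fL x 0; rewrite subr0 (ger0_norm x0) => h.
have h1 : L * x <= `|L| * D.
  by rewrite (le_trans (ler_wpM2r x0 (ler_norm L))) // ler_wpM2l.
have := ler_normD (f x - f 0) (f 0); rewrite subrK; lra.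
Qed.

End bounded_mean.

(** * The Bellman step: convexity, monotonicity and critical ratios *)

Section dynamic_programming.
Context {R : realType}.
Local Notation MR := (measurableTypeR R).
Variable M : inventory R.
Local Notation T := (horizon M).
Local Notation D := (dmax M).
Local Notation C := (cost_bound M).

Let D_gt0 : 0 < D := dmax_gt0 M.

Lemma cost_bound_ge t : (t < T)%N -> hold M t <= C /\ short M t <= C.
Proof.
move=> tT; have := @le_bigmax _ _ _ 0 (fun s : 'I_T => Num.max (hold M s) (short M s)) (Ordinal tT).
by rewrite ge_max => /andP[].
Qed.

Lemma cost_bound_gt0 : 0 < C.
Proof.
have T0 := horizon_gt0 M.
by apply: lt_le_trans (hold_gt0 T0) _; case: (cost_bound_ge T0).
Qed.

Lemma cost_ge0 t y d : (t < T)%N -> 0 <= cost M t y d.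
Proof.
move=> tT; rewrite addr_ge0 // mulr_ge0 ?le_max ?lexx ?orbT //.
  exact/ltW/hold_gt0.
exact/ltW/short_gt0.
Qed.

Let max0_split (x y : R) : Num.max (x - y) 0 - Num.max (y - x) 0 = x - y.
Proof. by case: (lerP (x - y) 0); case: (lerP (y - x) 0) => *; lra. Qed.

Let max0_mono (x y : R) : x <= y -> Num.max x 0 <= Num.max y 0.
Proof. by move=> xy; rewrite ge_max !le_max xy lexx orbT. Qed.

Lemma cost_lip t a b d : (t < T)%N -> `|cost M t a d - cost M t b d| <= C * `|a - b|.
Proof.
move=> tT; wlog : a b / b <= a.
  move=> H; have [/H//|/H h] := orP (le_total b a).
  by rewrite distrC (distrC a b).
move=> ab; have [hC pC] := cost_bound_ge tT.
have h0 := hold_gt0 tT; have p0 := short_gt0 tT.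
pose al := Num.max (a - d) 0 - Num.max (b - d) 0.
pose be := Num.max (d - b) 0 - Num.max (d - a) 0.
have [al0 be0 abE] : [/\ 0 <= al, 0 <= be & a - b = al + be].
  have m1 := max0_mono (_ : b - d <= a - d); have m2 := max0_mono (_ : d - a <= d - b).
  rewrite lerD2r in m1; rewrite lerD2l lerN2 in m2.
  have := m1 ab; have := m2 ab; have := max0_split a d; have := max0_split b d.
  by rewrite /al /be; split; lra.
have -> : cost M t a d - cost M t b d = hold M t * al - short M t * be.
  by rewrite /cost /al /be; ring.
have e1 := ler_wpM2r al0 hC; have e2 := ler_wpM2r be0 pC.
have f1 : 0 <= hold M t * al by rewrite mulr_ge0 // ltW.
have f2 : 0 <= short M t * be by rewrite mulr_ge0 // ltW.
rewrite [leRHS](_ : _ = C * al + C * be); last by rewrite ger0_norm ?subr_ge0 // abE mulrDr.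
by rewrite ler_norml; apply/andP; split; lra.
Qed.

Lemma cost_lip_demand t a d e : (t < T)%N -> `|cost M t a d - cost M t a e| <= C * `|d - e|.
Proof.
move=> tT; wlog : d e / e <= d.
  move=> H; have [/H//|/H h] := orP (le_total e d).
  by rewrite distrC (distrC d e).
move=> ab; have [hC pC] := cost_bound_ge tT.
have h0 := hold_gt0 tT; have p0 := short_gt0 tT.
pose al := Num.max (a - e) 0 - Num.max (a - d) 0.
pose be := Num.max (d - a) 0 - Num.max (e - a) 0.
have [al0 be0 abE] : [/\ 0 <= al, 0 <= be & d - e = al + be].
  have m1 := max0_mono (_ : a - d <= a - e); have m2 := max0_mono (_ : e - a <= d - a).
  rewrite lerD2l lerN2 in m1; rewrite lerD2r in m2.
  have := m1 ab; have := m2 ab; have := max0_split a d; have := max0_split a e.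
  by rewrite /al /be; split; lra.
have -> : cost M t a d - cost M t a e = short M t * be - hold M t * al.
  by rewrite /cost /al /be; ring.
have e1 := ler_wpM2r al0 hC; have e2 := ler_wpM2r be0 pC.
have f1 : 0 <= hold M t * al by rewrite mulr_ge0 // ltW.
have f2 : 0 <= short M t * be by rewrite mulr_ge0 // ltW.
rewrite [leRHS](_ : _ = C * al + C * be); last by rewrite ger0_norm ?subr_ge0 // abE mulrDr.
by rewrite ler_norml; apply/andP; split; lra.
Qed.

Definition convex_on_line (f : R -> R) := forall a x y, 0 <= a <= 1 ->
  f (a * x + (1 - a) * y) <= a * f x + (1 - a) * f y.

Lemma convex_max b c : convex_on_line (fun x => Num.max (x - b) c).
Proof.
move=> a x y /andP[a0 a1]; have a2 : 0 <= 1 - a by lra.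
have u1 := ler_wpM2l a0 (_ : x - b <= Num.max (x - b) c); rewrite le_max lexx in u1.
have u2 := ler_wpM2l a0 (_ : c <= Num.max (x - b) c); rewrite le_max lexx orbT in u2.
have v1 := ler_wpM2l a2 (_ : y - b <= Num.max (y - b) c); rewrite le_max lexx in v1.
have v2 := ler_wpM2l a2 (_ : c <= Num.max (y - b) c); rewrite le_max lexx orbT in v2.
rewrite ge_max; apply/andP; split.
  apply: le_trans (lerD (u1 isT) (v1 isT)); apply: eq_ler; ring.
apply: le_trans (lerD (u2 isT) (v2 isT)); apply: eq_ler; ring.
Qed.

Lemma convex_cost t d : (t < T)%N -> convex_on_line (fun y => cost M t y d).
Proof.
move=> tT a x y a01; have h0 := ltW (hold_gt0 tT); have p0 := ltW (short_gt0 tT).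
have h1 := ler_wpM2l h0 (@convex_max d 0 a x y a01).
have h2 : Num.max (d - (a * x + (1 - a) * y)) 0 <=
    a * Num.max (d - x) 0 + (1 - a) * Num.max (d - y) 0.
  have := @convex_max (- d) 0 a (- x) (- y) a01; rewrite /= !opprK.
  rewrite (_ : a * - x + (1 - a) * - y + d = d - (a * x + (1 - a) * y)); last by ring.
  by rewrite ![- _ + d]addrC.
have := ler_wpM2l p0 h2; rewrite /cost; lra.
Qed.

(** The invariants of the Bellman recursion. Value functions increase with the stock because stock
    only restricts the admissible levels; this monotonicity is what keeps v (max (y - d) 0) convex
    in y. The Lipschitz bound provides measurability and integrability. *)
Definition value_like (v : R -> R) := [/\
  forall x, 0 <= v x, forall x y, x <= y -> v x <= v y, convex_on_line v &
  exists L, forall x y, `|v x - v y| <= L * `|x - y|].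

Lemma max_sub_lip (b c x y : R) : `|Num.max (x - b) c - Num.max (y - b) c| <= `|x - y|.
Proof.
by rewrite ler_norml; case: (lerP (x - b) c) => ?; case: (lerP (y - b) c) => ?;
  have := ler_norm (x - y); have := ler_norm (y - x); rewrite [`|y - x|]distrC; lra.
Qed.

Section step.
Variables (mu : probability MR R) (t : nat) (v : R -> R).
Hypothesis mu_supp : mu [set` `[0, D]] = 1%E.
Hypothesis tT : (t < T)%N.
Hypothesis vv : value_like v.

Let g y d := cost M t y d + v (Num.max (y - d) 0).
Definition onward y := mean mu D (g y).

Lemma integrand_lip : exists L, forall y y' d d',
  `|g y d - g y' d'| <= L * (`|y - y'| + `|d - d'|).
Proof.
have [_ _ _ [L vL]] := vv; exists (C + `|L|) => y y' d d'.
have h1 := cost_lip y y' d tT; have h2 := cost_lip_demand y' d d' tT.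
have h3 : `|v (Num.max (y - d) 0) - v (Num.max (y' - d') 0)| <= `|L| * (`|y - y'| + `|d - d'|).
  apply: (le_trans (vL _ _)); apply: (@le_trans _ _ (`|L| * `|Num.max (y - d) 0 - Num.max (y' - d') 0|)).
    by rewrite ler_wpM2r // ler_norm.
  rewrite ler_wpM2l //.
  have := max_sub_lip 0 0 (y - d) (y' - d'); rewrite !subr0 => /le_trans; apply.
  rewrite (_ : y - d - (y' - d') = (y - y') - (d - d')); last by ring.
  exact: ler_normB.
rewrite /g (_ : _ - _ = (cost M t y d - cost M t y' d) + (cost M t y' d - cost M t y' d') +
  (v (Num.max (y - d) 0) - v (Num.max (y' - d') 0))); last by ring.
have := ler_normD (cost M t y d - cost M t y' d + (cost M t y' d - cost M t y' d'))
  (v (Num.max (y - d) 0) - v (Num.max (y' - d') 0)).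
have := ler_normD (cost M t y d - cost M t y' d) (cost M t y' d - cost M t y' d').
rewrite mulrDl mulrDr; lra.
Qed.

Let nice (f : R -> R) L : (forall x y, `|f x - f y| <= L * `|x - y|) -> bounded_measurable D f.
Proof. exact: lipschitz_bounded. Qed.

Lemma bounded_cost y : bounded_measurable D (cost M t y).
Proof. by apply: (nice (L := C)) => d d'; exact: cost_lip_demand. Qed.

Lemma bounded_value y : bounded_measurable D (fun d => v (Num.max (y - d) 0)).
Proof.
have [_ _ _ [L vL]] := vv; apply: (nice (L := `|L|)) => d d'.
apply: (le_trans (vL _ _)).
apply: (@le_trans _ _ (`|L| * `|Num.max (y - d) 0 - Num.max (y - d') 0|)).
  by rewrite ler_wpM2r // ler_norm.
rewrite ler_wpM2l //.
have := max_sub_lip 0 0 (y - d) (y - d'); rewrite !subr0 => /le_trans; apply.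
by rewrite (_ : y - d - (y - d') = - (d - d')) ?normrN //; ring.
Qed.

Lemma bounded_integrand y : bounded_measurable D (g y).
Proof.
have [L gL] := integrand_lip; apply: (nice (L := L)) => d d'.
by have := gL y y d d'; rewrite subrr normr0 add0r.
Qed.

Lemma cost_to_goE Q : Q t = mu -> forall y,
  cost_to_go M Q (fun x => (v x)%:E) t y = (onward y)%:E.
Proof.
move=> Qt y; have [v0 _ _ _] := vv; rewrite /cost_to_go Qt.
rewrite (integral_mean mu_supp (bounded_cost y)); last by move=> d; exact: cost_ge0.
rewrite (integral_mean mu_supp (bounded_value y)) //.
rewrite -EFinD -meanD //; [exact: bounded_cost|exact: bounded_value].
Qed.

Lemma onward_ge0 y : 0 <= onward y.
Proof.
have [v0 _ _ _] := vv; apply: Rintegral_ge0 => d _.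
by rewrite addr_ge0 // cost_ge0.
Qed.

Lemma onward_lip : exists L, forall y y', `|onward y - onward y'| <= L * `|y - y'|.
Proof.
have [L gL] := integrand_lip; exists L => y y'.
have main a b : onward a - onward b <= L * `|a - b|.
  rewrite lerBlDl -[X in _ + X](mean_cst mu_supp).
  rewrite -meanD //; [|exact: bounded_integrand|]; last first.
    by split; [exact: measurable_cst|exists `|L * `|a - b| | => x _].
  apply: mean_le => //; first exact: bounded_integrand.
    split; last first.
      have [_ [B hB]] := bounded_integrand b.
      exists (B + `|L * `|a - b| |) => x /hB h.
      by rewrite (le_trans (ler_normD _ _)) // lerD2r.
    by apply: measurable_funD; [case: (bounded_integrand b)|exact: measurable_cst].
  move=> d _; have := gL a b d d; rewrite subrr normr0 addr0 => h.
  by have := ler_norm (g a d - g b d); lra.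
rewrite ler_norml main andbT.
by have := main y' y; rewrite [`|y' - y|]distrC; lra.
Qed.

Lemma onward_convex : convex_on_line onward.
Proof.
have [v0 vm vc _] := vv; move=> a x y a01; have /andP[a0 a1] := a01.
rewrite -!meanZ; try exact: bounded_integrand.
have bz b z : bounded_measurable D (fun d => b * g z d).
  have [L gL] := integrand_lip; apply: (nice (L := `|b| * L)) => d d'.
  rewrite -mulrBr normrM -mulrA ler_wpM2l //.
  by have := gL z z d d'; rewrite subrr normr0 add0r.
rewrite -meanD //; apply: mean_le => //; first exact: bounded_integrand.
  have [m1 [B1 b1]] := bz a x; have [m2 [B2 b2]] := bz (1 - a) y.
  split; first exact: measurable_funD.
  exists (B1 + B2) => d dD; rewrite (le_trans (ler_normD _ _)) // lerD //; [exact: b1|exact: b2].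
move=> d _; rewrite /g.
have h1 := convex_cost d tT x y a01.
have h2 := vm _ _ (@convex_max d 0 a x y a01).
have := vc a (Num.max (x - d) 0) (Num.max (y - d) 0) a01; lra.
Qed.

(** No demand exceeds [D]: above it there is no shortage left to save, while holding cost and
    carried stock grow. Minimisation can therefore be confined to the compact interval [0, D]. *)
Lemma onward_le y : D <= y -> onward D <= onward y.
Proof.
have [_ vm _ _] := vv; move=> Dy; apply: mean_le; try exact: bounded_integrand.
move=> d /andP[d0 dD]; apply: lerD; last by apply: vm; apply: max0_mono; rewrite lerD2r.
rewrite /cost !(max_r (_ : d - _ <= 0)) ?subr_le0 ?(le_trans dD) // !mulr0 !addr0.
by apply: ler_wpM2l; [exact/ltW/hold_gt0|apply: max0_mono; rewrite lerD2r].
Qed.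

(* Past a, an extra unit of stock costs hold on demands at most a and saves at most
   short on the others. *)
Lemma onward_lt a y : ((critical_ratio M t)%:E < mu [set` `]-oo, a]])%E -> a < y ->
  onward a < onward y.
Proof.
have [_ vm _ _] := vv; move=> qF ay.
have h0 := hold_gt0 tT; have p0 := short_gt0 tT.
pose A : set MR := [set` `]-oo, a]].
have mA : measurable A by exact: measurable_itv.
pose F := fine (mu A).
have FE : mu A = F%:E by rewrite fineK // fin_num_measure.
have qF' : short M t < F * (hold M t + short M t).
  by move: qF; rewrite FE lte_fin /critical_ratio ltr_pdivrMr // addr_gt0.
have bA : bounded_measurable D (\1_A : R -> R).
  split; first exact: measurable_indic.
  by exists 1 => x _; rewrite indicE; case: (_ \in _); rewrite ?normr1 ?normr0.
have meanA : mean mu D \1_A = F.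
  apply: EFin_inj; rewrite -(integral_mean mu_supp bA); last by move=> x; rewrite indicE.
  by rewrite integral_indic // setIT; exact: FE.
have bc c : bounded_measurable D (fun=> c).
  by split; [exact: measurable_cst|exists `|c| => x _].
pose k := (y - a) * (hold M t + short M t).
have bk : bounded_measurable D (fun d => k * \1_A d).
  split; first by apply: measurable_funM => //; exact: measurable_indic.
  exists `|k| => x _; rewrite indicE; case: (_ \in _); rewrite ?mulr1 ?mulr0 ?normr0 //.
have bs f1 f2 : bounded_measurable D f1 -> bounded_measurable D f2 ->
    bounded_measurable D (fun d => f1 d + f2 d).
  move=> [m1 [B1 b1]] [m2 [B2 b2]]; split; first exact: measurable_funD.
  by exists (B1 + B2) => d dD; rewrite (le_trans (ler_normD _ _)) // lerD //; [exact: b1|exact: b2].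
apply: (@lt_le_trans _ _ (onward a + (- ((y - a) * short M t) + k * F))).
  have : 0 < (y - a) * (F * (hold M t + short M t) - short M t).
    by rewrite mulr_gt0 // subr_gt0.
  by rewrite /k; set u := y - a; rewrite ltrDl => h; apply: lt_le_trans h _; apply: eq_ler; ring.
rewrite -meanA -meanZ // -[X in X + mean _ _ _](mean_cst mu_supp).
rewrite -meanD //.
rewrite -meanD //; [|exact: bounded_integrand|by apply: (bs)].
apply: mean_le; [apply: (bs); [exact: bounded_integrand|by apply: (bs)]|
  exact: bounded_integrand|].
move=> d _; rewrite /g.
have hv : v (Num.max (a - d) 0) <= v (Num.max (y - d) 0).
  by apply: vm; apply: max0_mono; rewrite lerD2r ltW.
suff : cost M t a d + (- ((y - a) * short M t) + k * \1_A d) <= cost M t y d by lra.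
have m1 := max0_mono (_ : a - d <= y - d); rewrite lerD2r in m1; have {}m1 := m1 (ltW ay).
have s1 := max0_split a d; have s2 := max0_split y d.
rewrite indicE; have [dA|dA] := boolP (d \in A).
  move: dA; rewrite inE /A /= in_itv /= => da; rewrite /cost /k.
  have dy := le_trans da (ltW ay).
  rewrite (max_l (_ : 0 <= a - d)) ?subr_ge0 // (max_l (_ : 0 <= y - d)) ?subr_ge0 //.
  rewrite !(max_r (_ : d - _ <= 0)) ?subr_le0 //.
  by apply: eq_ler; rewrite /=; ring.
rewrite mulr0 addr0 /cost.
have h1 := ler_wpM2l (ltW h0) m1.
suff : short M t * (Num.max (d - a) 0 - Num.max (d - y) 0) <= (y - a) * short M t by lra.
by rewrite [leRHS]mulrC; apply: ler_wpM2l; [exact: ltW|lra].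
Qed.

Lemma onward_minimizer : exists2 s, 0 <= s <= D & forall y, 0 <= y -> onward s <= onward y.
Proof.
have [L gL] := onward_lip.
have cont : {within `[0, D]%classic, continuous onward}.
  apply: continuous_subspaceT => x; apply/cvgrPdist_lt => e e0.
  have L1 : 0 < `|L| + 1 by rewrite ltr_wpDl.
  near=> y; apply: (le_lt_trans (gL x y)).
  apply: (@le_lt_trans _ _ ((`|L| + 1) * `|x - y|)).
    by rewrite ler_wpM2r // (le_trans (ler_norm L)) // lerDl.
  rewrite mulrC -ltr_pdivlMr //; near: y.
  by exists (e / (`|L| + 1)); rewrite /= ?divr_gt0.
have [s sD smin] := EVT_min (ltW D_gt0) cont.
exists s => // y y0; have [yD|Dy] := leP y D; first by apply: smin; rewrite in_itv /= y0.
apply: (le_trans (smin D _)); first by rewrite in_itv /= lexx ltW.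
exact/onward_le/ltW.
Unshelve. all: by end_near. Qed.

Lemma convex_min_mono (f : R -> R) s x y : convex_on_line f -> f s <= f y ->
  s <= x -> x <= y -> f x <= f y.
Proof.
move=> fc fsy sx xy; have [->//|ny] := eqVneq x y.
have sy : 0 < y - s by rewrite subr_gt0 (le_lt_trans sx) // lt_neqAle ny.
pose a := (y - x) / (y - s).
have a0 : 0 <= a by apply: divr_ge0; [rewrite subr_ge0|exact: ltW].
have a1 : a <= 1 by rewrite ler_pdivrMr // mul1r lerD2l lerN2.
have -> : x = a * s + (1 - a) * y by rewrite /a; field; rewrite gt_eqF.
have := fc a s y; rewrite a0 a1 => /(_ isT); have := ler_wpM2l a0 fsy; lra.
Qed.

Section next_value.
Variable s : R.
Hypothesis s_range : 0 <= s <= D.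
Hypothesis s_min : forall y, 0 <= y -> onward s <= onward y.

(** By convexity the cost is nondecreasing to the right of a minimiser, so a stock above [s] is best
    left as it is. This is the optimality of base-stock decisions. *)
Lemma onward_order_up x y : Num.max x 0 <= y -> onward (Num.max x s) <= onward y.
Proof.
have /andP[s0 _] := s_range.
rewrite ge_max => /andP[xy y0]; case: (leP x s) => [_|/ltW sx]; first exact: s_min.
by apply: (convex_min_mono onward_convex (s_min y0)).
Qed.

Lemma onward_up_mono x y : s <= x -> x <= y -> onward x <= onward y.
Proof.
have /andP[s0 _] := s_range; move=> sx xy.
apply: (convex_min_mono onward_convex (s_min _) sx xy).
exact: le_trans s0 (le_trans sx xy).
Qed.

Lemma value_like_next : value_like (fun x => onward (Num.max x s)).
Proof.
split.
- by move=> x; exact: onward_ge0.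
- move=> x y xy; apply: onward_up_mono; first by rewrite le_max lexx orbT.
  by rewrite ge_max !le_max xy lexx orbT.
- move=> a x y a01; apply: le_trans _ (onward_convex _ _ a01).
  apply: onward_up_mono; first by rewrite le_max lexx orbT.
  by have := @convex_max 0 s a x y a01; rewrite !subr0.
- have [L gL] := onward_lip; exists `|L| => x y; apply: (le_trans (gL _ _)).
  apply: (@le_trans _ _ (`|L| * `|Num.max x s - Num.max y s|)).
    by rewrite ler_wpM2r // ler_norm.
  by rewrite ler_wpM2l //; have := max_sub_lip 0 s x y; rewrite !subr0.
Qed.

Lemma ereal_inf_next x :
  ereal_inf [set (onward y)%:E | y in [set y | Num.max x 0 <= y]] = (onward (Num.max x s))%:E.
Proof.
have /andP[s0 _] := s_range; apply/eqP; rewrite eq_le; apply/andP; split.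
  apply: ereal_inf_lbound; exists (Num.max x s) => //=.
  by rewrite ge_max !le_max lexx s0 orbT.
by apply: le_ereal_inf_tmp => _ [y /= xy <-]; rewrite lee_fin; exact: onward_order_up.
Qed.

End next_value.

End step.

End dynamic_programming.

Lemma integral_probability_cst {R : realType} d (X : measurableType d) (P : probability X R) (r : R) :
  (\int[P]_x r%:E = r%:E)%E.
Proof.
by rewrite integral_cst // -[RHS]mule1; congr (_ * _)%E; exact: probability_setT.
Qed.

(** * Performance difference: costs as value plus Bellman gaps *)

Section performance.
Context {R : realType}.
Local Notation MR := (measurableTypeR R).
Variables (M : inventory R) (Q : nat -> probability MR R).
Local Notation T := (horizon M).
Local Notation D := (dmax M).
Hypothesis Q_supp : supported M Q.

Lemma bellman_value_like k t : (t + k = T)%N ->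
  exists2 v, value_like v & bellman M Q k t = EFin \o v.
Proof.
elim: k t => [|k IH] t tk.
  exists (fun=> 0) => //; split => //= [a x y _|]; first by rewrite !mulr0 addr0.
  by exists 0 => x y; rewrite subrr normr0 mul0r.
have tT : (t < T)%N by rewrite -tk addnS ltnS leq_addr.
have [|v vv vE] := IH t.+1; first by rewrite addSnnS.
have [s sD smin] := onward_minimizer (Q_supp tT) tT vv.
exists (fun x => onward M (Q t) t v (Num.max x s)).
  exact: (value_like_next (Q_supp tT) tT vv sD smin).
apply/funext => x /=; rewrite -(ereal_inf_next tT vv sD smin) vE.
congr ereal_inf; apply/seteqP; split => z [y xy <-]; exists y => //.
  by rewrite (cost_to_goE (Q_supp tT) tT vv).
by rewrite (cost_to_goE (Q_supp tT) tT vv).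
Qed.

Definition value t x : R := fine (bellman M Q (T - t) t x).
Definition onward_value t y : R := onward M (Q t) t (value t.+1) y.

Lemma bellmanE t : (t <= T)%N -> bellman M Q (T - t) t = EFin \o value t.
Proof.
move=> tT; have [|v vv vE] := @bellman_value_like (T - t) t; first by rewrite subnKC.
by apply/funext => x; rewrite /value vE.
Qed.

Lemma value_like_value t : (t <= T)%N -> value_like (value t).
Proof.
move=> tT; have [|v vv vE] := @bellman_value_like (T - t) t; first by rewrite subnKC.
by rewrite (_ : value t = v) //; apply/funext => x; rewrite /value vE.
Qed.

Lemma cost_to_go_value t y : (t < T)%N ->
  cost_to_go M Q (bellman M Q (T - t.+1) t.+1) t y = (onward_value t y)%:E.
Proof.
move=> tT; rewrite bellmanE //.
by rewrite (cost_to_goE (Q_supp tT) tT (value_like_value tT)).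
Qed.

Lemma value_levels : exists S : nat -> R, forall t, (t < T)%N ->
  [/\ 0 <= S t <= D, forall y, 0 <= y -> onward_value t (S t) <= onward_value t y &
      forall x, value t x = onward_value t (Num.max x (S t))].
Proof.
suff : forall t, exists s, (t < T)%N ->
    [/\ 0 <= s <= D, forall y, 0 <= y -> onward_value t s <= onward_value t y &
      forall x, value t x = onward_value t (Num.max x s)].
  by move=> /choice[S SP]; exists S.
move=> t; have [tT|] := boolP (t < T)%N; last by exists 0.
have vv := value_like_value tT.
have [s sD smin] := onward_minimizer (Q_supp tT) tT vv.
exists s => _; split => // x.
apply: EFin_inj; rewrite -(ereal_inf_next tT vv sD smin).
have := bellmanE (ltnW tT); rewrite -[X in bellman _ _ X]prednK ?subn_gt0 // -subnS.
move=> /(congr1 (fun f => f x)) /= <-; congr ereal_inf.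
apply/seteqP; split => z [y xy <-]; exists y => //.
  by rewrite cost_to_go_value.
by rewrite cost_to_go_value.
Qed.

Lemma value_le t x y : (t < T)%N -> Num.max x 0 <= y -> value t x <= onward_value t y.
Proof.
move=> tT xy; have [S SP] := value_levels; have [SD Smin ->] := SP t tT.
exact: (onward_order_up tT (value_like_value tT) SD Smin xy).
Qed.

Lemma dp_minimizerP t x y : (t < T)%N -> Num.max x 0 <= y ->
  dp_minimizer M Q t x y <-> onward_value t y = value t x.
Proof.
move=> tT xy; split=> [[_ ymin]|yE].
  apply/eqP; rewrite eq_le value_le // andbT.
  have [S SP] := value_levels; have [/andP[S0 _] _ ->] := SP t tT.
  have := ymin (Num.max x (S t)); rewrite /= !cost_to_go_value // lee_fin; apply.
  by rewrite ge_max !le_max lexx S0 orbT.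
by split=> // y' xy'; rewrite !cost_to_go_value // lee_fin yE value_le.
Qed.

Definition stage_cost t (x y u : R) : R := cost M t y u.
(** The excess of a decision over the Bellman minimum. The value 0 past the horizon makes it
    measurable for all [t], as [measurable_accum] requires. *)
Definition stage_gap t (x y u : R) : R :=
  if (t < T)%N then onward_value t y - value t x else 0.

Lemma measurable_stage_cost t :
  measurable_fun [set: MR * MR * MR] (fun w => stage_cost t w.1.1 w.1.2 w.2 : MR).
Proof.
have m2 : measurable_fun [set: MR * MR * MR] (fun w => w.1.2 : MR).
  exact: measurableT_comp measurable_snd measurable_fst.
have m3 : measurable_fun [set: MR * MR * MR] (fun w => w.2 : MR) by exact: measurable_snd.
rewrite /stage_cost /cost; apply: measurable_funD; apply: measurable_funM => //;
  by apply: measurable_maxr => //; exact: measurable_funB.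
Qed.

Lemma measurable_stage_gap t :
  measurable_fun [set: MR * MR * MR] (fun w => stage_gap t w.1.1 w.1.2 w.2 : MR).
Proof.
rewrite /stage_gap; have [tT|_] := boolP (t < T)%N; last exact: measurable_cst.
have [_ _ _ [L vL]] := value_like_value (ltnW tT).
have [L' gL] := onward_lip (Q_supp tT) tT (value_like_value tT).
apply: measurable_funB.
  apply: (measurableT_comp (lipschitz_measurable gL)).
  exact: measurableT_comp measurable_snd measurable_fst.
apply: (measurableT_comp (lipschitz_measurable vL)).
exact: measurableT_comp measurable_fst measurable_fst.
Qed.

Section policy.
Variable pi : @policy R.

Lemma accum_ge0 phi s k t (st : MR * t.-tuple (MR * MR * MR)) e :
  (forall r x y u, (t <= r < t + k)%N -> 0 <= x -> x <= y -> 0 <= phi r x y u) ->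
  0 <= st.1 :> R -> 0 <= accum (pi := pi) phi s k st e.
Proof.
elim: k t st e => //= k IH t st e H st0.
have oge := Defs.order_ge s st.2 st0.
rewrite addr_ge0 //.
  by apply: H => //; rewrite leqnn addnS ltnS leq_addr.
apply: IH; last by rewrite /= le_max lexx orbT.
move=> r x y u /andP[r1 r2]; apply: H.
by rewrite ltnW // -addSnnS.
Qed.

Lemma measurable_accum_demand phi s k t (st : MR * t.-tuple (MR * MR * MR)) :
  (forall t, measurable_fun [set: MR * MR * MR] (fun w => phi t w.1.1 w.1.2 w.2 : MR)) ->
  measurable_fun [set: k.-tuple MR] (fun d => (accum (pi := pi) phi s k st (nth 0 d))%:E).
Proof.
move=> mphi; apply/measurable_EFinP.
have mp : measurable_fun [set: k.-tuple MR] (fun d => (s, st, d)).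
  by apply/measurable_fun_pairP; split; [exact: measurable_cst|exact: measurable_id].
exact: (measurableT_comp (@measurable_accum R pi phi mphi k t) mp).
Qed.

Lemma stage_cost_ge0 r (x y u : R) : (r < T)%N -> 0 <= stage_cost r x y u.
Proof. exact: cost_ge0. Qed.

Lemma stage_gap_ge0 r (x y u : R) : 0 <= x -> x <= y -> 0 <= stage_gap r x y u.
Proof.
move=> x0 xy; rewrite /stage_gap; case: ifP => // rT.
by rewrite subr_ge0 value_le // max_l.
Qed.

Lemma integral_accum_cons phi s k t (st : MR * t.-tuple (MR * MR * MR))
    (Q' : nat -> probability MR R) :
  (forall t, measurable_fun [set: MR * MR * MR] (fun w => phi t w.1.1 w.1.2 w.2 : MR)) ->
  (forall r x y u, (t <= r < t + k.+1)%N -> 0 <= x -> x <= y -> 0 <= phi r x y u) ->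
  0 <= st.1 :> R ->
  let y : R := Defs.order (s, st.2, st.1) in
  (\int[product_law Q' k.+1]_d (accum phi s k.+1 st (nth 0 d))%:E =
   \int[Q' 0%N]_u ((phi t st.1 y u)%:E +
     \int[product_law (fun r => Q' r.+1) k]_d (accum (pi := pi) phi s k (step s st u) (nth 0 d))%:E))%E.
Proof.
move=> mphi phi0 st0 y.
rewrite ge0_integral_product_law_cons; first last.
- by move=> d; rewrite lee_fin accum_ge0.
- exact: measurable_accum_demand.
apply: eq_integral => u _.
transitivity (\int[product_law (fun r => Q' r.+1) k]_v ((phi t st.1 y u)%:E +
    (accum phi s k (step s st u) (nth 0 v))%:E))%E.
  by apply: eq_integral => v _; rewrite -EFinD.
rewrite ge0_integralD //.
- by rewrite integral_probability_cst.
- move=> v _; rewrite lee_fin phi0 //; first by rewrite leqnn addnS ltnS leq_addr.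
  exact: Defs.order_ge.
- move=> v _; rewrite lee_fin accum_ge0 //; last by rewrite /= le_max lexx orbT.
  by move=> r x z w /andP[r1 r2]; apply: phi0; rewrite ltnW // -addSnnS.
- exact: measurable_accum_demand.
Qed.

(* Costs are the value function plus the accumulated Bellman gaps, which are nonnegative
   and vanish exactly at dynamic-programming decisions. *)
Lemma performance s k t (st : MR * t.-tuple (MR * MR * MR)) (Q' : nat -> probability MR R) :
  (t + k = T)%N -> (forall r, Q' r = Q (t + r)%N) -> 0 <= st.1 :> R ->
  (\int[product_law Q' k]_d (accum (pi := pi) stage_cost s k st (nth 0 d))%:E =
   (value t st.1)%:E +
   \int[product_law Q' k]_d (accum (pi := pi) stage_gap s k st (nth 0 d))%:E)%E.
Proof.
elim: k t st Q' => [|k IH] t st Q' tk Q'E st0.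
  by rewrite /= !integral_probability_cst adde0 /value -tk addn0 subnn.
have tT : (t < T)%N by rewrite -tk addnS ltnS leq_addr.
have oge := Defs.order_ge s st.2 st0.
have cost0 r x y u : (t <= r < t + k.+1)%N -> 0 <= x -> x <= y -> 0 <= stage_cost r x y u.
  by move=> /andP[_]; rewrite tk => rT _ _; exact: stage_cost_ge0.
have gap0 r x y u : (t <= r < t + k.+1)%N -> 0 <= x -> x <= y -> 0 <= stage_gap r x y u.
  by move=> _; exact: stage_gap_ge0.
rewrite (integral_accum_cons s Q' measurable_stage_cost cost0 st0).
rewrite (integral_accum_cons s Q' measurable_stage_gap gap0 st0).
set y : R := Defs.order (s, st.2, st.1).
pose I u := (\int[product_law (fun r => Q' r.+1) k]_d
  (accum (pi := pi) stage_gap s k (step s st u) (nth 0 d))%:E)%E.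
have I0 u : (0 <= I u)%E.
  apply: integral_ge0 => d _; rewrite lee_fin accum_ge0 //; last by rewrite /= le_max lexx orbT.
  by move=> *; exact: stage_gap_ge0.
have Q0 : Q' 0%N = Q t by rewrite Q'E addn0.
have vv := value_like_value tT.
have [v0 _ _ _] := vv.
have gE u : stage_gap t st.1 y u = onward_value t y - value t st.1 by rewrite /stage_gap tT.
set c := onward_value t y - value t st.1 in gE.
have c0 : 0 <= c by rewrite subr_ge0 value_le // max_l.
have mI : measurable_fun [set: MR] I.
  pose f (w : MR * k.-tuple MR) := (accum (pi := pi) stage_gap s k (step s st w.1) (nth 0 w.2))%:E.
  have mf : measurable_fun [set: MR * k.-tuple MR] f.
    (* The continuation is the sum over k + 1 periods minus the first gap, which is the constant [c]
       whatever the demand; its joint measurability follows. *)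
    rewrite (_ : f = fun w => (accum (pi := pi) stage_gap s k.+1 st
        (nth 0 (prepend w)) - c)%:E); last first.
      by apply/funext => w; rewrite /f /= -(gE w.1) addrC addKr.
    apply/measurable_EFinP/measurable_funB; last exact: measurable_cst.
    have := @measurable_accum_demand stage_gap s k.+1 t st measurable_stage_gap.
    by move=> /measurable_EFinP m1; exact: (measurableT_comp m1 (@measurable_prepend R k)).
  apply: (@measurable_fun_fubini_tonelli_F _ _ _ _ _ _ f) => // w.
  by rewrite lee_fin accum_ge0 //=; [move=> *; exact: stage_gap_ge0|rewrite le_max lexx orbT].
transitivity ((onward_value t y)%:E + \int[Q' 0%N]_u I u)%E.
  transitivity (\int[Q' 0%N]_u ((cost M t y u + value t.+1 (Num.max (y - u) 0))%:E + I u))%E.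
    apply: eq_integral => u _; rewrite (IH t.+1); first last.
    - by rewrite /= le_max lexx orbT.
    - by move=> r; rewrite Q'E addnS addSn.
    - by rewrite addSnnS.
    by rewrite addeA -EFinD.
  have bi := bounded_integrand tT vv y; have [mi _] := bi.
  have g0 u : 0 <= cost M t y u + value t.+1 (Num.max (y - u) 0) by rewrite addr_ge0 ?cost_ge0.
  rewrite ge0_integralD //.
  - by rewrite Q0 (integral_mean (Q_supp tT) bi).
  - by move=> u _; rewrite lee_fin.
  - exact/measurable_EFinP.
have -> : (\int[Q' 0%N]_u ((stage_gap t st.1 y u)%:E + I u) = \int[Q' 0%N]_u (c%:E + I u))%E.
  by apply: eq_integral => u _; rewrite gE.
have -> : (\int[Q' 0%N]_u (c%:E + I u) = c%:E + \int[Q' 0%N]_u I u)%E.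
  by rewrite ge0_integralD // integral_probability_cst.
move: (\int[Q' 0%N]_u I u)%E => J; rewrite addeA -EFinD /c.
by congr (_ + _)%E; congr (_%:E); ring.
Qed.

End policy.
End performance.

Section values_of_policies.
Context {R : realType}.
Local Notation MR := (measurableTypeR R).
Variables (M : inventory R) (Q : nat -> probability MR R).
Local Notation T := (horizon M).
Local Notation D := (dmax M).
Implicit Types S d : nat -> R.

Lemma loss_accum (pi : @policy R) (s : seed pi) x1 (d : T.-tuple MR) :
  loss (M := M) s x1 d = accum (stage_cost M) s T (x1 : MR, [tuple]) (nth 0 d).
Proof.
rewrite -(accum_run (stage_cost M) s x1 (nth 0 d) T 0) add0n big_mkord.
by apply: eq_bigr => t _; case: (run s x1 (nth 0 d) t).
Qed.

Lemma run_base_stock S x1 d t : (run (pi := base_stock S) tt x1 d t).1 = stock S d x1 t.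
Proof.
elim: t => //= t <-.
by case: (run (pi := base_stock S) tt x1 d t).
Qed.

Lemma loss_base_stock S x1 (d : T.-tuple MR) :
  loss (M := M) (pi := base_stock S) tt x1 d = path_loss (T := T) (cost M) x1 S (nth 0 d).
Proof.
apply: eq_bigr => t _; rewrite /post -run_base_stock.
by case: (run (pi := base_stock S) tt x1 (nth 0 d) t).
Qed.

Lemma measurable_loss (pi : @policy R) x1 :
  measurable_fun [set: seed pi * T.-tuple MR] (fun w => (loss (M := M) w.1 x1 w.2)%:E).
Proof.
have mp : measurable_fun [set: seed pi * T.-tuple MR]
    (fun w => (w.1, (x1 : MR, [tuple] : 0.-tuple (MR * MR * MR)), w.2)).
  apply/measurable_fun_pairP; split; last exact: measurable_snd.
  by apply/measurable_fun_pairP; split; [exact: measurable_fst|exact: measurable_cst].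
apply: (eq_measurable_fun (fun w : seed pi * T.-tuple MR =>
    (accum (stage_cost M) w.1 T (x1 : MR, [tuple]) (nth 0 w.2))%:E)).
  by move=> w _; rewrite loss_accum.
apply/measurable_EFinP.
exact: (measurableT_comp (@measurable_accum R pi _ (measurable_stage_cost M) T 0) mp).
Qed.

Lemma loss_ge0 (pi : @policy R) (s : seed pi) x1 (d : T.-tuple MR) : 0 <= loss (M := M) s x1 d.
Proof.
apply: sumr_ge0 => t _; case: (run s x1 (nth 0 d) t) => x h; exact: cost_ge0.
Qed.

Lemma policy_value_fubini (pi : @policy R) x1 :
  policy_value M Q pi x1 =
  (\int[seed_law pi]_s \int[product_law Q T]_d (loss (M := M) s x1 d)%:E)%E.
Proof.
rewrite /policy_value fubini_tonelli1 //; first exact: measurable_loss.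
by move=> w; rewrite lee_fin loss_ge0.
Qed.

Lemma policy_value_base_stock S x1 :
  policy_value M Q (base_stock S) x1 = product_risk M Q x1 S.
Proof.
rewrite policy_value_fubini /product_risk.
set F := fun s : unit => (\int[product_law Q T]_d (loss (M := M) (pi := base_stock S) s x1 d)%:E)%E.
rewrite -[RHS]/(F tt) (eq_integral (cst (F tt))) //; last by move=> -[].
rewrite integral_dirac //; first by rewrite diracT mul1e.
Qed.

Hypothesis Q_supp : supported M Q.

Lemma integral_loss (pi : @policy R) (s : seed pi) x1 : 0 <= x1 ->
  (\int[product_law Q T]_d (loss (M := M) s x1 d)%:E = (value M Q 0 x1)%:E +
   \int[product_law Q T]_d (accum (stage_gap M Q) s T (x1 : MR, [tuple]) (nth 0 d))%:E)%E.
Proof.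
move=> x10; under eq_integral do rewrite loss_accum.
exact: (performance Q_supp (pi := pi) s (t := 0) (st := (x1 : MR, [tuple]))).
Qed.

(** The gaps are nonnegative for every seed and history, so no randomized history-dependent policy
    can beat the value function. *)
Lemma opt_value_ge x1 : 0 <= x1 -> ((value M Q 0 x1)%:E <= opt_value M Q x1)%E.
Proof.
move=> x10; apply: le_ereal_inf_tmp => _ [pi ->].
rewrite policy_value_fubini -[leLHS](integral_probability_cst (seed_law pi)).
have [v0 _ _ _] := value_like_value Q_supp (leq0n T).
apply: ge0_le_integral => //.
- by move=> s _; rewrite lee_fin.
- have h := @measurable_fun_fubini_tonelli_F _ _ _ _ R (product_law Q T) _ (measurable_loss (pi := pi) x1).
  by apply: h => w; rewrite lee_fin loss_ge0.
- move=> s _; rewrite integral_loss // leeDl //; apply: integral_ge0 => d _.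
  by rewrite lee_fin accum_ge0 // => *; exact: stage_gap_ge0.
Qed.

Definition total_gap S x1 d : R :=
  \sum_(t < T) (onward_value M Q t (post S d x1 t) - value M Q t (stock S d x1 t)).

Lemma total_gapE S x1 (d : T.-tuple MR) :
  accum (stage_gap M Q) (pi := base_stock S) tt T (x1 : MR, [tuple]) (nth 0 d) =
  total_gap S x1 (nth 0 d).
Proof.
rewrite -(accum_run (stage_gap M Q) (pi := base_stock S) tt x1 (nth 0 d) T 0) add0n big_mkord.
apply: eq_bigr => t _; rewrite /stage_gap ltn_ord /post -run_base_stock.
by case: (run (pi := base_stock S) tt x1 (nth 0 d) t).
Qed.

Lemma product_riskE S x1 : 0 <= x1 ->
  (product_risk M Q x1 S = (value M Q 0 x1)%:E +
   \int[product_law Q T]_d (total_gap S x1 (nth 0 d))%:E)%E.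
Proof.
move=> x10; rewrite /product_risk integral_loss //; congr (_ + _)%E.
by apply: eq_integral => d _; rewrite total_gapE.
Qed.

Lemma stock_ge0 S x1 d t : 0 <= x1 -> 0 <= stock S d x1 t.
Proof. by case: t => //= t _; rewrite le_max lexx orbT. Qed.

Lemma gap_ge0 S x1 d t : (t < T)%N -> 0 <= x1 ->
  0 <= onward_value M Q t (post S d x1 t) - value M Q t (stock S d x1 t).
Proof.
move=> tT x10; have := @stage_gap_ge0 _ _ _ Q_supp t (stock S d x1 t) (post S d x1 t) 0.
rewrite /stage_gap tT; apply; first exact: stock_ge0.
by rewrite le_max lexx.
Qed.

Lemma total_gap_ge0 S x1 d : 0 <= x1 -> 0 <= total_gap S x1 d.
Proof. by move=> x10; apply: sumr_ge0 => t _; exact: gap_ge0. Qed.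

Lemma product_risk_ge S x1 : 0 <= x1 -> ((value M Q 0 x1)%:E <= product_risk M Q x1 S)%E.
Proof.
move=> x10; rewrite product_riskE // leeDl // integral_ge0 // => d _.
by rewrite lee_fin total_gap_ge0.
Qed.

(** Bellman minimisers, the first one raised to x1 for feasibility, which does not change the order
    placed from x1. Beyond a_t the cost is strictly increasing, so no minimiser lies there. The
    levels are chosen before [a]: one and the same vector must serve all the caps that the design
    may produce. *)
Lemma optimal_levels x1 : 0 <= x1 <= D -> exists S,
  [/\ feasible_levels M x1 S, product_risk M Q x1 S = (value M Q 0 x1)%:E &
      forall a, x1 <= a 0%N ->
        (forall t, (t < T)%N -> 0 <= a t /\
           ((critical_ratio M t)%:E < Q t [set` `]-oo, (a t)]])%E) ->
        forall t, (t < T)%N -> S t <= a t].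
Proof.
move=> /andP[x10 x1D]; have [S0 SP] := value_levels Q_supp.
pose S t := if t is 0 then Num.max x1 (S0 0%N) else S0 t.
have T0 := horizon_gt0 M.
exists S; split.
- split; last by rewrite /= le_max lexx.
  move=> [|t] tT; have [/andP[h1 h2] _ _] := SP _ tT; last by rewrite /= h1.
  by rewrite /= le_max ge_max x10 x1D h2.
- rewrite product_riskE // (_ : (fun _ => _) = cst 0%E) ?integral0 ?adde0 //.
  apply/funext => d; rewrite /total_gap big1 // => -[t tT] _ /=.
  have [_ _ vE] := SP t tT; rewrite vE /post.
  case: t {tT vE} => [|t] /=; last by rewrite subrr.
  by rewrite maxA maxxx subrr.
- move=> a x1a aP t tT.
  have S0a r : (r < T)%N -> S0 r <= a r.
    move=> rT; have [_ Smin _] := SP r rT; have [a0 qa] := aP r rT.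
    rewrite leNgt; apply/negP => aS.
    have := onward_lt (Q_supp rT) rT (value_like_value Q_supp rT) qa aS.
    by rewrite ltNge; move: (Smin _ a0); rewrite /onward_value => ->.
  by case: t tT => [|t] tT /=; rewrite ?ge_max ?x1a S0a.
Qed.

(** The Bellman value bounds every product risk from below and some feasible levels attain it.
    [product_dpP] gives the same characterisation of empirical dynamic programming, whence the
    equivalence of the two. *)
Lemma product_ermP x1 S : 0 <= x1 <= D -> product_erm M Q x1 S <->
  feasible_levels M x1 S /\ product_risk M Q x1 S = (value M Q 0 x1)%:E.
Proof.
move=> x1D; have /andP[x10 _] := x1D; have [S' [S'f S'v _]] := optimal_levels x1D.
split=> [[Sf Smin]|[Sf Sv]]; split=> //.
  apply/eqP; rewrite eq_le product_risk_ge // andbT -S'v; exact: Smin.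
by move=> S'' _; rewrite Sv; exact: product_risk_ge.
Qed.

(** The mean total gap is the difference between risk and value; it vanishes exactly when almost
    every trajectory has all its nonnegative gaps equal to 0. *)
Lemma product_riskP x1 S : 0 <= x1 ->
  product_risk M Q x1 S = (value M Q 0 x1)%:E <->
  {ae product_law Q T, forall d : T.-tuple MR, forall t, (t < T)%N ->
    onward_value M Q t (post S (nth 0 d) x1 t) = value M Q t (stock S (nth 0 d) x1 t)}.
Proof.
move=> x10; rewrite product_riskE //.
have mg : measurable_fun [set: T.-tuple MR] (fun d : T.-tuple MR => (total_gap S x1 (nth 0 d))%:E).
  apply: (eq_measurable_fun (fun d : T.-tuple MR => (accum (stage_gap M Q)
      (pi := base_stock S) tt T (x1 : MR, [tuple]) (nth 0 d))%:E)).
    by move=> d _; rewrite total_gapE.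
  by apply: measurable_accum_demand => t; exact: measurable_stage_gap.
have g0 d : (0 <= (total_gap S x1 d)%:E)%E by rewrite lee_fin total_gap_ge0.
have zero d : total_gap S x1 d = 0 <-> forall t, (t < T)%N ->
    onward_value M Q t (post S d x1 t) = value M Q t (stock S d x1 t).
  split=> [/eqP|h]; last first.
    by rewrite /total_gap big1 // => t _; rewrite h // subrr.
  rewrite psumr_eq0; last by move=> t _; exact: gap_ge0.
  move=> /allP h t tT; apply/eqP; rewrite -subr_eq0.
  exact: (h (Ordinal tT) (mem_index_enum _)).
have iff0 : (\int[product_law Q T]_d (total_gap S x1 (nth 0 d))%:E = 0)%E <->
    ae_eq (product_law Q T) setT (fun d : T.-tuple MR => (total_gap S x1 (nth 0 d))%:E) (cst 0%E).
  have := ae_eq_integral_abs (product_law Q T) measurableT mg.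
  under eq_integral do rewrite gee0_abs //.
  by [].
split.
  move=> h; have /iff0 : (\int[product_law Q T]_d (total_gap S x1 (nth 0 d))%:E = 0)%E.
    by move: h; rewrite addeC => /(congr1 (fun z => z - (value M Q 0 x1)%:E)%E); rewrite addeK // subee.
  apply: filterS => d hd; apply: (zero _).1; apply: EFin_inj; exact: hd.
move=> h; rewrite (iff0.2 _) ?adde0 //.
by move: h; apply: filterS => d hd _; rewrite /= ((zero _).2 hd).
Qed.

Lemma product_dpP x1 S : 0 <= x1 -> product_dp M Q x1 S <->
  feasible_levels M x1 S /\ product_risk M Q x1 S = (value M Q 0 x1)%:E.
Proof.
move=> x10.
have dpE (d : T.-tuple MR) t : (t < T)%N ->
    dp_minimizer M Q t (run (pi := base_stock S) tt x1 (nth 0 d) t).1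
      (Num.max (run (pi := base_stock S) tt x1 (nth 0 d) t).1 (S t)) <->
    onward_value M Q t (post S (nth 0 d) x1 t) = value M Q t (stock S (nth 0 d) x1 t).
  move=> tT; rewrite run_base_stock; apply: dp_minimizerP => //.
  by rewrite max_l ?stock_ge0 // le_max lexx.
split=> -[Sf h]; split=> //.
  apply/product_riskP => //; move: h; apply: filterS => d h t tT.
  exact/(dpE d t tT).1/h.
move/product_riskP : h => /(_ x10); apply: filterS => d h t tT.
exact/(dpE d t tT).2/h.
Qed.

End values_of_policies.

(** * Empirical laws and discretisation *)

Section finite_product_law.
Context {R : realType}.
Local Notation MR := (measurableTypeR R).

Lemma measurable_nth n t : measurable_fun [set: n.-tuple MR] (fun d : n.-tuple MR => nth 0 d t : MR).
Proof.
have [tn|nt] := ltnP t n.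
  apply: (eq_measurable_fun (fun d : n.-tuple MR => tnth d (Ordinal tn))).
    by move=> d _; rewrite (tnth_nth 0).
  exact: measurable_tnth.
apply: (eq_measurable_fun (cst (0 : MR))); last exact: measurable_cst.
by move=> d _; rewrite nth_default // size_tuple.
Qed.

Lemma product_law_ae n (Q : nat -> probability MR R) (A : nat -> set MR) :
  (forall t, (t < n)%N -> measurable (A t)) -> (forall t, (t < n)%N -> Q t (A t) = 1%E) ->
  {ae product_law Q n, forall d : n.-tuple MR, forall t, (t < n)%N -> A t (nth 0 d t)}.
Proof.
move=> mA QA.
pose E n (A : nat -> set MR) := [set d : n.-tuple MR | forall t, (t < n)%N -> A t (nth 0 d t)].
have mE m (B : nat -> set MR) : (forall t, (t < m)%N -> measurable (B t)) -> measurable (E m B).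
  move=> mB; rewrite (_ : E m B = \bigcap_(t in [set t | (t < m)%N])
      ((fun d : m.-tuple MR => nth 0 d t : MR) @^-1` B t)) //.
  apply: bigcap_measurableType => // t /= tm; rewrite -[X in measurable X]setTI.
  by apply: (@measurable_nth m t); [exact: measurableT|exact: mB].
suff E1 : product_law Q n (E n A) = 1%E.
  exists (~` E n A); split => //; first by apply: measurableC; exact: mE.
  have := probability_setC (product_law Q n) (mE n A mA).
  by rewrite E1 subee.
elim: n Q A mA QA => [|n IH] Q A mA QA.
  have -> : E 0%N A = setT by apply/seteqP; split.
  exact: probability_setT.
have -> : product_law Q n.+1 (E n.+1 A) =
    (Q 0%N \x product_law (fun t => Q t.+1) n)%E (A 0%N `*` E n (fun t => A t.+1)).
  transitivity ((Q 0%N \x product_law (fun t => Q t.+1) n)%E (@prepend R n @^-1` E n.+1 A)).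
    by [].
  apply: (congr1 (Q 0%N \x product_law (fun t => Q t.+1) n)%E).
  apply/seteqP; split => -[u v] /=.
    by move=> h; split; [exact: (h 0%N)|move=> t tn; exact: (h t.+1)].
  by move=> [h0 h] [|t] tn //=; exact: h.
rewrite product_measure1E; [|exact: mA|by apply: mE => t tn; exact: mA].
transitivity (1 * 1 : \bar R)%E; last by rewrite mule1.
by congr (_ * _)%E; [exact: QA|apply: IH => t tn; [exact: mA|exact: QA]].
Qed.

Definition fcons n (V : finType) (v : V) (y : {ffun 'I_n -> V}) : {ffun 'I_n.+1 -> V} :=
  [ffun i => if unlift ord0 i is Some j then y j else v].

Lemma big_fcons (S : Type) (idx : S) (op : Monoid.com_law idx) n (V : finType)
    (F : {ffun 'I_n.+1 -> V} -> S) :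
  \big[op/idx]_x F x = \big[op/idx]_y \big[op/idx]_v F (fcons v y).
Proof.
rewrite exchange_big pair_bigA /=.
rewrite (reindex (fun p : V * {ffun 'I_n -> V} => fcons p.1 p.2)) //=.
exists (fun x : {ffun 'I_n.+1 -> V} => (x ord0, [ffun j => x (lift ord0 j)])) => [[v y]|x] _ /=.
  by congr (_, _); [rewrite ffunE unlift_none|apply/ffunP => j; rewrite !ffunE liftK].
by apply/ffunP => i; rewrite ffunE; case: unliftP => [j ->|->] //; rewrite ffunE.
Qed.

Definition outcome n (V : finType) (val : nat -> V -> R) (x : {ffun 'I_n -> V}) : n.-tuple MR :=
  [tuple (val i (x i) : MR) | i < n].

Lemma outcome_fcons n (V : finType) (val : nat -> V -> R) v (y : {ffun 'I_n -> V}) :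
  outcome val (fcons v y) = [tuple of (val 0%N v : MR) :: outcome (fun t => val t.+1) y].
Proof.
apply: eq_from_tnth => i; rewrite tnth_mktuple ffunE.
case: (unliftP ord0 i) => [j ->|->] //=.
by rewrite tnthS tnth_mktuple.
Qed.

Lemma measurable_map_tuple n (r : MR -> MR) : measurable_fun [set: MR] r ->
  measurable_fun [set: n.-tuple MR] (map_tuple r).
Proof.
move=> mr; apply/measurable_fun_tnthP => i.
rewrite (_ : _ \o _ = r \o (fun d : n.-tuple MR => tnth d i)); last first.
  by apply/funext => d /=; rewrite tnth_map.
exact: (measurableT_comp mr (measurable_tnth i)).
Qed.

(** The map [r] lets one statement cover two cases: empirical marginals, with [r] the identity and
    [val] listing the sample with multiplicity, and arbitrary laws rounded to a grid. *)
Lemma integral_product_law_finite n (Q : nat -> probability MR R) (V : finType)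
    (r : MR -> MR) (q val : nat -> V -> R) (f : n.-tuple MR -> \bar R) :
  measurable_fun [set: MR] r -> (forall t v, 0 <= q t v) ->
  (forall t, (t < n)%N -> forall g : MR -> \bar R, measurable_fun [set: MR] g ->
     (forall x, 0 <= g x)%E ->
     (\int[Q t]_u g (r u) = \sum_v (q t v)%:E * g (val t v))%E) ->
  measurable_fun [set: n.-tuple MR] f -> (forall d, 0 <= f d)%E ->
  (\int[product_law Q n]_d f (map_tuple r d) =
   \sum_(x : {ffun 'I_n -> V}) (\prod_(t < n) q t (x t))%:E * f (outcome val x))%E.
Proof.
move=> mr; elim: n Q q val f => [|n IH] Q q val f q0 Qq mf f0.
  transitivity (f [tuple]).
    rewrite (eq_integral (cst (f [tuple]))); last by move=> d _; congr f; exact: tuple0.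
    by rewrite integral_cst // -[RHS]mule1; congr (_ * _)%E; exact: probability_setT.
  rewrite (big_pred1 (ffun0 (card_ord 0) : {ffun 'I_0 -> V})).
    by rewrite big_ord0 mul1e; congr f; apply/esym; exact: tuple0.
  by move=> x; apply/esym/eqP/ffunP => -[].
rewrite ge0_integral_product_law_cons //; last first.
  exact: (measurableT_comp mf (@measurable_map_tuple n.+1 r mr)).
have msec (v : MR) : measurable_fun [set: n.-tuple MR]
    (fun d : n.-tuple MR => f [tuple of v :: d]).
  have mc : measurable_fun [set: n.-tuple MR] (fun d : n.-tuple MR => [tuple of v :: d]).
    by apply: measurable_cons; [exact: measurable_cst|exact: measurable_id].
  exact: (measurableT_comp mf mc).
have msec2 (d : n.-tuple MR) : measurable_fun [set: MR] (fun v : MR => f [tuple of v :: d]).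
  have mc : measurable_fun [set: MR] (fun v : MR => [tuple of v :: d]).
    by apply: measurable_cons; [exact: measurable_id|exact: measurable_cst].
  exact: (measurableT_comp mf mc).
transitivity (\int[Q 0%N]_u \sum_(y : {ffun 'I_n -> V}) (\prod_(t < n) q t.+1 (y t))%:E *
    f [tuple of r u :: outcome (fun t => val t.+1) y])%E.
  apply: eq_integral => u _.
  rewrite -(IH (fun t => Q t.+1) (fun t => q t.+1) (fun t => val t.+1)
    (fun d => f [tuple of r u :: d])) //; last by move=> t tn; exact: Qq.
  by apply: eq_integral => v _; congr f; apply: val_inj.
rewrite ge0_integral_sum //; first last.
- by move=> y u _; rewrite mule_ge0 // lee_fin prodr_ge0.
- move=> y; apply: measurable_funeM.
  exact: (measurableT_comp (msec2 _) mr).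
rewrite big_fcons; apply: eq_bigr => y _.
rewrite ge0_integralZl //; first last.
- by rewrite lee_fin prodr_ge0.
- exact: (measurableT_comp (msec2 _) mr).
rewrite (Qq 0%N _ (fun v => f [tuple of v :: outcome (fun t => val t.+1) y])) //.
rewrite ge0_sume_distrr; last by move=> v _; rewrite mule_ge0 // lee_fin.
apply: eq_bigr => v _; rewrite muleA -EFinM outcome_fcons; congr (_%:E * _)%E.
rewrite big_ord_recl mulrC ffunE unlift_none; congr (_ * _).
by apply: eq_bigr => t _; rewrite ffunE liftK.
Qed.

End finite_product_law.

Section empirical_risk.
Context {R : realType}.
Local Notation MR := (measurableTypeR R).

Lemma empiricalE (s : seq R) (A : set MR) : (0 < size s)%N ->
  empirical s A = ((\sum_(i < size s) \d_(nth 0%R s i : MR) A) * ((size s)%:R^-1)%:E)%E.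
Proof.
move=> s0; have sT : (\sum_(i < size s) \d_(nth 0%R s i : MR) [set: MR])%E = ((size s)%:R)%:E :> \bar R.
  under eq_bigr do rewrite diracT.
  by rewrite sumEFin sumr_const card_ord.
rewrite /empirical /= /mnormalize /= /msum /= sT ifF //.
by rewrite orbF; apply/negbTE; rewrite eqe pnatr_eq0 -lt0n.
Qed.

Lemma empirical_supp (s : seq R) (A : set MR) : measurable A -> (0 < size s)%N ->
  (forall x, x \in s -> A x) -> empirical s A = 1%E.
Proof.
move=> mA s0 sA; rewrite empiricalE //.
have -> : (\sum_(i < size s) \d_(nth 0%R s i : MR) A)%E = (\sum_(i < size s) 1)%E :> \bar R.
  by apply: eq_bigr => i _; rewrite diracE mem_set //; apply: sA; exact: mem_nth.
by rewrite sumEFin sumr_const card_ord -EFinM mulfV // pnatr_eq0 -lt0n.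
Qed.

Lemma integral_empirical (s : seq R) (f : MR -> \bar R) : (0 < size s)%N ->
  measurable_fun [set: MR] f -> (forall x, 0 <= f x)%E ->
  (\int[empirical s]_x f x = \sum_(i < size s) ((size s)%:R^-1)%:E * f (nth 0%R s i))%E.
Proof.
move=> s0 mf f0.
have k0 : 0 <= (size s)%:R^-1 :> R by rewrite invr_ge0.
pose k : {nonneg R} := NngNum k0.
rewrite (@eq_measure_integral _ _ _ _
  (mscale k (msum (fun i => \d_(nth 0%R s i : MR)) (size s)))); last first.
  by move=> A mA _; rewrite -[LHS]/(empirical s A) empiricalE // muleC.
rewrite ge0_integral_mscale // ge0_integral_measure_sum // ge0_sume_distrr; last first.
  by move=> i _; exact: integral_ge0.
by apply: eq_bigr => i _; rewrite integral_dirac // diracT mul1e.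
Qed.

End empirical_risk.

Section grid.
Context {R : realType}.
Local Notation MR := (measurableTypeR R).
Variables (m : nat) (eta : R).
Hypothesis eta_gt0 : 0 < eta.

(** The integer part of u / eta clipped to [0, m], written as a count of thresholds so that rounding
    is a sum of indicators. *)
Definition gridix (u : R) : 'I_m.+1 := inord (\sum_(i < m) (i.+1%:R * eta <= u)%R).
Definition gridval (k : 'I_m.+1) : R := k%:R * eta.
Definition roundg (u : R) : R := gridval (gridix u).

Let ix_le N u : (\sum_(i < N) (i.+1%:R * eta <= u)%R <= N)%N.
Proof.
rewrite -[X in (_ <= X)%N](card_ord N) -sum1_card; apply: leq_sum => i _.
by case: (_ <= u).
Qed.

Lemma roundg_near u : 0 <= u <= m%:R * eta -> `|u - roundg u| <= eta.
Proof.
rewrite /roundg /gridval inordK ?ltnS ?ix_le // => /andP[u0 um].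
pose c N : R := (\sum_(i < N) (i.+1%:R * eta <= u)%R)%N%:R * eta.
suff : forall N, (u <= N%:R * eta -> c N <= u <= c N + eta) /\ (N%:R * eta < u -> c N = N%:R * eta).
  by move=> /(_ m)[/(_ um) + _]; rewrite -/(c m) ler_norml => /andP[]; lra.
have e0 := eta_gt0; elim=> [|N [IH1 IH2]].
  by rewrite /c big_ord0 mul0r; split=> // h; rewrite u0 /=; lra.
have cS : c N.+1 = c N + (if N.+1%:R * eta <= u then eta else 0).
  rewrite /c big_ord_recr /= natrD mulrDl; congr (_ + _).
  by case: ifP; rewrite ?mul1r ?mul0r.
rewrite cS -natr1 mulrDl mul1r; have [h1|h1] := leP u (N%:R * eta).
  have /andP[a1 a2] := IH1 h1; rewrite ifF; last by apply/negbTE; rewrite -ltNge; lra.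
  by split=> [_|h]; [apply/andP; split; lra|exfalso; lra].
rewrite IH2 //; case: ifP => h2.
  by split=> [h3|//]; apply/andP; split; lra.
move/negbT: h2; rewrite -ltNge => h2.
by split=> [_|h]; [apply/andP; split; lra|exfalso; lra].
Qed.

Lemma gridval_inj : injective gridval.
Proof.
move=> i j /(mulIf (lt0r_neq0 eta_gt0)) /eqP; rewrite eqr_nat => /eqP ij.
exact: val_inj.
Qed.

Lemma gridval_range k : 0 <= gridval k <= m%:R * eta.
Proof.
by rewrite mulr_ge0 ?(ltW eta_gt0) //= ler_wpM2r ?(ltW eta_gt0) // ler_nat -ltnS.
Qed.

Lemma measurable_roundg : measurable_fun [set: MR] (roundg : MR -> MR).
Proof.
apply: (eq_measurable_fun (fun u : MR =>
    (\sum_(i < m) (\1_[set` `[(i.+1%:R * eta), +oo[] : MR -> MR) u) * eta)).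
  move=> u _; rewrite /roundg /gridval inordK ?ltnS ?ix_le // natr_sum; congr (_ * _).
  by apply: eq_bigr => i _; rewrite indicE mem_setE in_itv /= andbT.
apply: measurable_funM; last exact: measurable_cst.
by apply: measurable_sum => i; exact: measurable_indic.
Qed.

Definition cell_of (k : 'I_m.+1) : set MR := [set u : MR | gridix u = k].

Lemma measurable_cell k : measurable (cell_of k).
Proof.
rewrite (_ : cell_of k = setT `&` (roundg : MR -> MR) @^-1` [set gridval k]).
  exact: (measurable_roundg measurableT).
rewrite setTI; apply/seteqP; split => u; rewrite /cell_of /roundg /=; first by move=> ->.
exact: gridval_inj.
Qed.

Lemma integral_roundg (mu : probability MR R) (g : MR -> \bar R) :
  measurable_fun [set: MR] g -> (forall x, 0 <= g x)%E ->
  (\int[mu]_u g (roundg u) =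
   \sum_k (fine (mu (cell_of k)))%:E * g (gridval k))%E.
Proof.
move=> mg g0.
transitivity (\int[mu]_u (\sum_k g (gridval k) * (\1_(cell_of k) u)%:E))%E.
  apply: eq_integral => u _; rewrite (bigD1 (gridix u)) //= big1 ?adde0.
    by rewrite indicE mem_set // mule1.
  move=> k kn; rewrite indicE memNset ?mule0 // => /= kE.
  by rewrite kE eqxx in kn.
have mi k : measurable_fun [set: MR] (fun u => (\1_(cell_of k) u)%:E : \bar R).
  by apply/measurable_EFinP/measurable_indic; exact: measurable_cell.
rewrite ge0_integral_sum //; first last.
- by move=> k u _; rewrite mule_ge0 // lee_fin indicE.
- by move=> k; apply: measurable_funeM.
apply: eq_bigr => k _; rewrite ge0_integralZl //.
rewrite integral_indic ?setIT //; last exact: measurable_cell.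
rewrite muleC fineK //; apply: fin_num_measure; exact: measurable_cell.
Qed.

Lemma sum_cell (mu : probability MR R) : \sum_k fine (mu (cell_of k)) = 1.
Proof.
have h := integral_roundg mu (g := cst 1%E) (measurable_cst _) (fun=> lee01).
have E : (\sum_k (fine (mu (cell_of k)))%:E * cst 1 (gridval k) = 1 :> \bar R)%E.
  by rewrite -h; exact: integral_probability_cst.
apply: EFin_inj; rewrite -sumEFin -[RHS]E.
by apply: eq_bigr => k _; rewrite mule1.
Qed.

End grid.

(** * Stability of the loss under rounding and under capping *)

Section loss_regularity.
Context {R : realType}.
Variable M : inventory R.
Local Notation T := (horizon M).
Local Notation C := (cost_bound M).
Local Notation ploss := (path_loss (T := T) (cost M)).
Implicit Types S d : nat -> R.

Lemma max_lip (x y u v : R) : `|Num.max x u - Num.max y v| <= Num.max `|x - y| `|u - v|.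
Proof.
have key (a b c e : R) : Num.max a c - Num.max b e <= Num.max `|a - b| `|c - e|.
  rewrite lerBlDl ge_max; apply/andP; split.
    have : a - b <= Num.max `|a - b| `|c - e| by rewrite le_max ler_norm.
    have : b <= Num.max b e by rewrite le_max lexx.
    by lra.
  have : c - e <= Num.max `|a - b| `|c - e| by rewrite le_max ler_norm orbT.
  have : e <= Num.max b e by rewrite le_max lexx orbT.
  by lra.
rewrite ler_norml; apply/andP; split; last exact: key.
by have := key y x v u; rewrite (distrC y) (distrC v); lra.
Qed.

Lemma post_lip S S' d d' x1 eta t : 0 <= eta -> (t < T)%N ->
  (forall r, (r < T)%N -> `|S r - S' r| <= eta) ->
  (forall r, (r < T)%N -> `|d r - d' r| <= eta) ->
  `|post S d x1 t - post S' d' x1 t| <= 2 * T%:R * eta.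
Proof.
move=> eta0 tT hS hd.
have step r (a : R) : (r < T)%N -> `|stock S d x1 r - stock S' d' x1 r| <= a ->
    `|post S d x1 r - post S' d' x1 r| <= a + eta.
  move=> rT ha; have a0 : 0 <= a by exact: le_trans ha.
  apply: (le_trans (max_lip _ _ _ _)); rewrite ge_max; have := hS r rT.
  by move=> h; apply/andP; split; lra.
have h r : (r <= t)%N -> `|stock S d x1 r - stock S' d' x1 r| <= 2 * r%:R * eta.
  elim: r => [|r IH] rt; first by rewrite /= subrr normr0 mulr0 mul0r.
  have rT : (r < T)%N by rewrite (ltn_trans rt).
  have h1 := step r _ rT (IH (ltnW rt)); have h4 := hd r rT.
  rewrite -[stock S d x1 r.+1]/(Num.max (post S d x1 r - d r) 0).
  rewrite -[stock S' d' x1 r.+1]/(Num.max (post S' d' x1 r - d' r) 0).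
  apply: (le_trans (max_lip _ _ _ _)); rewrite subrr normr0 (max_l (normr_ge0 _)).
  rewrite (_ : _ - _ = (post S d x1 r - post S' d' x1 r) - (d r - d' r)); last by ring.
  by apply: (le_trans (ler_normB _ _)); rewrite -natr1; lra.
apply: (le_trans (step t _ tT (h t (leqnn t)))).
have : t.+1%:R * eta <= T%:R * eta by rewrite ler_wpM2r // ler_nat.
by rewrite -natr1; lra.
Qed.

(** Each earlier period displaces the path by at most 2 eta, so the post-order level moves by at
    most 2 T eta. The demand inside the cost adds eta <= T eta, and there are T periods. *)
Lemma path_loss_lip S S' d d' x1 eta : 0 <= eta ->
  (forall r, (r < T)%N -> `|S r - S' r| <= eta) ->
  (forall r, (r < T)%N -> `|d r - d' r| <= eta) ->
  `|ploss x1 S d - ploss x1 S' d'| <= 3 * C * T%:R ^+ 2 * eta.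
Proof.
move=> eta0 hS hd; rewrite /path_loss -sumrB.
have C0 := cost_bound_gt0 M.
apply: (le_trans (ler_norm_sum _ _ _)).
apply: (@le_trans _ _ (\sum_(t < T) C * (3 * T%:R * eta))); last first.
  by rewrite sumr_const card_ord -[_ *+ _]mulr_natl; apply: eq_ler; ring.
apply: ler_sum => t _; have tT := ltn_ord t.
rewrite (_ : _ - _ = (cost M t (post S d x1 t) (d t) - cost M t (post S' d' x1 t) (d t)) +
  (cost M t (post S' d' x1 t) (d t) - cost M t (post S' d' x1 t) (d' t))); last by ring.
apply: (le_trans (ler_normD _ _)).
have h1 := cost_lip (post S d x1 t) (post S' d' x1 t) (d t) tT.
have h2 := cost_lip_demand (post S' d' x1 t) (d t) (d' t) tT.
apply: (le_trans (lerD h1 h2)); rewrite -mulrDr ler_wpM2l ?(ltW C0) //.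
have h3 := post_lip x1 eta0 tT hS hd; have h4 := hd t tT.
have : 1 * eta <= T%:R * eta by rewrite ler_wpM2r // ler1n (leq_ltn_trans _ tT).
lra.
Qed.

Lemma eq_path_loss S d d' x1 : (forall t, (t < T)%N -> d t = d' t) ->
  ploss x1 S d = ploss x1 S d'.
Proof.
move=> dd'; apply/eqP; rewrite -subr_eq0 -normr_le0.
have := @path_loss_lip S S d d' x1 0 (lexx _) _ _; rewrite mulr0; apply=> r rT.
  by rewrite subrr normr0.
by rewrite dd' // subrr normr0.
Qed.

(* As long as stock never exceeds the caps, capping the demands leaves the path of
   stocks unchanged and shifts the loss by a term that does not involve S. *)
Lemma path_loss_capped S d a x1 :
  (forall t, (t < T)%N -> S t <= a t) -> x1 <= a 0%N ->
  (forall t, (t.+1 < T)%N -> a t <= a t.+1) -> (forall t, (t < T)%N -> 0 <= a t) ->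
  (forall t, (t < T)%N -> 0 <= d t) ->
  ploss x1 S (fun t => Num.min (d t) (a t)) =
  ploss x1 S d - \sum_(t < T) short M t * Num.max (d t - a t) 0.
Proof.
move=> Sa x1a amono a0 d0; set e := fun t => Num.min (d t) (a t).
have H t : (t < T)%N -> stock S e x1 t = stock S d x1 t /\ post S d x1 t <= a t.
  elim: t => [|t IH] tT; first by split => //; rewrite /post ge_max x1a Sa.
  have tT' : (t < T)%N by exact: ltnW.
  have [E pa] := IH tT'.
  have pa' : post S d x1 t - d t <= a t.+1.
    by have := d0 t tT'; have := amono t tT; lra.
  split; last by rewrite /post ge_max Sa // andbT /= ge_max pa' a0.
  rewrite -[stock S e x1 t.+1]/(Num.max (Num.max (stock S e x1 t) (S t) - e t) 0) E.
  rewrite -[stock S d x1 t.+1]/(Num.max (post S d x1 t - d t) 0) -/(post S d x1 t) /e.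
  have [//|ad] := leP (d t) (a t).
  by rewrite !max_r //; lra.
rewrite /path_loss -sumrB; apply: eq_bigr => t _; have tT := ltn_ord t.
have [E pa] := H t tT; have -> : post S e x1 t = post S d x1 t by rewrite /post E.
move: (post S d x1 t) pa => y pa; rewrite /e /cost.
have [da|ad] := leP (d t) (a t).
  by rewrite (max_r (_ : d t - a t <= 0)) ?subr_le0 // mulr0 subr0.
rewrite (max_r (_ : y - a t <= 0)) ?subr_le0 // (max_r (_ : y - d t <= 0)); last by lra.
rewrite (max_l (_ : 0 <= a t - y)) ?subr_ge0 // (max_l (_ : 0 <= d t - y)); last by lra.
by rewrite (max_l (_ : 0 <= d t - a t)); [ring|lra].
Qed.

End loss_regularity.

(** * From the regret to a deviation event on a grid *)

Section regret_reduction.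
Context {R : realType}.
Local Notation MR := (measurableTypeR R).
Variable M : inventory R.
Local Notation T := (horizon M).
Local Notation D := (dmax M).
Local Notation C := (cost_bound M).
Local Notation ploss := (path_loss (T := T) (cost M)).

Lemma measurable_loss_demand S x1 : measurable_fun [set: T.-tuple MR]
  (fun d : T.-tuple MR => (loss (M := M) (pi := base_stock S) tt x1 d)%:E).
Proof.
apply: (eq_measurable_fun (fun d : T.-tuple MR => (accum (stage_cost M)
    (pi := base_stock S) tt T (x1 : MR, [tuple]) (nth 0 d))%:E)).
  by move=> d _; rewrite loss_accum.
by apply: measurable_accum_demand => t; exact: measurable_stage_cost.
Qed.

Lemma nth_outcome (V : finType) (val : nat -> V -> R) (x : {ffun 'I_T -> V}) :
  nth 0 (outcome val x) = dem (fun t : 'I_T => val t) x.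
Proof.
apply/funext => t; rewrite /dem; case: insubP => [i _ <-|].
  by rewrite -(tnth_nth 0 (outcome val x) i) tnth_mktuple.
by rewrite -leqNgt => Tt; rewrite nth_default // size_tuple.
Qed.

Lemma dem_lt (V : finType) (val : 'I_T -> V -> R) (x : {ffun 'I_T -> V}) (t : 'I_T) :
  dem val x t = val t (x t).
Proof. by rewrite /dem valK. Qed.

Lemma risk_empirical n (s : nat -> seq R) S x1 : (0 < n)%N ->
  (forall t, (t < T)%N -> size (s t) = n) ->
  product_risk M (fun t => empirical (s t)) x1 S =
  ((n%:R ^+ T)^-1 * \sum_(j : {ffun 'I_T -> 'I_n})
     ploss x1 S (dem (fun (t : 'I_T) (i : 'I_n) => nth 0 (s t) i) j))%:E.
Proof.
move=> n0 sn; rewrite /product_risk.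
have := @integral_product_law_finite R T (fun t => empirical (s t)) 'I_n id
  (fun _ _ => n%:R^-1) (fun t i => nth 0 (s t) i)
  (fun d : T.-tuple MR => (loss (M := M) (pi := base_stock S) tt x1 d)%:E).
move=> h; rewrite (eq_integral (fun d : T.-tuple MR =>
   (loss (M := M) (pi := base_stock S) tt x1 (map_tuple id d))%:E)); last first.
  by move=> d _; congr (loss _ _ _)%:E; apply: val_inj; rewrite /= map_id.
rewrite h //; first last.
- by move=> d; rewrite lee_fin loss_ge0.
- exact: measurable_loss_demand.
- move=> t tT g mg g0; rewrite integral_empirical ?sn //.
rewrite mulr_sumr -sumEFin; apply: eq_bigr => j _.
rewrite prodr_const card_ord exprVn -EFinM loss_base_stock; congr (_ * _)%:E.
by rewrite nth_outcome.
Qed.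

Section rounding.
Variables (P : nat -> probability MR R) (m : nat) (eta x1 : R).
Hypothesis P_supp : supported M P.
Hypothesis eta_gt0 : 0 < eta.
Hypothesis eta_m : m%:R * eta = D.

Definition cellp (t : 'I_T) (k : 'I_m.+1) : R := fine (P t (cell_of eta k)).
Definition rounded_risk S : R :=
  \sum_x tweight cellp x * ploss x1 S (dem (fun _ => gridval eta) x).
Let kap : R := 3 * C * T%:R ^+ 2 * eta.

(** The levels may be rounded together with the demands. It serves for the empirical levels with
    [S'] on the grid, and for the optimal ones with [S'] equal to [S]. *)
Lemma risk_rounded S S' : (forall t, (t < T)%N -> `|S t - S' t| <= eta) ->
  exists2 rho, product_risk M P x1 S = rho%:E & `|rho - rounded_risk S'| <= kap.
Proof.
move=> SS'.
have kap0 : 0 <= kap by rewrite !mulr_ge0 ?sqr_ge0 ?(ltW (cost_bound_gt0 M)) ?(ltW eta_gt0).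
pose f S := fun d : T.-tuple MR => (loss (M := M) (pi := base_stock S) tt x1 d)%:E.
pose r := roundg m eta.
have mf S0 : measurable_fun [set: T.-tuple MR] (f S0) by exact: measurable_loss_demand.
have mr : measurable_fun [set: MR] (r : MR -> MR) by exact: measurable_roundg.
have mfr S0 : measurable_fun [set: T.-tuple MR] (fun d => f S0 (map_tuple (r : MR -> MR) d)).
  exact: (measurableT_comp (mf S0) (measurable_map_tuple mr)).
have f0 S0 d : (0 <= f S0 d)%E by rewrite lee_fin loss_ge0.
have rE : (\int[product_law P T]_d f S' (map_tuple (r : MR -> MR) d) = (rounded_risk S')%:E)%E.
  rewrite (@integral_product_law_finite R T P 'I_m.+1 r (fun t k => fine (P t (cell_of eta k)))
    (fun _ => @gridval R m eta) (f S')) //; first last.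
  - by move=> t _ g mg g0; exact: integral_roundg.
  - by move=> t k; rewrite fine_ge0.
  rewrite /rounded_risk -sumEFin; apply: eq_bigr => x _.
  by rewrite /f loss_base_stock nth_outcome -EFinM.
have aeD : {ae product_law P T, forall d : T.-tuple MR, forall t, (t < T)%N ->
    [set` `[0, D]] (nth 0 d t)}.
  apply: (@product_law_ae R T P (fun _ => [set` `[0, D]])) => [t _|t tT].
    exact: measurable_itv.
  exact: P_supp.
have close (d : T.-tuple MR) : (forall t, (t < T)%N -> [set` `[0, D]] (nth 0 d t)) ->
    `|loss (M := M) (pi := base_stock S) tt x1 d -
      loss (M := M) (pi := base_stock S') tt x1 (map_tuple (r : MR -> MR) d)| <= kap.
  move=> dD; rewrite !loss_base_stock; apply: path_loss_lip => //; first exact: ltW.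
  move=> t tT; rewrite (nth_map 0) ?size_tuple //; apply: roundg_near => //.
  by have := dD t tT; rewrite /= in_itv /= eta_m.
have le1 : (product_risk M P x1 S <= (rounded_risk S' + kap)%:E)%E.
  rewrite EFinD -rE -(integral_probability_cst (product_law P T) kap) -ge0_integralD //.
  apply: ae_ge0_le_integral => //.
  - by move=> d _; exact: (f0 S).
  - exact: (mf S).
  - by move=> d _; rewrite adde_ge0.
  - by apply: emeasurable_funD => //; exact: mfr.
  by move: aeD; apply: filterS => d /close h _; rewrite /f -EFinD lee_fin; move: h; rewrite ler_norml; lra.
have le2 : ((rounded_risk S')%:E <= product_risk M P x1 S + kap%:E)%E.
  rewrite -rE -(integral_probability_cst (product_law P T) kap) -ge0_integralD //;
    [|by move=> d _; exact: (f0 S)|exact: (mf S)].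
  apply: ae_ge0_le_integral => //.
  - by move=> d _; rewrite adde_ge0 ?f0.
  - by apply: emeasurable_funD => //; exact: mf.
  by move: aeD; apply: filterS => d /close h _; rewrite /f -EFinD lee_fin; move: h; rewrite ler_norml; lra.
have risk0 : (0 <= product_risk M P x1 S)%E by apply: integral_ge0 => d _; exact: f0.
have : product_risk M P x1 S \is a fin_num.
  by rewrite ge0_fin_numE // (le_lt_trans le1) // ltry.
move=> /fineK E; exists (fine (product_risk M P x1 S)); first by rewrite E.
by move: le1 le2; rewrite -E -EFinD !lee_fin ler_norml; lra.
Qed.

End rounding.

(** A single trajectory suffices. Almost surely the ERM levels have no Bellman gap and the demands
    lie in the supports, so such a trajectory exists. Along it the stock stays below the
    nondecreasing caps: the law gives full mass to demands at most a_t, so ordering beyond a_t would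
    be strictly worse than a_t and leave a gap. Finally S_t never exceeds the post-order level. *)
Lemma erm_levels_le (Q : nat -> probability MR R) (a : nat -> R) S x1 :
  0 <= x1 -> x1 <= a 0%N -> (forall t, (t < T)%N -> 0 <= a t <= D) ->
  (forall t, (t.+1 < T)%N -> a t <= a t.+1) ->
  (forall t, (t < T)%N -> Q t [set` `[0, (a t)]] = 1%E) ->
  supported M Q ->
  product_erm M Q x1 S -> forall t, (t < T)%N -> S t <= a t.
Proof.
move=> x10 x1a aD amono Qa Qs ermS.
have T0 := horizon_gt0 M.
have x1D : 0 <= x1 <= D by rewrite x10 (le_trans x1a) //; case/andP: (aD 0%N T0).
have [_ /(product_riskP Qs _ x10) aeS] := (product_ermP Qs S x1D).1 ermS.
have aeD : {ae product_law Q T, forall d : T.-tuple MR, forall t, (t < T)%N ->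
    [set` `[0, (a t)]] (nth 0 d t)}.
  apply: (@product_law_ae R T Q (fun t => [set` `[0, (a t)]])) => [t _|t tT].
    exact: measurable_itv.
  exact: Qa.
have PF : ProperFilter (almost_everywhere (product_law Q T)).
  apply: ae_properfilter_algebraOfSetsType.
  have E1 : product_law Q T setT = 1%E := probability_setT _.
  by apply: (@lt_le_trans _ _ (product_law Q T setT)); [rewrite E1|exact: lexx].
have [d [dS dD]] := filter_ex (filterI aeS aeD).
have qlt t : (t < T)%N -> ((critical_ratio M t)%:E < Q t [set` `]-oo, (a t)]])%E.
  move=> tT; apply: (@lt_le_trans _ _ 1%E).
    rewrite lte_fin /critical_ratio ltr_pdivrMr ?addr_gt0 ?hold_gt0 ?short_gt0 // mul1r.
    by rewrite ltrDr hold_gt0.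
  rewrite -(Qa t tT); apply: le_measure; rewrite ?inE; try exact: measurable_itv.
  by move=> x /=; rewrite !in_itv /= => /andP[].
have H t : (t < T)%N -> stock S (nth 0 d) x1 t <= a t -> post S (nth 0 d) x1 t <= a t.
  move=> tT st; rewrite leNgt; apply/negP => ap.
  have /andP[at0 _] := aD t tT.
  have := onward_lt (Qs t tT) tT (value_like_value Qs tT) (qlt t tT) ap.
  rewrite ltNge -/(onward_value M Q t _) -/(onward_value M Q t _) (dS t tT).
  by rewrite (value_le Qs tT) // ge_max st.
have I t : (t < T)%N -> stock S (nth 0 d) x1 t <= a t.
  elim: t => [|t IH] tT //.
  have tT' : (t < T)%N by exact: ltnW.
  have p1 := H t tT' (IH tT').
  rewrite -[stock _ _ _ _]/(Num.max (post S (nth 0 d) x1 t - nth 0 d t) 0) ge_max.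
  have := dD t tT'; rewrite /= in_itv /= => /andP[d0 _].
  have := amono t tT; have /andP[-> _] := aD t.+1 tT; rewrite andbT.
  by lra.
move=> t tT; apply: le_trans (H t tT (I t tT)).
by rewrite le_max lexx orbT.
Qed.

End regret_reduction.

Section regret_deviation.
Context {R : realType}.
Local Notation MR := (measurableTypeR R).
Variables (M : inventory R) (P : nat -> probability MR R).
Local Notation T := (horizon M).
Local Notation D := (dmax M).
Local Notation C := (cost_bound M).
Local Notation ploss := (path_loss (T := T) (cost M)).
Variables (m n : nat) (eta x1 eps : R) (S1 : nat -> R).
Hypothesis P_supp : supported M P.
Hypothesis eta_gt0 : 0 < eta.
Hypothesis eta_m : m%:R * eta = D.
Hypothesis eta_small : 3 * C * T%:R ^+ 2 * eta <= eps / 8.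
Hypothesis x1_range : 0 <= x1 <= D.
Hypothesis eps_gt0 : 0 < eps.
Hypothesis S1_risk : product_risk M P x1 S1 = (value M P 0 x1)%:E.
Hypothesis S1_feasible : feasible_levels M x1 S1.

Definition grid_levels (u : {ffun 'I_T -> 'I_m.+1}) : nat -> R :=
  dem (fun _ => gridval eta) u.

Definition grid_diff (u x : {ffun 'I_T -> 'I_m.+1}) : R :=
  loss_diff (cost M) x1 (fun _ => gridval eta) grid_levels S1 u x.

Definition bad_sample (w : {ffun 'I_n.+1 -> {ffun 'I_T -> 'I_m.+1}}) : bool :=
  [exists u, eps / 2 < vstat grid_diff u w - \sum_x tweight (cellp P eta) x * grid_diff u x].

Definition grid_sample (W : nat -> nat -> R) : {ffun 'I_n.+1 -> {ffun 'I_T -> 'I_m.+1}} :=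
  [ffun i : 'I_n.+1 => [ffun t : 'I_T => gridix m eta (W t i)]].

(** [W] holds the uncapped demands, whose law is P, while ERM only sees min (W, a). The budget is
    eps / 2 for the deviation and four rounding errors of at most eps / 8: two in the true risks,
    two in the empirical comparison. *)
Lemma regret_deviation (W : nat -> nat -> R) (a Sh : nat -> R) (s : nat -> seq R) :
  x1 <= a 0%N -> (forall t, (t < T)%N -> 0 <= a t <= D) ->
  (forall t, (t.+1 < T)%N -> a t <= a t.+1) ->
  (forall t, (t < T)%N -> S1 t <= a t) ->
  (forall t i, (t < T)%N -> (i < n.+1)%N -> 0 <= W t i <= D) ->
  (forall t, (t < T)%N -> size (s t) = n.+1) ->
  (forall t i, (t < T)%N -> (i < n.+1)%N -> nth 0 (s t) i = Num.min (W t i) (a t)) ->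
  product_erm M (fun t => empirical (s t)) x1 Sh ->
  ~~ bad_sample (grid_sample W) ->
  (policy_value M P (base_stock Sh) x1 - opt_value M P x1 <= eps%:E)%E.
Proof.
move=> x1a aD amono S1a WD ss snth ermS good.
have /andP[x10 x1D] := x1_range.
pose Q t := empirical (s t).
have s_in t x : (t < T)%N -> x \in s t -> 0 <= x <= a t.
  move=> tT /(nthP 0)[i]; rewrite ss // => iN <-; rewrite snth //.
  have /andP[w0 _] := WD t i tT iN; have /andP[a0 _] := aD t tT.
  by rewrite le_min w0 a0 ge_min lexx orbT.
have Qa t : (t < T)%N -> Q t [set` `[0, (a t)]] = 1%E.
  move=> tT; apply: empirical_supp; first exact: measurable_itv.
    by rewrite ss.
  by move=> x /(s_in t x tT); rewrite /= in_itv.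
have Qs : supported M Q.
  move=> t tT; apply: empirical_supp; first exact: measurable_itv.
    by rewrite ss.
  move=> x /(s_in t x tT) /andP[h1 h2]; rewrite /= in_itv /= h1 (le_trans h2) //.
  by case/andP: (aD t tT).
have Sha := erm_levels_le x10 x1a aD amono Qa Qs ermS.
have [Shf Shmin] := ermS.
pose dj (j : {ffun 'I_T -> 'I_n.+1}) := dem (fun (t : 'I_T) (i : 'I_n.+1) => W t i) j.
have djE j (t : 'I_T) : dj j t = W t (j t) by rewrite /dj dem_lt.
have dj0 j t : (t < T)%N -> 0 <= dj j t.
  by move=> tT; rewrite (djE j (Ordinal tT)); case/andP: (WD _ _ tT (ltn_ord (j (Ordinal tT)))).
pose shift j := \sum_(t < T) short M t * Num.max (dj j t - a t) 0.
have capE S j : (forall t, (t < T)%N -> S t <= a t) ->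
    ploss x1 S (dem (fun (t : 'I_T) (i : 'I_n.+1) => nth 0 (s t) i) j) =
    ploss x1 S (dj j) - shift j.
  move=> Sa; rewrite -(path_loss_capped Sa x1a amono) //; last first.
  - by move=> t tT; exact: dj0.
  - by move=> t tT; case/andP: (aD t tT).
  apply: eq_path_loss => t tT.
  by rewrite (djE j (Ordinal tT)) (dem_lt _ j (Ordinal tT)) snth.
have N0 : 0 < (n.+1%:R ^+ T)^-1 :> R by rewrite invr_gt0 exprn_gt0 // ltr0n.
(* The shift due to capping is the same for all levels below the caps and cancels, so empirical
   optimality passes from the capped to the uncapped demands. *)
have erm_le : \sum_(j : {ffun 'I_T -> 'I_n.+1}) ploss x1 Sh (dj j) <=
              \sum_(j : {ffun 'I_T -> 'I_n.+1}) ploss x1 S1 (dj j).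
  have := Shmin S1 S1_feasible; rewrite !(@risk_empirical R M n.+1) // lee_fin ler_pM2l //.
  under eq_bigr do rewrite capE //; under [leRHS]eq_bigr do rewrite capE //.
  by rewrite !sumrB lerD2r.
pose u : {ffun 'I_T -> 'I_m.+1} := [ffun t : 'I_T => gridix m eta (Sh t)].
have uE t : (t < T)%N -> grid_levels u t = roundg m eta (Sh t).
  by move=> tT; rewrite /grid_levels (dem_lt _ u (Ordinal tT)) ffunE.
have Shu t : (t < T)%N -> `|Sh t - grid_levels u t| <= eta.
  by move=> tT; rewrite uE //; apply: roundg_near => //; rewrite eta_m; exact: Shf.1.
have S11 t : (t < T)%N -> `|S1 t - S1 t| <= eta by rewrite subrr normr0 ltW.
have [rh rhE rhk] := risk_rounded x1 P_supp eta_gt0 eta_m Shu.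
have [r1 r1E r1k] := risk_rounded x1 P_supp eta_gt0 eta_m S11.
suff key : rh - r1 <= eps.
  have r1V : r1%:E = (value M P 0 x1)%:E by rewrite -r1E.
  rewrite policy_value_base_stock rhE.
  apply: (@le_trans _ _ (rh%:E - r1%:E)%E); last by rewrite -EFinB lee_fin.
  by apply: leeB => //; rewrite r1V; exact: opt_value_ge.
move: good; rewrite /bad_sample negb_exists => /forallP/(_ u); rewrite -leNgt => good.
set w := grid_sample W in good.
pose rj (j : {ffun 'I_T -> 'I_n.+1}) := dem (fun _ : 'I_T => gridval eta) [ffun t => w (j t) t].
have rjE j t : (t < T)%N -> `|dj j t - rj j t| <= eta.
  move=> tT; rewrite (djE j (Ordinal tT)) /rj (dem_lt _ _ (Ordinal tT)) !ffunE.
  apply: roundg_near => //; rewrite eta_m; exact: WD.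
have vge : - (2 * (3 * C * T%:R ^+ 2 * eta)) <= vstat grid_diff u w.
  rewrite /vstat [leRHS]mulrC ler_pdivlMr ?exprn_gt0 ?ltr0n //.
  have cK : n.+1%:R ^+ T = #|{ffun 'I_T -> 'I_n.+1}|%:R :> R.
    by rewrite card_ffun !card_ord natrX.
  rewrite cK mulr_natr -sumr_const.
  apply: (@le_trans _ _ (\sum_(j : {ffun 'I_T -> 'I_n.+1})
     (ploss x1 S1 (dj j) - ploss x1 Sh (dj j) - 2 * (3 * C * T%:R ^+ 2 * eta)))).
    by rewrite [leRHS]sumrB [X in _ <= X - _]sumrB sumrN; lra.
  apply: ler_sum => j _; rewrite /grid_diff /loss_diff -/(rj j).
  have h1 := path_loss_lip x1 (ltW eta_gt0) S11 (rjE j).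
  have h2 := path_loss_lip x1 (ltW eta_gt0) Shu (rjE j).
  by move: h1 h2; rewrite !ler_norml; lra.
have mE : \sum_x tweight (cellp P eta) x * grid_diff u x =
    rounded_risk M P m eta x1 S1 - rounded_risk M P m eta x1 (grid_levels u).
  by rewrite /rounded_risk -sumrB; apply: eq_bigr => x _; rewrite /grid_diff /loss_diff mulrBr.
by move: good rhk r1k eta_small; rewrite mE !ler_norml; lra.
Qed.

(** The factor 80 is the 20 of [deviation_bound] taken at deviation eps / 2. *)
Lemma bad_sample_rare delta : (0 < T)%N -> 0 < delta < 1 ->
  80 * (2 * 400 * T%:R * C * D) ^+ 2 / eps ^+ 2 * (1 + ln (1 / delta)) <= n.+1%:R ->
  \sum_(w | bad_sample w) pweight (tweight (cellp P eta)) w <= delta.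
Proof.
move=> T0 d01 nbig.
apply: (@deviation_bound R n T _ _ (cost M) C D x1) => //.
- exact: cost_bound_gt0.
- exact: dmax_gt0.
- by move=> t a b d tT; exact: cost_lip.
- by move=> t k; rewrite fine_ge0.
- by move=> t; exact: sum_cell.
- by move=> t k; case/andP: (gridval_range eta_gt0 k).
- move=> u s sT; rewrite /grid_levels (dem_lt _ u (Ordinal sT)) -eta_m; exact: gridval_range.
- by case: S1_feasible.
- by rewrite divr_gt0.
apply: le_trans nbig; apply: eq_ler; rewrite expr_div_n.
by field; rewrite gt_eqF.
Qed.

End regret_deviation.

(** * Conditioning on the design *)

Section conditional_probability.
Context {R : realType} {d : measure_display} {Omega : measurableType d}.
Variables (Pr : probability Omega R) (X : set (set Omega)) (E : set Omega).
Hypothesis mX : X `<=` measurable.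
Hypothesis mE : measurable E.

Local Notation Y := (g_sigma_algebraType X).

Lemma sub_sigma_measurable (A : set Omega) : <<s X >> A -> measurable A.
Proof. apply: smallest_sub; [exact: sigma_algebra_measurable|exact: mX]. Qed.

Definition coarsen (w : Omega) : Y := w.

Lemma measurable_coarsen : measurable_fun [set: Omega] coarsen.
Proof. by move=> _ A mA; rewrite setTI; exact: sub_sigma_measurable. Qed.

HB.instance Definition _ := isMeasurableFun.Build _ _ _ _ coarsen measurable_coarsen.

Definition joint (A : set Y) : \bar R := Pr (E `&` coarsen @^-1` A).

Let joint0 : joint set0 = 0%E.
Proof. by rewrite /joint preimage_set0 setI0 measure0. Qed.

Let joint_ge0 A : (0 <= joint A)%E.
Proof. exact: measure_ge0. Qed.

Let joint_sigma_additive : semi_sigma_additive joint.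
Proof.
move=> F mF tF mUF; rewrite /joint preimage_bigcup setI_bigcupr.
have mEF n : measurable (E `&` coarsen @^-1` F n).
  by apply: measurableI => //; exact: (sub_sigma_measurable (mF n)).
apply: measure_semi_sigma_additive => //.
- apply/trivIsetP => i j _ _ ij; move/trivIsetP : tF => /(_ _ _ Logic.I Logic.I ij) tij.
  by rewrite setIACA setIid -preimage_setI tij preimage_set0 setI0.
- exact: bigcup_measurable.
Qed.

HB.instance Definition _ := isMeasure.Build _ _ _ joint joint0 joint_ge0 joint_sigma_additive.

Let joint_fin : fin_num_fun joint.
Proof.
move=> A mA; rewrite fin_num_measure //; apply: measurableI => //.
exact: (sub_sigma_measurable mA).
Qed.

HB.instance Definition _ := Measure_isFinite.Build _ _ _ joint joint_fin.

(** The Radon-Nikodym derivative of [joint] with respect to the restriction of Pr to the smaller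
    sigma-algebra. That restriction is the image of Pr under [coarsen], the identity onto the same
    set with fewer measurable events. *)
Lemma cond_probability_exists :
  exists2 g, cond_probability Pr <<s X>> E g & forall w, 0 <= g w.
Proof.
pose mu : probability Y R := distribution Pr coarsen.
have dom : joint `<< mu.
  apply/null_content_dominatesP => A mA mu0.
  have mA' : measurable (coarsen @^-1` A) := sub_sigma_measurable mA.
  apply: (@subset_measure0 _ _ _ Pr _ (coarsen @^-1` A)) => //; exact: measurableI.
pose f := Radon_Nikodym_SigmaFinite.f joint mu.
have f0 := Radon_Nikodym_SigmaFinite.f_ge0 dom.
have ffin := Radon_Nikodym_SigmaFinite.f_fin_num dom.
have fint := Radon_Nikodym_SigmaFinite.f_integrable dom.
have mf : measurable_fun [set: Y] f by exact: measurable_int fint.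
exists (fun w => fine (f w)); last by move=> w; apply: fine_ge0; exact: f0.
split => //.
- move=> A mA.
  have := measurableT_comp (@fine_measurable R setT measurableT) mf.
  by move=> /(_ measurableT A mA); rewrite setTI.
- move=> B GB.
  have -> : Pr (E `&` B) = joint B by [].
  rewrite (Radon_Nikodym_SigmaFinite.f_integral dom) // -/f /mu.
  rewrite ge0_integral_pushforward //.
  + by apply: eq_integral => w _; rewrite /= fineK.
  + exact: measurable_funTS.
Qed.

End conditional_probability.

Section design.
Context {R : realType} {d : measure_display} {Omega : measurableType d}.
Local Notation MR := (measurableTypeR R).
Variables (M : inventory R) (P : nat -> probability MR R).
Variables (Pr : probability Omega R) (L : sales_logs R Omega).
Local Notation T := (horizon M).
Local Notation D := (dmax M).

Definition design_generators : set (set Omega) :=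
  [set E | (exists t j (A : set MR),
              [/\ (t < T)%N, (j < nlogs L t)%N, measurable A & E = boundary L t j @^-1` A]) \/
           (exists A : set (pilot_space L), measurable A /\ E = pilot L @^-1` A)].

Lemma design_generators_measurable : design_generators `<=` measurable.
Proof.
move=> E [[t [j [A [tT jN mA ->]]]]|[A [mA ->]]].
  by rewrite -[X in measurable X]setTI; exact: (@measurable_boundary _ _ _ L t j).
by rewrite -[X in measurable X]setTI; exact: (@measurable_pilot _ _ _ L).
Qed.

Lemma design_measurable E : design M L E -> measurable E.
Proof. exact: sub_sigma_measurable design_generators_measurable _. Qed.

Local Notation Y := (g_sigma_algebraType design_generators).

Lemma designP (E : set Omega) : design M L E <-> measurable (E : set Y).
Proof. by []. Qed.

Lemma designI E F : design M L E -> design M L F -> design M L (E `&` F).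
Proof. by rewrite !designP; exact: measurableI. Qed.

Lemma designT : design M L setT.
Proof. by rewrite designP; exact: measurableT. Qed.

Lemma design_all (I : finType) (F : I -> set Omega) :
  (forall i, design M L (F i)) -> design M L [set w | forall i, F i w].
Proof.
move=> dF; rewrite designP (_ : [set w | _] = \bigcap_(i in [set: I]) (F i : set Y)).
  by apply: fin_bigcap_measurable => // i _; exact: (dF i).
by apply/seteqP; split => w h i; [move=> _; exact: h|exact: h].
Qed.

Lemma design_lt (F : nat -> set Omega) n :
  (forall t, (t < n)%N -> design M L (F t)) ->
  design M L [set w | forall t, (t < n)%N -> F t w].
Proof.
move=> dF; rewrite (_ : [set w | _] = [set w | forall t : 'I_n, F t w]).
  by apply: design_all => t; exact: dF.
apply/seteqP; split => w h t; first exact: h.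
by move=> tn; exact: (h (Ordinal tn)).
Qed.

Section caps.
Variable lam : nat -> Omega -> R.
Hypothesis lam_adm : admissible_caps M L lam.
Local Notation cap := (carry_safe_cap M lam).

Lemma cap_range t w : (t < T)%N -> 0 <= cap t w <= D.
Proof.
move=> tT; have [_ lD] := lam_adm tT; have /andP[l0 lD'] := lD w.
apply/andP; split.
  rewrite /carry_safe_cap big_seq_cond; elim/big_ind: _ => // [x y x0 y0|s].
    by rewrite le_min x0.
  rewrite mem_index_iota andbT => /andP[_ sT].
  by have [_ /(_ w)/andP[]] := lam_adm sT.
by apply: le_trans lD'; exact: bigmin_le_id.
Qed.

Lemma cap_mono t w : (t.+1 < T)%N -> cap t w <= cap t.+1 w.
Proof.
move=> tT; have le_lam s : (t <= s < T)%N -> cap t w <= lam s w.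
  by move=> h; apply: ge_bigmin_seq => //; rewrite mem_index_iota.
rewrite {2}/carry_safe_cap big_seq_cond; elim/big_ind: _ => [|x y h1 h2|s].
- by apply: le_lam; rewrite leqnSn.
- by rewrite le_min h1.
- by rewrite mem_index_iota andbT => /andP[h1 h2]; apply: le_lam; rewrite (ltnW h1).
Qed.

Lemma measurable_lam t : (t < T)%N -> measurable_fun [set: Y] (lam t : Y -> MR).
Proof.
by move=> tT _ A mA; rewrite setTI; have [h _] := lam_adm tT; exact: h.
Qed.

Lemma measurable_cap t : (t < T)%N -> measurable_fun [set: Y] (cap t : Y -> MR).
Proof.
move=> tT; rewrite /carry_safe_cap.
have H (r : seq nat) : (forall s, s \in r -> (s < T)%N) ->
    measurable_fun [set: Y] (fun w : Y => \big[Num.min/lam t w]_(s <- r) lam s w : MR).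
  elim: r => [|s r IH] hr.
    by under eq_fun do rewrite big_nil; exact: measurable_lam.
  under eq_fun do rewrite big_cons; apply: measurable_minr.
    by apply: measurable_lam; apply: hr; rewrite mem_head.
  by apply: IH => s' s'r; apply: hr; rewrite in_cons s'r orbT.
by apply: H => s; rewrite mem_index_iota => /andP[].
Qed.

Lemma measurable_boundary_design t j : (t < T)%N -> (j < nlogs L t)%N ->
  measurable_fun [set: Y] (boundary L t j : Y -> MR).
Proof.
move=> tT jN _ A mA; rewrite setTI; apply: sub_sigma_algebra.
by left; exists t, j, A.
Qed.

Lemma design_eligible t (K : {set 'I_(nlogs L t)} -> Prop) : (t < T)%N ->
  design M L [set w | K (eligible M L lam t w)].
Proof.
move=> tT.
pose F (A : {set 'I_(nlogs L t)}) := [set w : Omega | eligible M L lam t w = A].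
have dF A : design M L (F A).
  rewrite (_ : F A = [set w | forall j : 'I_(nlogs L t), (cap t w <= boundary L t j w) = (j \in A)]).
    apply: design_all => j; apply/designP.
    have mb : measurable_fun [set: Y] (fun w : Y => cap t w <= boundary L t j w).
      apply: measurable_fun_ler; [exact: measurable_cap|exact: measurable_boundary_design].
    by have := mb measurableT [set (j \in A)] I; rewrite setTI.
  apply/seteqP; split => w; rewrite /F /=.
    by move=> <- j; rewrite inE.
  by move=> h; apply/setP => j; rewrite inE h.
rewrite (_ : [set w | _] = \bigcup_(A in [set A | K A]) (F A)).
  by apply/designP; apply: fin_bigcup_measurable => [|A _]; [exact: finite_finset|exact: (dF A)].
apply/seteqP; split => [w Kw|w [A KA wA]]; first by exists (eligible M L lam t w).
by rewrite /= (wA : eligible M L lam t w = A).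
Qed.

Lemma design_caps_valid x1 : design M L [set w | caps_valid M P lam x1 w].
Proof.
have T0 := horizon_gt0 M.
apply: designI.
  apply/designP.
  have mb : measurable_fun [set: Y] (fun w : Y => x1 <= cap 0 w).
    by apply: measurable_fun_ler; [exact: measurable_cst|exact: measurable_cap].
  by have := mb measurableT [set true] I; rewrite setTI.
apply: (@design_lt (fun t => [set w | ((critical_ratio M t)%:E < P t [set` `]-oo, (cap t w)[])%E])) => t tT.
(* This set of caps is upward closed, hence an interval and measurable. *)
pose A : set MR := [set a | ((critical_ratio M t)%:E < P t [set` `]-oo, (a : R)[])%E].
have mA : measurable A.
  apply: is_interval_measurable => a b Aa Ab z /andP[az zb].
  apply: (lt_le_trans Aa); apply: le_measure; rewrite ?inE; try exact: measurable_itv.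
  by move=> x /=; rewrite !in_itv /= => /lt_le_trans; apply.
by have := measurable_cap tT measurableT mA; rewrite setTI.
Qed.

End caps.

Lemma eq_nth_index_prod n (s : seq nat) N (F : nat -> R) (G : nat -> R) : uniq s -> size s = n ->
  (forall j, j \in s -> (j < N)%N) -> (forall j, (j < N)%N -> j \notin s -> F j = 1) ->
  (forall i, (i < n)%N -> F (nth 0%N s i) = G i) ->
  \prod_(j < N) F j = \prod_(i < n) G i.
Proof.
move=> us sn sN F1 FG.
rewrite -(big_mkord xpredT F) (bigID (fun j => j \in s)) /= [X in _ * X]big_nat_cond.
rewrite [X in _ * X]big1 ?mulr1; last by move=> j /andP[/andP[_ jN]]; exact: F1.
rewrite -big_filter (perm_big s); last first.
  apply: uniq_perm => //; first by rewrite filter_uniq // iota_uniq.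
  move=> j; rewrite mem_filter mem_index_iota /=.
  by case: (boolP (j \in s)) => // /sN ->.
rewrite (big_nth 0%N) big_mkord sn; apply: eq_bigr => i _; exact: FG.
Qed.

Hypothesis noninf : noninformative_censoring M P Pr L.

(** The conditional probability of a rectangle is a constant, so its integral over a design event
    factorises. *)
Lemma latent_rectangle (A : nat -> nat -> set MR) B : (forall t j, measurable (A t j)) ->
  design M L B ->
  Pr ([set w | forall t j, (t < T)%N -> (j < nlogs L t)%N -> A t j (latent L t j w)] `&` B) =
  ((\prod_(t < T) \prod_(j < nlogs L t) fine (P t (A t j)))%:E * Pr B)%E.
Proof.
move=> mA dB; have [_ _ h] := noninf mA; rewrite -(h B dB) integral_cst //.
exact: design_measurable.
Qed.

Lemma latent_range : supported M P ->
  {ae Pr, forall w, forall t j, (t < T)%N -> (j < nlogs L t)%N -> 0 <= latent L t j w <= D}.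
Proof.
move=> Ps; pose A (t j : nat) : set MR := if (t < T)%N then [set` `[0, D]] else setT.
have mA t j : measurable (A t j).
  by rewrite /A; case: ifP => _; [exact: measurable_itv|exact: measurableT].
have [mE _ _] := noninf mA.
have := latent_rectangle mA designT; set E := [set w | _] in mE *.
rewrite setIT big1 ?mul1e; last first.
  move=> t _; rewrite big1 // => j _; rewrite /A ltn_ord.
  exact: (congr1 fine (Ps t (ltn_ord t))).
rewrite probability_setT => E1; exists (~` E); split.
- exact: measurableC.
- by rewrite probability_setC // E1 subee.
- move=> w; apply: contra_not => Ew t j tT jN.
  by have := Ew t j tT jN; rewrite /A tT /= in_itv.
Qed.

Section cells.
Variables (m n : nat) (eta : R) (s : nat -> seq nat).
Hypothesis s_uniq : forall t, (t < T)%N -> uniq (s t).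
Hypothesis s_size : forall t, (t < T)%N -> size (s t) = n.+1.
Hypothesis s_lt : forall t j, (t < T)%N -> j \in s t -> (j < nlogs L t)%N.
Hypothesis eta_gt0 : 0 < eta.

Definition logged (w : Omega) (t i : nat) : R := latent L t (nth 0%N (s t) i) w.

(** For fixed index lists, that the rounded sample equals [v] is a rectangle event: a grid cell for
    each selected index, the whole line for the others, which contribute factors 1. *)
Lemma latent_cells (v : {ffun 'I_n.+1 -> {ffun 'I_T -> 'I_m.+1}}) B : design M L B ->
  measurable [set w | grid_sample M m n eta (logged w) = v] /\
  Pr ([set w | grid_sample M m n eta (logged w) = v] `&` B) =
  ((pweight (tweight (cellp P eta)) v)%:E * Pr B)%E.
Proof.
move=> dB.
pose A (t j : nat) : set MR := if insub t is Some t' then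
    if j \in s t then cell_of eta (v (inord (index j (s t))) t') else setT
  else setT.
have mA t j : measurable (A t j).
  rewrite /A; case: insubP => [t' _ _|_]; last exact: measurableT.
  by case: ifP => _; [exact: measurable_cell|exact: measurableT].
have E : [set w | grid_sample M m n eta (logged w) = v] =
    [set w | forall t j, (t < T)%N -> (j < nlogs L t)%N -> A t j (latent L t j w)].
  apply/seteqP; split => w /=.
    move=> vE t j tT jN; rewrite /A insubT; case: ifP => // js.
    rewrite /cell_of /= -vE !ffunE inordK; last by rewrite -(s_size tT) index_mem.
    by rewrite /logged nth_index.
  move=> h; apply/ffunP => i; apply/ffunP => t; rewrite !ffunE.
  have is_ : (i < size (s t))%N by rewrite s_size.
  have := h t (nth 0%N (s t) i) (ltn_ord t) (s_lt (ltn_ord t) (mem_nth _ is_)).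
  rewrite /A valK mem_nth // /cell_of /= /logged => ->; congr (v _ _).
  by rewrite index_uniq ?s_uniq // inord_val.
have [mE _ _] := noninf mA.
rewrite E; split=> //; rewrite latent_rectangle //; congr (_%:E * _)%E.
rewrite /pweight /tweight exchange_big /=; apply: eq_bigr => t _.
have tT := ltn_ord t.
rewrite (@eq_nth_index_prod n.+1 (s t) _ (fun j => fine (P t (A t j)))
  (fun i => cellp P eta t (v (inord i) t))) ?s_uniq ?s_size //.
- by apply: eq_bigr => i _; rewrite inord_val.
- by move=> j; exact: s_lt.
- move=> j _ /negbTE js; rewrite /A valK js.
  exact: (congr1 fine (probability_setT (P t))).
- move=> i iN; have is_ : (i < size (s t))%N by rewrite s_size.
  by rewrite /A valK mem_nth // index_uniq ?s_uniq.
Qed.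

(** A bad sample is one of finitely many grid samples; the bound follows from subadditivity and the
    exact weight of each, within the design event [B]. *)
Lemma bad_sample_prob x1 eps S1 delta B : design M L B ->
  \sum_(v : {ffun 'I_n.+1 -> {ffun 'I_T -> 'I_m.+1}} | bad_sample P eta x1 eps S1 v)
    pweight (tweight (cellp P eta)) v <= delta ->
  let G := [set w | bad_sample P eta x1 eps S1 (grid_sample M m n eta (logged w))] in
  measurable G /\ (Pr (G `&` B) <= delta%:E * Pr B)%E.
Proof.
move=> dB rare G.
pose F v := [set w : Omega | grid_sample M m n eta (logged w) = v].
have mB := design_measurable dB.
have GE : G = \big[setU/set0]_(v | bad_sample P eta x1 eps S1 v) F v.
  rewrite -bigcup_seq_cond.
  apply/seteqP; split => [w Gw|w [v /= /andP[_ bv] Fv]].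
    by exists (grid_sample M m n eta (logged w)) => //=; rewrite mem_index_enum.
  by rewrite /G /= Fv.
have mF v : measurable (F v) by have [] := latent_cells v dB.
split; first by rewrite GE; apply: bigsetU_measurable.
have le_sum (r : seq {ffun 'I_n.+1 -> {ffun 'I_T -> 'I_m.+1}}) (Q : pred _) :
    (Pr ((\big[setU/set0]_(v <- r | Q v) F v) `&` B) <= \sum_(v <- r | Q v) Pr (F v `&` B))%E.
  elim: r => [|v r IH]; first by rewrite !big_nil set0I measure0.
  rewrite !big_cons; case: (Q v) => //.
  rewrite setIUl; apply: (le_trans (measureU2 _ _ _)); try apply: measurableI => //.
    exact: bigsetU_measurable.
  by rewrite leeD2l.
rewrite GE; apply: (le_trans (le_sum _ _)).
rewrite (eq_bigr (fun v => (pweight (tweight (cellp P eta)) v)%:E * Pr B)%E); last first.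
  by move=> v _; have [_] := latent_cells v dB.
rewrite -ge0_sume_distrl; last first.
  move=> v _; rewrite lee_fin; apply: pweight_ge0 => x; apply: tweight_ge0 => t k.
  by rewrite fine_ge0.
by rewrite sumEFin lee_wpmul2r // lee_fin.
Qed.

End cells.

End design.

(** * The regret guarantee given the design *)

Section guarantee.
Context {R : realType} {d : measure_display} {Omega : measurableType d}.
Local Notation MR := (measurableTypeR R).
Variables (M : inventory R) (P : nat -> probability MR R).
Variables (Pr : probability Omega R) (L : sales_logs R Omega).
Variables (lam : nat -> Omega -> R) (x1 : R).
Local Notation T := (horizon M).
Local Notation D := (dmax M).
Local Notation cap := (carry_safe_cap M lam).
Hypothesis P_supp : supported M P.
Hypothesis noninf : noninformative_censoring M P Pr L.
Hypothesis lam_adm : admissible_caps M L lam.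
Hypothesis x1_ge0 : 0 <= x1.

Lemma caps_valid_range w : caps_valid M P lam x1 w -> 0 <= x1 <= D.
Proof.
have T0 := horizon_gt0 M.
move=> [x1c _]; rewrite x1_ge0 (le_trans x1c) //.
by case/andP: (cap_range lam_adm w T0).
Qed.

Lemma product_erm_dp n : (0 < n)%N ->
  erm_is_dp M Pr L lam x1 n (fun w => caps_valid M P lam x1 w /\
    forall t, (t < T)%N -> (n <= #|eligible M L lam t w|)%N).
Proof.
move=> n0 sel [_ selP].
apply: filterS (latent_range noninf P_supp) => w lat [cv el] S.
pose Q := empirical_marginals M lam sel w.
have Qs : supported M Q.
  move=> t tT; apply: empirical_supp; first exact: measurable_itv.
    by rewrite size_map -cardE; have [_ ->] := selP w el t tT.
  move=> x /mapP[j _ ->]; rewrite /= in_itv /= /capped_sales /sales.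
  have /andP[l0 lD] := lat t j tT (ltn_ord j); have b0 := boundary_ge0 L t j w.
  have /andP[c0 cD] := cap_range lam_adm w tT.
  by rewrite !le_min l0 b0 c0 !ge_min lD.
have x1D := caps_valid_range cv.
by rewrite (product_ermP Qs S x1D) (product_dpP Qs S x1_ge0).
Qed.

Lemma measurable_policy_value (Sh : nat -> Omega -> MR) :
  (forall t, (t < T)%N -> measurable_fun setT (Sh t)) ->
  measurable_fun setT (fun w => policy_value M P (base_stock (Sh ^~ w)) x1).
Proof.
move=> mS; pose X := (Omega * T.-tuple MR)%type.
have mSX t : (t < T)%N -> measurable_fun [set: X] (fun z => Sh t z.1 : MR).
  by move=> tT; exact: (measurableT_comp (mS t tT) measurable_fst).
have md t : measurable_fun [set: X] (fun z : X => nth 0 z.2 t : MR).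
  exact: (measurableT_comp (measurable_nth (R := R) (n := T) t) measurable_snd).
have mst t : (t < T)%N ->
    measurable_fun [set: X] (fun z : X => stock (Sh ^~ z.1) (nth 0 z.2) x1 t : MR).
  elim: t => [|t IH] tT; first exact: measurable_cst.
  have tT' := ltnW tT.
  exact: (measurable_maxr (measurable_funB (measurable_maxr (IH tT') (mSX t tT')) (md t))
    (@measurable_cst _ _ X MR setT 0)).
have mpost t : (t < T)%N ->
    measurable_fun [set: X] (fun z : X => post (Sh ^~ z.1) (nth 0 z.2) x1 t : MR).
  by move=> tT; exact: (measurable_maxr (mst t tT) (mSX t tT)).
pose f (z : X) := (path_loss (T := T) (cost M) x1 (Sh ^~ z.1) (nth 0 z.2))%:E.
have mf : measurable_fun [set: X] f.
  apply/measurable_EFinP; apply: measurable_sum => t.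
  have mc : measurable_fun [set: X] (fun z : X =>
      (0 : MR, post (Sh ^~ z.1) (nth 0 z.2) x1 t : MR, nth 0 z.2 t : MR)).
    apply/measurable_fun_pairP; split; last exact: md.
    by apply/measurable_fun_pairP; split; [exact: measurable_cst|exact: mpost].
  exact: (measurableT_comp (measurable_stage_cost M t) mc).
have f0 z : (0 <= f z)%E.
  by rewrite lee_fin; apply: sumr_ge0 => t _; exact: cost_ge0.
have h := @measurable_fun_fubini_tonelli_F _ _ _ _ R (product_law P T) f mf f0.
apply: (eq_measurable_fun _ _ h) => w _; rewrite policy_value_base_stock.
by apply: eq_integral => z _; rewrite /f loss_base_stock.
Qed.

(** On a design event [B A] where the selection is constant and [g] < 1 - delta, the good event E
    contains almost every point with a good sample, so Pr (E, B) >= (1 - delta) Pr B. But Pr (E, B)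
    is the integral of [g] over B, so 1 - delta - g, positive on B, has integral at most 0 there,
    and B is null. *)
Lemma regret_guarantee n eps delta (Ev : Omega -> Prop) :
  design M L [set w | Ev w] ->
  (forall w, Ev w -> caps_valid M P lam x1 w /\
    forall t, (t < T)%N -> (n.+1 <= #|eligible M L lam t w|)%N) ->
  0 < eps -> 0 < delta < 1 ->
  80 * (2 * 400 * T%:R * cost_bound M * D) ^+ 2 / eps ^+ 2 * (1 + ln (1 / delta)) <= n.+1%:R ->
  erm_guarantee M P Pr L lam x1 n.+1 eps delta Ev.
Proof.
move=> dEv EvP eps0 d01 nbig sel [dsel selP] Sh mS ae_erm.
have T0 := horizon_gt0 M; have D0 := dmax_gt0 M; have C0 := cost_bound_gt0 M.
set E := [set w | _].
have mE : measurable E.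
  have mF : measurable_fun [set: Omega] (fun w =>
      policy_value M P (base_stock (Sh ^~ w)) x1 - opt_value M P x1)%E.
    by apply: emeasurable_funB; [exact: measurable_policy_value|exact: measurable_cst].
  have := mF measurableT [set x | (x <= eps%:E)%E] _; rewrite setTI; apply.
  rewrite (_ : [set x | _] = [set` `]-oo, eps%:E]]); first exact: emeasurable_itv.
  by apply/seteqP; split => x; rewrite /= in_itv.
have [g gP g0] := cond_probability_exists Pr (@design_generators_measurable R d Omega M L) mE.
have [_ dg intg] := gP.
exists g; split=> //.
have mg : measurable_fun [set: Omega] (g : Omega -> MR).
  move=> _ A mA; rewrite setTI; apply: (@design_measurable R d Omega M L); exact: dg.
(* A point of [Ev] provides x1 <= D, under which the optimal levels exist; if there is none, the
   claim is void. *)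
have [[w0 Ew0]|noE] := pselect (exists w, Ev w); last first.
  by apply: aeW => w Ew; exfalso; apply: noE; exists w.
have x1D := caps_valid_range (EvP w0 Ew0).1.
have [S1 [S1f S1r S1a]] := optimal_levels P_supp x1D.
(* 24 = 3 * 8: a mesh D / m with m >= z makes the rounding error 3 C T^2 eta at most eps / 8. *)
pose z := 24 * cost_bound M * T%:R ^+ 2 * D / eps.
have z0 : 0 <= z by rewrite /z divr_ge0 ?mulr_ge0 ?exprn_ge0 ?ler0n ?ltW.
pose m := (Num.bound z).+1.
have zm : z <= m%:R.
  by apply: ltW; apply: (lt_trans (archi_boundP z0)); rewrite ltr_nat.
have m0 : 0 < m%:R :> R by rewrite ltr0n.
pose eta := D / m%:R.
have eta0 : 0 < eta by rewrite divr_gt0.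
have eta_m : m%:R * eta = D by rewrite /eta mulrC divfK // gt_eqF.
have eta_small : 3 * cost_bound M * T%:R ^+ 2 * eta <= eps / 8.
  move: zm; rewrite /z ler_pdivrMr // => zm.
  rewrite /eta mulrA ler_pdivrMr //; lra.
have rare := bad_sample_rare P eta0 eta_m x1D eps0 S1f T0 d01 nbig.
pose K := {dffun forall t : 'I_T, {set 'I_(nlogs L t)}}.
pose B (A : K) := [set w | Ev w /\ (forall t : 'I_T, sel t w = A t) /\ g w < 1 - delta].
(* A selection takes finitely many values A, so it suffices to show that each of the
   design events B A is negligible. *)
suff nullB A : {ae Pr, forall w, ~ B A w}.
  have nBall : {ae Pr, forall w, forall A : K, ~ B A w} by apply: filter_forall.
  apply: filterS nBall => w nB Ew.
  rewrite leNgt; apply/negP => glt.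
  by apply: (nB (finfun (fun t : 'I_T => sel t w) : K)); split=> //; split=> // t; rewrite ffunE.
have dB : design M L (B A).
  apply: designI => //; apply: designI.
    by apply: (@design_all R d Omega M L _ (fun t : 'I_T => sel t @^-1` [set A t])) => t; exact: dsel.
  have := dg [set` `]-oo, (1 - delta)[] (measurable_itv _).
  by rewrite (_ : g @^-1` _ = [set w | g w < 1 - delta]) //; apply/seteqP; split => w; rewrite /= in_itv.
have mB := design_measurable dB.
(* A point of [B A] shows that [A] is the value of a selection there, hence has n + 1 indices in
   each period. *)
have [[w1 Bw1]|noB] := pselect (exists w, B A w); last first.
  by apply: aeW => w Bw; apply: noB; exists w.
have cardA (t : 'I_T) : #|A t| = n.+1.
  have [Ew1 [selw1 _]] := Bw1; rewrite -selw1.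
  by have [_] := selP w1 (EvP w1 Ew1).2 t (ltn_ord t).
(* The indices are listed in the enumeration order used by [empirical_marginals], so that i-th
   entries correspond. *)
pose s (t : nat) : seq nat := if insub t is Some t' then map val (enum (A t')) else [::].
have sE (t : 'I_T) : s t = map val (enum (A t)) by rewrite /s valK.
have s_uniq t : (t < T)%N -> uniq (s t).
  by move=> tT; rewrite (sE (Ordinal tT)) map_inj_uniq ?enum_uniq //; exact: val_inj.
have s_size t : (t < T)%N -> size (s t) = n.+1.
  by move=> tT; rewrite (sE (Ordinal tT)) size_map -cardE cardA.
have s_lt t j : (t < T)%N -> j \in s t -> (j < nlogs L t)%N.
  by move=> tT; rewrite (sE (Ordinal tT)) => /mapP[i _ ->]; exact: ltn_ord.
have [mG leG] := bad_sample_prob noninf s_uniq s_size s_lt eta0 dB rare.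
set G := [set w | _] in mG leG.
have aeE : {ae Pr, forall w, B A w -> G w \/ E w}.
  apply: filterS2 (latent_range noninf P_supp) ae_erm => w lat erm [Ew [selw _]].
  have [gw|/negP ngw] := pselect (G w); [by left|right].
  have [[x1c qc] el] := EvP w Ew.
  have selt t : (t < T)%N -> (sel t w \subset eligible M L lam t w) /\ #|sel t w| = n.+1.
    exact: selP.
  apply: (@regret_deviation R M P m n eta x1 eps S1 P_supp eta0 eta_m eta_small x1D S1r S1f
    (logged L s w) (cap ^~ w) (Sh ^~ w)
    (fun t => [seq capped_sales M L lam t j w | j : 'I_(nlogs L t) <- enum (sel t w)])) => //.
  - by move=> t tT; exact: (cap_range lam_adm).
  - by move=> t tT; exact: (cap_mono _ _ tT).
  - apply: S1a => // t tT; split; first by case/andP: (cap_range lam_adm w tT).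
    apply: (lt_le_trans (qc t tT)); apply: le_measure; rewrite ?inE; try exact: measurable_itv.
    by move=> x /=; rewrite !in_itv /=; exact: ltW.
  - move=> t i tT iN; rewrite /logged; apply: lat => //; apply: s_lt => //.
    by apply: mem_nth; rewrite s_size.
  - by move=> t tT; rewrite size_map -cardE; have [_ ->] := selt t tT.
  - move=> t i tT iN; have iA : (i < size (enum (A (Ordinal tT))))%N by rewrite -cardE cardA.
    rewrite (selw (Ordinal tT)) /logged (sE (Ordinal tT)).
    have [j0 _] : exists j0, j0 \in enum (A (Ordinal tT)).
      by case: (enum _) iA => // j0 r _; exists j0; rewrite mem_head.
    rewrite !(nth_map j0) //= /capped_sales /sales.
    set j := nth j0 _ i; have jel : j \in eligible M L lam t w.
      have [/fintype.subsetP sub _] := selt t tT; apply: sub.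
      by rewrite (selw (Ordinal tT)) -mem_enum mem_nth.
    by move: jel; rewrite inE => cb; rewrite -minA (min_r cb).
  - exact: erm.
have [dl0 dl1] := andP d01.
(* From Pr B <= delta Pr B + Pr (E, B) to the lower bound on Pr (E, B); the subtraction requires
   finite values. *)
have solve (a b : \bar R) : a \is a fin_num -> b \is a fin_num ->
    (a <= delta%:E * a + b -> (1 - delta)%:E * a <= b)%E.
  by move=> /fineK <- /fineK <-; rewrite -!EFinM -EFinD !lee_fin; lra.
have leB : ((1 - delta)%:E * Pr (B A) <= Pr (E `&` B A))%E.
  have : (Pr (B A) <= Pr ((G `&` B A) `|` (E `&` B A)))%E.
    have [N [mN N0 NP]] := aeE.
    have mU : measurable ((G `&` B A) `|` (E `&` B A)) by apply: measurableU; exact: measurableI.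
    rewrite -(measureU0 mU mN N0); apply: le_measure; rewrite ?inE //; first exact: measurableU.
    move=> w Bw; have [GEw|nGE] := pselect (G w \/ E w).
      by left; case: GEw => h; [left|right].
    by right; apply: NP => /(_ Bw).
  have mGB : measurable (G `&` B A) by exact: measurableI.
  have mEB : measurable (E `&` B A) by exact: measurableI.
  move=> /le_trans /(_ (measureU2 _ mGB mEB)) h.
  have fB : Pr (B A) \is a fin_num by rewrite fin_num_measure.
  have fE : Pr (E `&` B A) \is a fin_num by rewrite fin_num_measure.
  apply: (solve _ _ fB fE); exact: (le_trans h (leeD2r _ leG)).
pose h w := 1 - delta - g w.
have mh : measurable_fun (B A) (fun w => (h w)%:E).
  apply/measurable_EFinP/measurable_funB; first exact: measurable_cst.
  exact: measurable_funTS.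
have h0 w : B A w -> 0 < h w by move=> [_ [_ gw]]; rewrite subr_gt0.
have inth : (\int[Pr]_(w in B A) (h w)%:E = 0)%E.
  apply/eqP; rewrite eq_le; apply/andP; split; last first.
    by apply: integral_ge0 => w /h0 /ltW; rewrite lee_fin.
  have Esum : (\int[Pr]_(w in B A) (h w)%:E + \int[Pr]_(w in B A) (g w)%:E =
               (1 - delta)%:E * Pr (B A))%E.
    rewrite -ge0_integralD //; first last.
    - by apply/measurable_EFinP; exact: measurable_funTS.
    - by move=> w _; rewrite lee_fin.
    - by move=> w /h0 /ltW; rewrite lee_fin.
    rewrite -integral_cst //; apply: eq_integral => w _.
    by rewrite -EFinD /h subrK.
  have fE : Pr (E `&` B A) \is a fin_num by rewrite fin_num_measure //; exact: measurableI.
  have intE : (\int[Pr]_(w in B A) (g w)%:E = Pr (E `&` B A))%E by exact: intg.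
  move: Esum leB; rewrite intE => <-; rewrite -[leRHS]add0e.
  by rewrite leeD2rE.
have := ae_eq_integral_abs Pr mB mh => -[/(_ _) + _].
rewrite (eq_integral (fun w => (h w)%:E)); last first.
  by move=> w; rewrite inE => /h0 hw; rewrite gee0_abs // lee_fin ltW.
move=> /(_ inth); apply: filterS => w hw Bw.
by have := h0 w Bw; have := EFin_inj (hw Bw) => ->; rewrite ltxx.
Qed.

End guarantee.

(** * Constants and sample sizes *)

Lemma nat_ceil (R : realType) (x : R) : 0 <= x ->
  exists n : nat, [/\ (0 < n)%N, x <= n%:R & n%:R <= x + 1].
Proof.
move=> x0; have /andP[h1 h2] := truncn_itv x0.
exists (Num.truncn x).+1; split=> //; first exact: ltW.
by rewrite -natr1 lerD2r.
Qed.

Theorem theorem5 (R : realType) :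
  exists C K : R, [/\ 0 < C, 0 < K &
  forall (M : inventory R) (eps delta : R), 0 < eps -> 0 < delta < 1 ->
  let T := horizon M in
  let rate := fun k : nat => cost_bound M ^+ 2 * dmax M ^+ 2 * T%:R ^+ k / eps ^+ 2
                       * (1 + ln (1 / delta)) in
  (forall (d : measure_display) (Omega : measurableType d) (Pr : probability Omega R)
     (L : sales_logs R Omega) (P : nat -> probability (measurableTypeR R) R)
     (lam : nat -> Omega -> R) (x1 : R) (n : nat),
     supported M P -> noninformative_censoring M P Pr L -> admissible_caps M L lam ->
     0 <= x1 -> (0 < n)%N ->
     let Ev := fun w => caps_valid M P lam x1 w /\
       forall t, (t < T)%N -> (n <= #|eligible M L lam t w|)%N in
     erm_is_dp M Pr L lam x1 n Ev /\
     (C * rate 2%N <= n%:R -> erm_guarantee M P Pr L lam x1 n eps delta Ev)) /\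
  (forall r : R, 0 < r <= 1 ->
   exists N0 : nat, T%:R * N0%:R <= K * (T%:R / r + rate 3%N / r) /\
   forall N : nat, (N0 <= N)%N ->
   exists n : nat, [/\ (0 < n)%N, C * rate 2%N <= n%:R, n%:R <= r * N%:R &
   forall (d : measure_display) (Omega : measurableType d) (Pr : probability Omega R)
     (L : sales_logs R Omega) (P : nat -> probability (measurableTypeR R) R)
     (lam : nat -> Omega -> R) (x1 : R),
     supported M P -> noninformative_censoring M P Pr L -> admissible_caps M L lam ->
     0 <= x1 -> (forall t, (t < T)%N -> nlogs L t = N) ->
     let Ev := fun w => caps_valid M P lam x1 w /\
       forall t, (t < T)%N -> r * N%:R <= #|eligible M L lam t w|%:R in
     erm_guarantee M P Pr L lam x1 n eps delta Ev])].
Proof.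
(* The product of 80 = 20 * 2^2, for deviations of eps / 2, and the (2 * 400)^2 of
   [rmean_loss_diff]. *)
pose C : R := 80 * (2 * 400) ^+ 2.
have C0 : 0 < C by rewrite mulr_gt0 ?exprn_gt0 ?mulr_gt0 ?ltr0n.
exists C, (C + 2); split=> //; first by rewrite addr_gt0.
move=> M eps delta eps0 d01 T rate.
have e0 : eps != 0 by rewrite gt_eqF.
have ln0 : 0 <= ln (1 / delta).
  have /andP[dl0 dl1] := d01.
  by rewrite ln_ge0 // ler_pdivlMr // mul1r ltW.
have rate0 k : 0 <= rate k.
  have Cb := ltW (cost_bound_gt0 M); have Db := ltW (dmax_gt0 M).
  by rewrite mulr_ge0 ?addr_ge0 // divr_ge0 ?mulr_ge0 ?exprn_ge0 // ltW.
have rateE : 80 * (2 * 400 * T%:R * cost_bound M * dmax M) ^+ 2 / eps ^+ 2 * (1 + ln (1 / delta))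
    = C * rate 2%N by rewrite /C /rate; field.
split.
  move=> d Omega Pr L P lam x1 [|n] Ps noninf adm x10 // _ Ev; split.
    exact: product_erm_dp.
  rewrite -rateE => nbig; apply: regret_guarantee => //.
  apply: designI; first exact: design_caps_valid.
  apply: (@design_lt _ _ _ M L (fun t => [set w | (n.+1 <= #|eligible M L lam t w|)%N])) => t tT.
  exact: (design_eligible adm (fun A => (n.+1 <= #|A|)%N) tT).
move=> r /andP[r0 r1].
have [[|n0] [// _ n0_ge n0_le]] := nat_ceil (mulr_ge0 (ltW C0) (rate0 2%N)).
(* N0 >= n / r logs per period guarantee r N >= n eligible ones as soon as N >= N0. *)
have [N0 [_ N0_ge N0_le]] := nat_ceil (divr_ge0 (ler0n R n0.+1) (ltW r0)).
exists N0; split.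
  have T1 : 0 <= T%:R / r by rewrite divr_ge0 // ltW.
  have T2 : 0 <= rate 3%N / r by rewrite divr_ge0 // ltW.
  have rE : 1 <= r^-1 by rewrite -[1]invr1 lef_pV2 ?posrE.
  (* Each of the two integer roundings costs at most 1, that is at most 1 / r after division since r
     <= 1; together they give the 2 T / r in the bound, whence C + 2. *)
  have h1 : T%:R * N0%:R <= T%:R * ((C * rate 2%N + 1) / r + r^-1).
    rewrite ler_wpM2l // (le_trans N0_le) // lerD //.
    by rewrite ler_wpM2r ?invr_ge0 // ltW.
  have h2 : T%:R * ((C * rate 2%N + 1) / r + r^-1) = C * (rate 3%N / r) + 2 * (T%:R / r).
    by rewrite /rate; field; rewrite e0 gt_eqF.
  have h3 : 0 <= C * (T%:R / r) by rewrite mulr_ge0 // ltW.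
  by rewrite (le_trans h1) // h2; lra.
move=> N NN0; exists n0.+1; split=> //.
  have : N0%:R <= N%:R :> R by rewrite ler_nat.
  by move=> /(le_trans N0_ge); rewrite ler_pdivrMr // mulrC.
move=> d Omega Pr L P lam x1 Ps noninf adm x10 NE Ev.
apply: regret_guarantee => //; last by rewrite rateE.
  apply: designI; first exact: design_caps_valid.
  apply: (@design_lt _ _ _ M L (fun t => [set w | r * N%:R <= #|eligible M L lam t w|%:R])) => t tT.
  exact: (design_eligible adm (fun A => r * N%:R <= #|A|%:R) tT).
move=> w [cv el]; split=> // t tT.
rewrite -(ler_nat R); apply: le_trans (el t tT).
have : N0%:R <= N%:R :> R by rewrite ler_nat.
by move=> /(le_trans N0_ge); rewrite ler_pdivrMr // mulrC.
Qed.
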